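(* Let $X$ be a Calabi-Yau manifold of complex dimension $n$ with Ricci-flat Kähler metric $g$, complex structure $J$ and Kähler form $\omega(Y,Z)=g(Y,JZ)$, and let $j:\Lambda\hookrightarrow X$ be a Lagrangian embedding of a connected manifold $\Lambda$. Fix $p\in\Lambda$. For $q\in\Lambda$ and a path $\gamma$ in $\Lambda$ from $p$ to $q$, let $(\mathcal D_\gamma)_q\subset T_qX$ be the image of $T_p\Lambda$ under parallel transport along $\gamma$ with respect to the Levi-Civita connection of $g$. Then $(\mathcal D_\gamma)_q$ is a Lagrangian subspace of $T_qX$, and if $A_q$ is a unitary automorphism of $(T_qX,J_q,g_q)$ with $T_q\Lambda=A_q(\mathcal D_\gamma)_q$, the number $\det^2(A_q)\in S^1$ depends neither on the choice of $\gamma$ nor on the choice of $A_q$. Hence there is a well-defined map $$\mathcal M:\Lambda\to S^1,\qquad q\mapsto \det{}^2(A_q).$$ Moreover, with $\alpha=\frac1{2\pi}d\theta$ on $S^1$, the form $\mathcal M^*\alpha$ on $\Lambda$ and the class $\mathcal M^*[\alpha]\in H^1(\Lambda,\mathbb Z)$ do not depend on the choice of the base point $p$.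
   Context: A Calabi-Yau manifold of complex dimension $n$ is a compact Kähler manifold $(X,g,J)$ with vanishing first Chern class, where $g$ is the Ricci-flat Kähler metric; its holonomy group is contained in $SU(n)$. Lagrangian means $\dim_{\mathbb R}\Lambda=n$ and $j^*\omega=0$; a Lagrangian subspace of $T_qX$ is a real $n$-dimensional subspace on which $\omega_q$ vanishes. $\det^2(A):=(\det_{\mathbb C}A)^2$ for a unitary automorphism $A$. $[\alpha]$ is the generator of $H^1(S^1,\mathbb Z)$ represented by $\alpha$. *)

(* Defs.v *)
From HB Require Import structures.
From mathcomp Require Import all_boot all_order all_algebra.
From mathcomp Require Import complex.
From mathcomp Require Import all_classical all_reals all_analysis.

Set Implicit Arguments.
Unset Strict Implicit.
Unset Printing Implicit Defensive.

Import Order.TTheory GRing.Theory Num.Theory.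
Import numFieldNormedType.Exports.

Local Open Scope classical_set_scope.
Local Open Scope ring_scope.

(* All vectors are row vectors, and linear maps act on them on the right. *)

Definition partial (R : realType) (m : nat) (i : 'I_m)
    (f : 'rV[R]_m -> R) (x : 'rV[R]_m) : R :=
  'D_(delta_mx 0 i) f x.

(* Meant for U open. *)
Fixpoint Ck (R : realType) (k m : nat) (U : set 'rV[R]_m)
    (f : 'rV[R]_m -> R) {struct k} : Prop :=
  match k with
  | 0 => {in U, continuous f}
  | k'.+1 => (forall x, U x -> differentiable f x) /\
             (forall i : 'I_m, Ck k' U (partial i f))
  end.

Definition smooth_on (R : realType) (m : nat) (U : set 'rV[R]_m)
    (f : 'rV[R]_m -> R) : Prop :=
  forall k, Ck k U f.

Definition smooth_mx_on (R : realType) (m r s : nat) (U : set 'rV[R]_m)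
    (F : 'rV[R]_m -> 'M[R]_(r, s)) : Prop :=
  forall i j, smooth_on U (fun x => F x i j).

(* [coord a] is a homeomorphism from [dom a] onto an open subset of R^m, with
   inverse [param a]; both functions are total and their values elsewhere are
   irrelevant.  [chart_at x] selects one chart around [x]. *)
Record manifold (R : realType) (m : nat) := Manifold {
  point :> topologicalType;
  manifold_hausdorff : hausdorff_space point;
  manifold_second_countable : @second_countable point;
  chart : Type;
  dom : chart -> set point;
  coord : chart -> point -> 'rV[R]_m;
  param : chart -> 'rV[R]_m -> point;
  chart_at : point -> chart;
  dom_open : forall a, open (dom a);
  image_open : forall a, open (coord a @` dom a);
  coordK : forall a x, dom a x -> param a (coord a x) = x;
  coord_continuous : forall a, {in dom a, continuous (coord a)};
  param_continuous : forall a, {in coord a @` dom a, continuous (param a)};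
  dom_chart_at : forall x, dom (chart_at x) x;
  transition_smooth : forall a b,
    smooth_mx_on (coord a @` (dom a `&` dom b)) (coord b \o param a)
}.

Arguments chart {R m} _.
Arguments dom {R m} _ _.
Arguments coord {R m} _ _ _.
Arguments param {R m} _ _ _.
Arguments chart_at {R m} _ _.

(* The tangent space T_x X is 'rV[R]_m: a tangent vector at x is given by its
   coordinates in the preferred chart [chart_at X x].  Accordingly a tensor
   field takes at x the matrix of its components in that chart. *)

Section Manifold.
Variables (R : realType) (m : nat) (X : manifold R m).

Definition chart_image (a : chart X) : set 'rV[R]_m := coord X a @` dom X a.

(* Jacobian matrix at x of the change of coordinates from a to b. *)
Definition chart_change (a b : chart X) (x : X) : 'M[R]_m :=
  'J (coord X b \o param X a) (coord X a x).

(* Components in the chart a of a tangent vector at x, of a field of covectors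
   and of a field of bilinear forms. *)
Definition vector_in (a : chart X) (x : X) (v : 'rV[R]_m) : 'rV[R]_m :=
  v *m chart_change (chart_at X x) a x.

Definition covector_in (eta : X -> 'rV[R]_m) (a : chart X)
    (y : 'rV[R]_m) : 'rV[R]_m :=
  let x := param X a y in
  eta x *m (chart_change a (chart_at X x) x)^T.

Definition bilinear_in (h : X -> 'M[R]_m) (a : chart X)
    (y : 'rV[R]_m) : 'M[R]_m :=
  let x := param X a y in
  let B := chart_change a (chart_at X x) x in
  B *m h x *m B^T.

Definition C1_curve_at (c : R -> X) (t : R) : Prop :=
  {for t, continuous c} /\
  forall a, dom X a (c t) ->
    (\forall s \near t, derivable (coord X a \o c) s 1) /\
    {for t, continuous (derive1 (coord X a \o c))}.

(* Piecewise C^1 paths from x to y, parametrized by [0, 1]; on each closed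
   piece the path is the restriction of a C^1 curve defined around it. *)
Definition pwC1_path (gamma : R -> X) (x y : X) : Prop :=
  [/\ gamma 0 = x, gamma 1 = y &
      exists (N : nat) (tau : nat -> R),
        [/\ tau 0%N = 0, tau N = 1 &
            forall i, (i < N)%N -> tau i < tau i.+1 /\
              exists c : R -> X, forall t, tau i <= t <= tau i.+1 ->
                C1_curve_at c t /\ c t = gamma t]].

End Manifold.

Section Maps.
Variables (R : realType) (m k : nat) (L : manifold R m) (X : manifold R k).

Definition smooth_map (f : L -> X) : Prop :=
  continuous f /\
  forall a b, smooth_mx_on (coord L a @` (dom L a `&` f @^-1` dom X b))
                           (coord X b \o f \o param L a).

Definition differential (f : L -> X) (x : L) : 'M[R]_(m, k) :=
  'J (coord X (chart_at X (f x)) \o f \o param L (chart_at L x))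
     (coord L (chart_at L x) x).

Definition embedding (f : L -> X) : Prop :=
  [/\ smooth_map f, injective f,
      forall x, row_free (differential f x) &
      forall U : set L, open U -> exists2 V : set X, open V & U = f @^-1` V].

Definition tangent_image (f : L -> X) (x : L) : set 'rV[R]_k :=
  range (fun u : 'rV[R]_m => u *m differential f x).

End Maps.

Section LocalFormulas.
Variables (R : realType) (m : nat).
Implicit Types (G : 'rV[R]_m -> 'M[R]_m) (y : 'rV[R]_m).

(* Gamma^k_ij *)
Definition christoffel G y (k i j : 'I_m) : R :=
  2^-1 * \sum_l invmx (G y) k l *
    (partial i (fun z => G z j l) y + partial j (fun z => G z i l) y
     - partial l (fun z => G z i j) y).

Definition ricci G y : 'M[R]_m := \matrix_(i, j) \sum_k
  (partial k (fun z => christoffel G z k i j) y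
   - partial j (fun z => christoffel G z k i k) y
   + \sum_l (christoffel G y k k l * christoffel G y l i j
             - christoffel G y k j l * christoffel G y l i k)).

Definition closed_2form (W : 'rV[R]_m -> 'M[R]_m) y : Prop :=
  forall i j k, partial i (fun z => W z j k) y + partial j (fun z => W z k i) y
                + partial k (fun z => W z i j) y = 0.

Definition ext_deriv (eta : 'rV[R]_m -> 'rV[R]_m) y : 'M[R]_m :=
  \matrix_(i, j) (partial i (fun z => eta z 0 j) y
                  - partial j (fun z => eta z 0 i) y).

End LocalFormulas.

Section Riemannian.
Variables (R : realType) (m : nat) (X : manifold R m) (g : X -> 'M[R]_m).

Definition riemannian : Prop :=
  [/\ forall x, (g x)^T = g x,
      forall x (v : 'rV[R]_m), v != 0 -> 0 < (v *m g x *m v^T) 0 0 &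
      forall a, smooth_mx_on (chart_image a) (bilinear_in g a)].

(* V t in T_(gamma t) X is continuous and, away from finitely many times, its
   covariant derivative along gamma for the Levi-Civita connection is zero. *)
Definition parallel (gamma : R -> X) (V : R -> 'rV[R]_m) : Prop :=
  (forall t, 0 <= t <= 1 -> forall a, dom X a (gamma t) ->
     (fun s => vector_in a (gamma s) (V s)) @ within `[0, 1] (nbhs t) -->
     vector_in a (gamma t) (V t)) /\
  (exists E : seq R, forall t, 0 < t < 1 -> t \notin E ->
     forall a, dom X a (gamma t) ->
     is_derive t 1 (fun s => vector_in a (gamma s) (V s))
       (- \row_k \sum_i \sum_j
            christoffel (bilinear_in g a) (coord X a (gamma t)) k i j
            * derive1 (coord X a \o gamma) t 0 i
            * vector_in a (gamma t) (V t) 0 j)).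

Definition transport (gamma : R -> X) (v w : 'rV[R]_m) : Prop :=
  exists V, [/\ parallel gamma V, V 0 = v & V 1 = w].

Definition ricci_flat : Prop :=
  forall a y, chart_image a y -> ricci (bilinear_in g a) y = 0.

End Riemannian.

(* C^n is R^n x R^n through z = x + i y: [Jstd] is multiplication by i. *)
Definition Jstd (R : realType) (n : nat) : 'M[R]_(n + n) :=
  block_mx 0 1%:M (- 1%:M) 0.

(* A real endomorphism commuting with [Jstd] has the form
   block_mx P Q (- Q) P and acts on C^n as P + i Q. *)
Definition detC (R : realType) (n : nat) (A : 'M[R]_(n + n)) : R[i] :=
  \det (\matrix_(i, j) Complex (ulsubmx A i j) (ursubmx A i j) : 'M[R[i]]_n).

Section Kaehler.
Variables (R : realType) (n : nat) (X : manifold R (n + n)).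
Variable g : X -> 'M[R]_(n + n).
Local Notation J := (Jstd R n).

(* The transition maps satisfy the Cauchy-Riemann equations; the complex
   structure of each tangent space is then [Jstd] in every chart. *)
Definition holomorphic_atlas : Prop :=
  forall a b x, dom X a x -> dom X b x ->
    J *m chart_change a b x = chart_change a b x *m J.

Definition hermitian : Prop := forall x, J *m g x *m J^T = g x.

(* omega(u, v) = u *m kahler_mx x *m v^T = g(u, J v) *)
Definition kahler_mx (x : X) : 'M[R]_(n + n) := g x *m J^T.

Definition kahler_form (x : X) (u v : 'rV[R]_(n + n)) : R :=
  (u *m kahler_mx x *m v^T) 0 0.

Definition unitary (x : X) (A : 'M[R]_(n + n)) : Prop :=
  A *m J = J *m A /\ A *m g x *m A^T = g x.

(* rho(u, v) = Ric(J u, v); rho / 2 pi represents the first Chern class. *)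
Definition ricci_form (a : chart X) (y : 'rV[R]_(n + n)) : 'M[R]_(n + n) :=
  J *m ricci (bilinear_in g a) y.

Definition c1_zero : Prop :=
  exists eta : X -> 'rV[R]_(n + n),
    (forall a, smooth_mx_on (chart_image a) (covector_in eta a)) /\
    (forall a y, chart_image a y ->
       ext_deriv (covector_in eta a) y = (2 * pi)^-1 *: ricci_form a y).

Definition holonomy_SU : Prop :=
  forall (x : X) (gamma : R -> X) (h : 'M[R]_(n + n)),
    pwC1_path gamma x x ->
    (forall v, transport g gamma v (v *m h)) ->
    unitary x h /\ detC h = 1.

Record calabi_yau : Prop := CalabiYau {
  cy_compact : compact [set: X];
  cy_complex : holomorphic_atlas;
  cy_riemannian : riemannian g;
  cy_hermitian : hermitian;
  cy_closed : forall a y, chart_image a y -> closed_2form (bilinear_in kahler_mx a) y;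
  cy_c1 : c1_zero;
  cy_ricci_flat : ricci_flat g;
  cy_holonomy : holonomy_SU
}.

Definition lagrangian_subspace (x : X) (D : set 'rV[R]_(n + n)) : Prop :=
  exists U : {vspace 'rV[R]_(n + n)},
    [/\ D = [set u | u \in U], \dim U = n &
        {in U &, forall u v, kahler_form x u v = 0}].

End Kaehler.

Definition circle (R : realType) : set (R[i]^o) := [set z | `|z| = 1].
Arguments circle : clear implicits.

Section Circle.
Variable R : realType.

(* d theta / 2 pi at z on the unit circle, where d theta is the restriction
   of x dy - y dx; w is tangent to the circle at z. *)
Definition alpha (z w : R[i]) : R :=
  (2 * pi)^-1 * (complex.Re z * complex.Im w - complex.Im z * complex.Re w).

Definition derive_C (m : nat) (v : 'rV[R]_m) (f : 'rV[R]_m -> R[i])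
    (x : 'rV[R]_m) : R[i] :=
  Complex ('D_v (@complex.Re R \o f) x) ('D_v (@complex.Im R \o f) x).

Definition smooth_C_on (m : nat) (U : set 'rV[R]_m)
    (f : 'rV[R]_m -> R[i]) : Prop :=
  smooth_on U (@complex.Re R \o f) /\ smooth_on U (@complex.Im R \o f).

Variables (m : nat) (L : manifold R m).

Definition smooth_circle_map (M : L -> circle R) : Prop :=
  forall a : chart L, smooth_C_on (chart_image a) (fun y => val (M (param L a y))).

(* (M^* alpha)_q evaluated at u in T_q L *)
Definition pullback_alpha (M : L -> circle R) (q : L) (u : 'rV[R]_m) : R :=
  let a := chart_at L q in
  alpha (val (M q))
        (derive_C u (fun y => val (M (param L a y))) (coord L a q)).

End Circle.

Definition simplex (R : realType) (k : nat) : set 'rV[R]_k.+1 :=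
  [set x | (forall i, 0 <= x 0 i) /\ \sum_i x 0 i = 1].
Arguments simplex : clear implicits.

Section SingularCohomology.
Variable R : realType.

(* Inclusion of the i-th face, opposite to the i-th vertex. *)
Definition face (k : nat) (i : 'I_k.+2) (x : 'rV[R]_k.+1) : 'rV[R]_k.+2 :=
  \row_j oapp (x 0) 0 (unlift i j).

Variables (T : topologicalType) (A : pzRingType).

Definition singular (k : nat) (sigma : 'rV[R]_k.+1 -> T) : Prop :=
  {within simplex R k, continuous sigma}.

(* Singular simplices are represented by total functions, of which only the
   restriction to the standard simplex matters. *)
Definition cochain (k : nat) (c : ('rV[R]_k.+1 -> T) -> A) : Prop :=
  forall sigma tau, (forall x, simplex R k x -> sigma x = tau x) ->
    c sigma = c tau.

Definition coboundary (k : nat) (c : ('rV[R]_k.+1 -> T) -> A)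
    (sigma : 'rV[R]_k.+2 -> T) : A :=
  \sum_(i < k.+2) (-1) ^+ i * c (sigma \o face i).

Definition cocycle (k : nat) (c : ('rV[R]_k.+1 -> T) -> A) : Prop :=
  cochain c /\ forall sigma, singular sigma -> coboundary c sigma = 0.

Definition cohomologous (k : nat) (c c' : ('rV[R]_k.+2 -> T) -> A) : Prop :=
  exists2 b : ('rV[R]_k.+1 -> T) -> A, cochain b &
    forall sigma, singular sigma -> c sigma - c' sigma = coboundary b sigma.

End SingularCohomology.

Section CircleClass.
Variable R : realType.

Definition edge (t : R) : 'rV[R]_2 := \row_i (if i == ord0 then 1 - t else t).

(* Integral of alpha over the singular 1-simplex given by s on [simplex R 1]. *)
Definition integral_alpha (s : 'rV[R]_2 -> R[i]) : R :=
  \int[@lebesgue_measure R]_(t in `[0, 1])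
    alpha (s (edge t)) (derive_C (edge 1 - edge 0) s (edge t)).

(* The integral singular cocycle z on the circle represents alpha: over R, its
   restriction to smooth simplices is cohomologous to integration of alpha.
   A smooth simplex is one that extends to a smooth map on R^2. *)
Definition represents_alpha (z : ('rV[R]_2 -> circle R) -> int) : Prop :=
  cocycle z /\
  exists2 f : ('rV[R]_1 -> circle R) -> R, cochain f &
    forall (sigma : 'rV[R]_2 -> circle R) (s : 'rV[R]_2 -> R[i]),
      smooth_C_on setT s ->
      (forall x, simplex R 1 x -> val (sigma x) = s x) ->
      (z sigma)%:~R = integral_alpha s + coboundary f sigma.

(* [alpha] is the class of any z representing alpha; its pullbacks by M and M'
   are compared through such a z. *)
Definition same_pullback_class (T : topologicalType) (M M' : T -> circle R) :
    Prop :=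
  forall z, represents_alpha z ->
    @cohomologous R T int 0 (fun sigma => z (M \o sigma))
                            (fun sigma => z (M' \o sigma)).

End CircleClass.

Section Maslov.
Variables (R : realType) (n : nat) (X : manifold R (n + n)).
Variables (g : X -> 'M[R]_(n + n)) (L : manifold R n) (j : L -> X).

Definition lagrangian_embedding : Prop :=
  embedding j /\
  forall (x : L) (u v : 'rV[R]_n),
    kahler_form g (j x) (u *m differential j x) (v *m differential j x) = 0.

(* (D_gamma)_q, for gamma a path from p to q *)
Definition transported (p : L) (gamma : R -> L) : set 'rV[R]_(n + n) :=
  [set w | exists2 v, tangent_image j p v & transport g (j \o gamma) v w].

Definition comparison (p q : L) (gamma : R -> L) (A : 'M[R]_(n + n)) : Prop :=
  [/\ pwC1_path gamma p q, unitary g (j q) A &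
      tangent_image j q = [set v *m A | v in transported p gamma]].

Definition maslov_map (p : L) (M : L -> circle R) : Prop :=
  forall q, (exists gamma A, comparison p q gamma A) /\
            (forall gamma A, comparison p q gamma A -> val (M q) = detC A ^+ 2).

End Maslov.

(* Main.v *)
(* Closedness of the Kaehler form makes J parallel, so parallel transport P
   along a path of Lambda is complex linear and isometric; hence it maps
   Lagrangian subspaces to Lagrangian subspaces, and since the holonomy lies
   in SU(n), detC P depends only on the end points.  Let D_q be the complex
   n x n matrix of a real basis of T_q Lambda.  From D_q = S D_p P A with S real
   one gets w := det D_q / (det D_p detC P) = det S * detC A, and as detC A is
   unimodular, detC A ^ 2 = w / conj w does not depend on A.

   Multiplicativity of detC P under concatenation shows that a change of base
   point multiplies M by a constant of modulus 1.  This leaves the form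
   M^* alpha unchanged, and the rotation being homotopic to the identity, also
   the class.  Smoothness: in a chart, conj (detC P) / detC P satisfies the
   differential equation th' = - 2 i Im (tau) th, where tau is the complex
   trace of minus the connection, and th is bounded. *)

From HB Require Import structures.
Require Import Defs.
From mathcomp Require Import all_boot all_order all_algebra.
From mathcomp Require Import complex ring lra zify.
From mathcomp Require Import all_classical all_reals all_analysis.

Set Implicit Arguments.
Unset Strict Implicit.
Unset Printing Implicit Defensive.

Import Order.TTheory GRing.Theory Num.Theory.
Import numFieldNormedType.Exports.
Local Open Scope classical_set_scope.
Local Open Scope ring_scope.
Import Defs.

(** Tangent vectors are stored in the preferred chart of their base point, which jumps as the point
    moves. Statements about continuity and derivatives are therefore made in a fixed chart around
    the point, and the parallelism equation is shown to be independent of that chart by the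
    inhomogeneous transformation law of the connection. Parallel transport has to be constructed.
    The linear equation is solved by Picard iteration only when its coefficients are small on the
    unit interval; short pieces of a path, rescaled to unit time, meet this condition, and
    continuous induction joins them. Uniqueness comes from preservation of the metric. Smoothness of
    the phase is delicate because transport is known along paths only: it yields directional
    derivatives along segments, with no continuity in the end point to start from. In a chart the
    determinant of the transport has no fixed modulus, whereas the quotient with its conjugate has
    modulus 1. The mean value theorem turns this bound into continuity, then differentiability,
    after which the equation itself raises the order step by step. *)

(** * Derivatives and limits of matrix-valued functions *)

Section MatrixCalculus.
Context {R : realType} {V : normedModType R}.

Lemma is_derive_mxP m n (M : V -> 'M[R]_(m, n)) t v (M' : 'M[R]_(m, n)) :
  is_derive t v M M' <-> forall i j, is_derive t v (fun x => M x i j) (M' i j).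
Proof.
split=> [[dM <-] i j|dM].
  by rewrite derive_mx// mxE; apply: DeriveDef => //; exact: (derivable_mxP _ _ _).1.
have dM' : derivable M t v by apply/derivable_mxP => i j; case: (dM i j).
apply: DeriveDef => //; rewrite derive_mx//; apply/matrixP => i j; rewrite mxE.
by case: (dM i j).
Qed.

Lemma is_derive_bigsum (I : Type) (r : seq I) (f : I -> V -> R) (f' : I -> R) t v :
  (forall i, is_derive t v (f i) (f' i)) ->
  is_derive t v (fun x => \sum_(i <- r) f i x) (\sum_(i <- r) f' i).
Proof.
move=> df; elim: r => [|i r IH].
  rewrite big_nil; under eq_fun do rewrite big_nil.
  exact: is_derive_cst.
rewrite big_cons; under eq_fun do rewrite big_cons.
exact: is_deriveD.
Qed.

Lemma is_derive_mul (f g : V -> R) t v f' g' :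
  is_derive t v f f' -> is_derive t v g g' ->
  is_derive t v (fun x => f x * g x) (f' * g t + f t * g').
Proof.
move=> df dg; have dM := is_deriveM df dg.
apply: (is_derive_eq dM); by rewrite /GRing.scale /= addrC [g t * _]mulrC.
Qed.

Lemma is_derive_mulmx m n p (M : V -> 'M[R]_(m, n)) (N : V -> 'M[R]_(n, p)) t v
    M' N' :
  is_derive t v M M' -> is_derive t v N N' ->
  is_derive t v (fun x => M x *m N x) (M' *m N t + M t *m N').
Proof.
move=> /is_derive_mxP dM /is_derive_mxP dN; apply/is_derive_mxP => i j.
under eq_fun do rewrite mxE.
rewrite !mxE -big_split; apply: is_derive_bigsum => k.
exact: is_derive_mul.
Qed.

Lemma is_derive_trmx m n (M : V -> 'M[R]_(m, n)) t v M' :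
  is_derive t v M M' -> is_derive t v (fun x => (M x)^T) M'^T.
Proof.
move=> /is_derive_mxP dM; apply/is_derive_mxP => i j.
by under eq_fun do rewrite mxE; rewrite mxE.
Qed.

Lemma differentiable_mx m n (F : V -> 'M[R]_(m, n)) x :
  (forall i j, differentiable (fun y => F y i j) x) -> differentiable F x.
Proof.
move=> dF.
have -> : F = \sum_(i < m) \sum_(j < n) (fun y => F y i j *: delta_mx i j).
  apply/funext => y; rewrite [LHS]matrix_sum_delta fct_sumE; apply: eq_bigr => i _.
  by rewrite fct_sumE.
apply: differentiable_sum => i; apply: differentiable_sum => j.
exact: differentiableZl.
Qed.

Lemma differentiable_entry m n (F : V -> 'M[R]_(m, n)) x i j :
  differentiable F x -> differentiable (fun y => F y i j) x.
Proof.
move=> dF; apply: (@differentiable_comp _ _ _ _ F (fun N : 'M[R]_(m, n) => N i j)) => //.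
exact: differentiable_coord.
Qed.

Lemma differentiable_mulmx m n p (F : V -> 'M[R]_(m, n)) (G : V -> 'M[R]_(n, p)) x :
  differentiable F x -> differentiable G x -> differentiable (fun y => F y *m G y) x.
Proof.
move=> dF dG; apply: differentiable_mx => i j.
have -> : (fun y => (F y *m G y) i j) = \sum_k (fun y => F y i k * G y k j).
  by apply/funext => y; rewrite mxE fct_sumE.
apply: differentiable_sum => k.
by apply: differentiableM; exact: differentiable_entry.
Qed.

Section MatrixLimits.
Context {T : Type} (F : set_system T) {FF : Filter F}.

Lemma cvg_mxP m n (M : T -> 'M[R]_(m, n)) (A : 'M[R]_(m, n)) :
  M @ F --> A <-> forall i j, (fun x => M x i j) @ F --> A i j.
Proof.
split=> [cM i j|cM].
  by apply: (@cvg_comp _ _ _ M (fun N => N i j)) cM _; exact: matrix_normedtype.coord_continuous.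
move=> /= B [P PA PB]; rewrite nbhs_simpl /=.
have : \forall x \near F, forall ij : 'I_m * 'I_n, P ij.1 ij.2 (M x ij.1 ij.2).
  by apply: filter_forall => -[i j] /=; exact: cM (PA i j).
by apply: filterS => y Py; apply: PB => i j; exact: (Py (i, j)).
Qed.

Lemma cvg_bigsum (I : Type) (r : seq I) (f : I -> T -> R) (l : I -> R) :
  (forall i, f i @ F --> l i) ->
  (fun x => \sum_(i <- r) f i x) @ F --> \sum_(i <- r) l i.
Proof.
move=> fl; elim: r => [|i r IH].
  by rewrite big_nil; under eq_fun do rewrite big_nil; exact: cvg_cst.
rewrite big_cons; under eq_fun do rewrite big_cons.
exact: cvgD.
Qed.

Lemma cvg_mulmx m n p (M : T -> 'M[R]_(m, n)) (N : T -> 'M[R]_(n, p))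
    (A : 'M[R]_(m, n)) (B : 'M[R]_(n, p)) :
  M @ F --> A -> N @ F --> B -> (fun x => M x *m N x) @ F --> A *m B.
Proof.
move=> /cvg_mxP MA /cvg_mxP NB; apply/cvg_mxP => i j.
under eq_fun do rewrite mxE.
by rewrite mxE; apply: cvg_bigsum => k; exact: cvgM.
Qed.

Lemma cvg_trmx m n (M : T -> 'M[R]_(m, n)) (A : 'M[R]_(m, n)) :
  M @ F --> A -> (fun x => (M x)^T) @ F --> A^T.
Proof.
move=> /cvg_mxP MA; apply/cvg_mxP => i j.
by under eq_fun do rewrite mxE; rewrite mxE; exact: MA.
Qed.

End MatrixLimits.

End MatrixCalculus.

Section Curves.
Context {R : realType}.

Lemma differentiable_is_derive (V W : normedModType R) (f : V -> W) x v :
  differentiable f x -> is_derive x v f ('D_v f x).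
Proof. by move=> df; apply: derivableP; exact: diff_derivable. Qed.

Lemma derive_sum_partial m (f : 'rV[R]_m -> R) x v : differentiable f x ->
  'D_v f x = \sum_i v 0 i * partial i f x.
Proof.
move=> df; rewrite deriveE// [in LHS](row_sum_delta v) linear_sum.
by apply: eq_bigr => i _; rewrite linearZ /partial deriveE.
Qed.

Lemma is_derive1_comp (V W : normedModType R) (F : V -> W) (u : R -> V) t u' :
  differentiable F (u t) -> is_derive t 1 u u' ->
  is_derive t 1 (F \o u) ('D_u' F (u t)).
Proof.
move=> dF [du u'E].
have du1 : differentiable u t by exact/derivable1_diffP.
have dc : differentiable (F \o u) t by exact: differentiable_comp.
apply: DeriveDef; first exact: diff_derivable.
by rewrite deriveE// diff_comp//= [in RHS]deriveE// -u'E [in RHS]deriveE.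
Qed.

Lemma is_derive_comp_scal (V : normedModType R) (F : R -> V) (h : R -> R) t h' F' :
  is_derive (h t) 1 F F' -> is_derive t 1 h h' -> is_derive t 1 (F \o h) (h' *: F').
Proof.
move=> dF dh.
have dF' : differentiable F (h t) by apply/derivable1_diffP; case: dF.
have := is_derive1_comp dF' dh; rewrite deriveE//.
by rewrite -[in 'd _ _ _](mulr1 h') linearZ -deriveE// derive_val.
Qed.

Lemma is_derive_affine (a b t : R) : is_derive t 1 (fun s => a + b * s) b.
Proof.
have -> : (fun s => a + b * s) = cst a + b \*: id.
  by apply/funext.
by apply: is_derive_eq; rewrite add0r /GRing.scale/= mulr1.
Qed.

End Curves.

(** * Functions of class C^k *)

Section SmoothFunctions.
Context {R : realType}.

Lemma open_nbhs_sub (T : topologicalType) (U : set T) x : open U -> U x -> \forall y \near x, U y.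
Proof. by move=> oU Ux; exact: open_nbhs_nbhs. Qed.

Lemma eq_partial m (U : set 'rV[R]_m) (f g : 'rV[R]_m -> R) i x :
  open U -> (forall y, U y -> f y = g y) -> U x -> partial i f x = partial i g x.
Proof.
move=> oU fg Ux; apply: near_eq_derive.
by apply: filterS (open_nbhs_sub oU Ux) => y; exact: fg.
Qed.

(** By [diff_unique], any continuous linear map satisfying the first-order estimate is the
    differential; this gives an epsilon criterion in which a candidate [l] can be proposed. *)
Lemma differentiable_approxP (V W : normedModType R) (f : V -> W) x (l : {linear V -> W}) :
  continuous l ->
  (forall e, 0 < e -> \forall h \near 0, `|f (h + x) - f x - l h| <= e * `|h|) ->
  differentiable f x.
Proof.
move=> cl fl.
have fE : f \o shift x = cst (f x) + l +o_ (0 : V) id.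
  apply/eqaddoP => e e0; apply: filterS (fl e e0) => h /=.
  by rewrite opprD addrA.
have dE := diff_unique cl fE.
by apply/diff_locallyP; rewrite dE.
Qed.

Lemma differentiable_approx (V W : normedModType R) (f : V -> W) x e :
  differentiable f x -> 0 < e ->
  \forall h \near 0, `|f (h + x) - f x - 'd f x h| <= e * `|h|.
Proof.
move=> /diff_locally /eqaddoP fE e0.
by apply: filterS (fE e e0) => h /=; rewrite opprD addrA.
Qed.

Lemma near_eq_differentiable (V W : normedModType R) (f g : V -> W) x :
  {near x, f =1 g} -> differentiable f x -> differentiable g x.
Proof.
move=> fg df; have fgx := nbhs_singleton fg.
apply: (@differentiable_approxP _ _ _ _ ('d f x)) => [|e e0].
  exact: diff_continuous.
have fg0 : \forall h \near 0, f (h + x) = g (h + x).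
  by move: fg; rewrite (near_shift 0 x); apply: filterS => h /=; rewrite subr0.
by apply: filterS2 fg0 (differentiable_approx df e0) => h <-; rewrite -fgx.
Qed.

(** Openness of [U] lets an equality on [U] pass to the partial derivatives, which look at a
    neighbourhood. The closure lemmas below use this to replace a partial derivative by the formula
    that computes it on [U]. *)
Lemma Ck_eq k m (U : set 'rV[R]_m) (f g : 'rV[R]_m -> R) :
  open U -> (forall x, U x -> f x = g x) -> Ck k U f -> Ck k U g.
Proof.
move=> oU; elim: k f g => [|k IH] f g fg /=.
  move=> cf x Ux; have {}Ux : U x by rewrite inE in Ux.
  have cfx : {for x, continuous f} by apply: cf; rewrite inE.
  rewrite /prop_for /continuous_at -(fg _ Ux); apply: cvg_trans cfx.
  have fgx : \forall y \near x, f y = g y.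
    by apply: filterS (open_nbhs_sub oU Ux) => y; exact: fg.
  exact: near_eq_cvg fgx.
move=> [df pf]; split.
  move=> x Ux; apply: near_eq_differentiable (df x Ux).
  by apply: filterS (open_nbhs_sub oU Ux) => y; exact: fg.
move=> i; apply: IH (pf i) => x Ux; exact: (eq_partial _ oU fg Ux).
Qed.

Lemma Ck_le k m (U : set 'rV[R]_m) (f : 'rV[R]_m -> R) : Ck k.+1 U f -> Ck k U f.
Proof.
elim: k f => [|k IH] f; last by move=> [df pf]; split=> // i; exact: IH.
move=> [df _] x; rewrite inE => Ux.
exact/differentiable_continuous/df.
Qed.

Lemma Ck_cst k m (U : set 'rV[R]_m) c : Ck k U (fun=> c).
Proof.
elim: k c => [|k IH] c /=; first by move=> x _; exact: cst_continuous.
split=> [x _|i]; first exact: differentiable_cst.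
have -> : partial i (fun=> c) = (fun _ : 'rV[R]_m => 0).
  by apply/funext => x; exact: derive_cst.
exact: IH.
Qed.

Lemma partialD m i (f g : 'rV[R]_m -> R) x :
  differentiable f x -> differentiable g x ->
  partial i (fun y => f y + g y) x = partial i f x + partial i g x.
Proof. by move=> df dg; rewrite /partial deriveD//; exact: diff_derivable. Qed.

Lemma partialM m i (f g : 'rV[R]_m -> R) x :
  differentiable f x -> differentiable g x ->
  partial i (fun y => f y * g y) x = partial i f x * g x + f x * partial i g x.
Proof.
move=> df dg.
by have [_ <-] := is_derive_mul (differentiable_is_derive (delta_mx 0 i) df)
  (differentiable_is_derive (delta_mx 0 i) dg).
Qed.

Lemma Ck_add k m (U : set 'rV[R]_m) (f g : 'rV[R]_m -> R) : open U ->
  Ck k U f -> Ck k U g -> Ck k U (fun x => f x + g x).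
Proof.
move=> oU; elim: k f g => [|k IH] f g /=.
  by move=> cf cg x Ux; apply: continuousD; [exact: cf|exact: cg].
move=> [df pf] [dg pg]; split=> [x Ux|i].
  by apply: differentiableD; [exact: df|exact: dg].
apply: (@Ck_eq _ _ _ (fun x => partial i f x + partial i g x)) => //; last exact: IH.
by move=> x Ux; rewrite partialD//; [exact: df|exact: dg].
Qed.

Lemma Ck_mul k m (U : set 'rV[R]_m) (f g : 'rV[R]_m -> R) : open U ->
  Ck k U f -> Ck k U g -> Ck k U (fun x => f x * g x).
Proof.
move=> oU; elim: k f g => [|k IH] f g.
  by move=> cf cg x Ux; apply: continuousM; [exact: cf|exact: cg].
move=> cf cg; have [df pf] := cf; have [dg pg] := cg; split=> [x Ux|i].
  by apply: differentiableM; [exact: df|exact: dg].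
apply: (@Ck_eq _ _ _ (fun x => partial i f x * g x + f x * partial i g x)) => //.
  by move=> x Ux; rewrite partialM//; [exact: df|exact: dg].
(* The Leibniz formula also contains [f] and [g] undifferentiated, so they are needed at the lower
   order too. *)
have [cf' cg'] := (Ck_le cf, Ck_le cg).
by apply: Ck_add => //; apply: IH => //; [exact: pf|exact: pg].
Qed.

Lemma Ck_sum k m (U : set 'rV[R]_m) (I : Type) (r : seq I) (f : I -> 'rV[R]_m -> R) :
  open U -> (forall i, Ck k U (f i)) -> Ck k U (fun x => \sum_(i <- r) f i x).
Proof.
move=> oU cf; elim: r => [|i r IH].
  by apply: (Ck_eq oU _ (@Ck_cst k m U 0)) => x _; rewrite big_nil.
apply: (Ck_eq oU _ (Ck_add oU (cf i) IH)) => x _; by rewrite big_cons.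
Qed.

Lemma Ck_prod k m (U : set 'rV[R]_m) (I : Type) (r : seq I) (f : I -> 'rV[R]_m -> R) :
  open U -> (forall i, Ck k U (f i)) -> Ck k U (fun x => \prod_(i <- r) f i x).
Proof.
move=> oU cf; elim: r => [|i r IH].
  by apply: (Ck_eq oU _ (@Ck_cst k m U 1)) => x _; rewrite big_nil.
apply: (Ck_eq oU _ (Ck_mul oU (cf i) IH)) => x _; by rewrite big_cons.
Qed.

Lemma Ck_opp k m (U : set 'rV[R]_m) (f : 'rV[R]_m -> R) : open U ->
  Ck k U f -> Ck k U (fun x => - f x).
Proof.
move=> oU cf; apply: (Ck_eq oU _ (Ck_mul oU (@Ck_cst k m U (- 1)) cf)) => x _.
by rewrite mulN1r.
Qed.

Lemma partialV m i (f : 'rV[R]_m -> R) x :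
  differentiable f x -> f x != 0 ->
  partial i (fun y => (f y)^-1) x = - (f x)^-1 * ((f x)^-1 * partial i f x).
Proof.
move=> df f0; have := @deriveV _ _ f x (delta_mx 0 i) f0 (diff_derivable df).
rewrite /partial => ->.
by rewrite /GRing.scale/= expr2 invfM [RHS]mulrA !mulNr.
Qed.

(** The derivative of the inverse is a product of inverses and of a derivative of [f], so order [k]
    for the inverse gives order [k.+1]. *)
Lemma Ck_inv k m (U : set 'rV[R]_m) (f : 'rV[R]_m -> R) : open U ->
  (forall x, U x -> f x != 0) -> Ck k U f -> Ck k U (fun x => (f x)^-1).
Proof.
move=> oU f0; elim: k => [|k IH] cf.
  by move=> x Ux; apply: continuousV; [rewrite inE in Ux; exact: f0|exact: cf].
have IH' := IH (Ck_le cf); case: cf => df pf; split=> [x Ux|i].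
  by apply: differentiableV; [exact: df|exact: f0].
apply: (@Ck_eq _ _ _ (fun x => - (f x)^-1 * ((f x)^-1 * partial i f x))) => //.
  by move=> x Ux; rewrite partialV//; [exact: df|exact: f0].
apply: Ck_mul => //; first exact: Ck_opp.
by apply: Ck_mul => //; exact: pf.
Qed.

Lemma smooth_mx_differentiable m r s (U : set 'rV[R]_m) (F : 'rV[R]_m -> 'M[R]_(r, s)) x :
  smooth_mx_on U F -> U x -> differentiable F x.
Proof.
by move=> sF Ux; apply: differentiable_mx => i j; case: (sF i j 1%N) => + _; exact.
Qed.

Lemma partial_comp m p i (F : 'rV[R]_m -> 'rV[R]_p) (f : 'rV[R]_p -> R) x :
  differentiable F x -> differentiable f (F x) ->
  partial i (f \o F) x = \sum_l partial i (fun y => F y 0 l) x * partial l f (F x).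
Proof.
move=> dF df; rewrite /partial deriveE; last exact: differentiable_comp.
rewrite diff_comp//= -deriveE// derive_sum_partial//; apply: eq_bigr => l _.
rewrite -deriveE// derive_mx//; last exact: diff_derivable.
by rewrite mxE.
Qed.

(** By the chain rule the partial derivatives of [f \o F] are sums of smooth functions times
    [partial l f \o F]; the induction on [k] changes [f] and keeps [F], which is smooth to all
    orders. *)
Lemma Ck_comp k m p (U : set 'rV[R]_m) (V : set 'rV[R]_p)
    (F : 'rV[R]_m -> 'rV[R]_p) (f : 'rV[R]_p -> R) :
  open U -> open V -> (forall x, U x -> V (F x)) ->
  smooth_mx_on U F -> Ck k V f -> Ck k U (f \o F).
Proof.
move=> oU oV UV sF; elim: k f => [|k IH] f.
  move=> cf x; rewrite inE => Ux; apply: continuous_comp.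
    exact/differentiable_continuous/(smooth_mx_differentiable sF).
  by apply: cf; rewrite inE; exact: UV.
move=> [df pf]; split=> [x Ux|i].
  apply: differentiable_comp; last exact/df/UV.
  exact: smooth_mx_differentiable Ux.
apply: (@Ck_eq _ _ _ (fun x => \sum_l partial i (fun y => F y 0 l) x
    * (partial l f \o F) x)) => //.
  move=> x Ux; rewrite partial_comp//; last exact/df/UV.
  exact: smooth_mx_differentiable Ux.
apply: Ck_sum => // l; apply: Ck_mul => //; last exact/IH/pf.
by have [_] := sF 0 l k.+1; exact.
Qed.

End SmoothFunctions.

(** * Mean value arguments and symmetry of second derivatives *)

Section RealAnalysis.
Context {R : realType}.

Lemma norm_mx_le m n (A : 'M[R]_(m, n)) c : 0 <= c ->
  (forall i j, `|A i j| <= c) -> `|A| <= c.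
Proof.
move=> c0 Ac; rewrite /Num.Def.normr/= mx_normrE.
by apply: bigmax_le => // -[i j] _; exact: Ac.
Qed.

Lemma norm_mx_coord m n (A : 'M[R]_(m, n)) i j : `|A i j| <= `|A|.
Proof. by rewrite [leRHS]/Num.Def.normr/= mx_normrE; exact: (le_bigmax _ _ (i, j)). Qed.

Lemma norm_delta_mx m n (i : 'I_m) (j : 'I_n) : `|delta_mx i j : 'M[R]_(m, n)| <= 1.
Proof.
apply: norm_mx_le => // k l; rewrite mxE.
by case: (_ && _); rewrite ?normr1 ?normr0.
Qed.

Lemma is_derive_line (V W : normedModType R) (f : V -> W) x v t :
  differentiable f (x + t *: v) ->
  is_derive t 1 (fun s => f (x + s *: v)) ('D_v f (x + t *: v)).
Proof.
move=> df; apply: (@is_derive1_comp _ _ _ f (fun s => x + s *: v)) => //.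
have -> : (fun s => x + s *: v) = cst x + (fun s : R => s *: v) by [].
have dl : is_derive t 1 (fun s : R => s *: v) v.
  have dl : differentiable (fun s : R => s *: v) t by exact: differentiableZl.
  apply: DeriveDef; first exact: diff_derivable.
  by rewrite deriveE// (@diffZl _ _ _ id)// diff_val scale1r.
by have := is_deriveD (is_derive_cst x t 1) dl; rewrite add0r.
Qed.

Lemma derive_continuous_within (f f' : R -> R) (a b : R) :
  (forall t, a <= t <= b -> is_derive t 1 f (f' t)) -> {within `[a, b], continuous f}.
Proof.
move=> df; apply: derivable_within_continuous => t.
by rewrite in_itv /= => /df [].
Qed.

Lemma MVT_le (f f' : R -> R) (a b : R) : a <= b ->
  (forall t, a <= t <= b -> is_derive t 1 f (f' t)) ->
  exists2 c, a <= c <= b & f b - f a = f' c * (b - a).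
Proof.
move=> ab df; have [||c] := @MVT_segment _ f f' a b ab.
- by move=> t; rewrite in_itv /= => /andP[at_ tb]; apply: df; rewrite !ltW.
- exact: derive_continuous_within df.
- by rewrite in_itv /= => cab ->; exists c.
Qed.

(** The mean value theorem is applied twice: in direction [i] to the increment of [f] along [j],
    then in direction [j] to [partial i f]. Exchanging [i] and [j] leaves the left side unchanged
    but moves [p]. *)
Lemma mixed_difference m (U : set 'rV[R]_m) (f : 'rV[R]_m -> R)
    (x : 'rV[R]_m) (i j : 'I_m) (h : R) :
  0 < h -> (forall y : 'rV[R]_m, `|y - x| <= h + h -> U y) -> Ck 2 U f ->
  exists2 p : 'rV[R]_m, `|p - x| <= h + h &
    f (x + h *: delta_mx 0 i + h *: delta_mx 0 j) - f (x + h *: delta_mx 0 i)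
    - (f (x + h *: delta_mx 0 j) - f x) = h * (h * partial j (partial i f) p).
Proof.
move=> h0 xU [df pf]; have [dpf _] := pf i.
have near_x (s t : R) : 0 <= s <= h -> 0 <= t <= h ->
    `|x + s *: delta_mx 0 i + t *: delta_mx 0 j - x| <= h + h.
  move=> /andP[s0 sh] /andP[t0 th].
  rewrite addrC !addrA addNr add0r (le_trans (ler_normD _ _))// !normrZ !ger0_norm//.
  apply: lerD; [apply: le_trans sh|apply: le_trans th];
    by rewrite ler_piMr// norm_delta_mx.
have h00 : 0 <= (0 : R) <= h by rewrite lexx ltW.
have hh : 0 <= h <= h by rewrite lexx ltW.
pose F s := f (x + h *: delta_mx 0 j + s *: delta_mx 0 i) - f (x + s *: delta_mx 0 i).
pose F' s := partial i f (x + h *: delta_mx 0 j + s *: delta_mx 0 i)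
             - partial i f (x + s *: delta_mx 0 i).
have [|s sh] := @MVT_le F F' 0 h (ltW h0).
  move=> s sh; apply: is_deriveB; apply: is_derive_line; apply/df/xU.
    by have := near_x s h sh hh; rewrite [x + s *: _ + _]addrAC.
  by have := near_x s 0 sh h00; rewrite scale0r addr0.
rewrite subr0 /F !scale0r !addr0 [X in f X - _ - _]addrAC => ->.
have [|t th] := @MVT_le (fun t => partial i f (x + s *: delta_mx 0 i + t *: delta_mx 0 j))
    (fun t => partial j (partial i f) (x + s *: delta_mx 0 i + t *: delta_mx 0 j))
    0 h (ltW h0).
  by move=> t th; apply: is_derive_line; apply/dpf/xU/near_x.
rewrite subr0 scale0r addr0 addrAC /F' [X in partial i f X - _]addrAC => ->.
exists (x + s *: delta_mx 0 i + t *: delta_mx 0 j); first exact: near_x.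
by rewrite mulrC [X in h * X]mulrC.
Qed.

Lemma dist_le_half (e a b c c' : R) :
  c = c' -> `|b - c| < e / 2 -> `|a - c'| < e / 2 -> `|a - b| <= e.
Proof.
move=> <- /ltW bc /ltW ac; rewrite -(subrK c a) -addrA.
by rewrite (le_trans (ler_normD _ _))// (splitr e) lerD// distrC.
Qed.

(** The second difference is symmetric in [i] and [j], so the two mixed derivatives take a common
    value at two points close to [x]; both being continuous at [x], they agree there. *)
Lemma schwarz m (U : set 'rV[R]_m) (f : 'rV[R]_m -> R)
    (x : 'rV[R]_m) (i j : 'I_m) :
  open U -> U x -> Ck 2 U f ->
  partial i (partial j f) x = partial j (partial i f) x.
Proof.
move=> oU Ux cf.
have cont k l : {for x, continuous (partial k (partial l f))}.
  by have [_ /(_ l)[_ /(_ k)]] := cf; apply; rewrite inE.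
apply/eqP; rewrite -subr_eq0 -normr_le0; apply/ler_addgt0Pl => /= e e0; rewrite addr0.
have e2 : 0 < e / 2 by rewrite divr_gt0.
have /nbhs_normP[d /= d0 dP] : \forall y \near x, U y /\
   `|partial i (partial j f) x - partial i (partial j f) y| < e / 2 /\
   `|partial j (partial i f) x - partial j (partial i f) y| < e / 2.
  have /cvgrPdist_lt /(_ _ e2) A := cont i j.
  have /cvgrPdist_lt /(_ _ e2) B := cont j i.
  exact: filterI (open_nbhs_sub oU Ux) (filterI A B).
(* The points given by [mixed_difference] lie within [h + h] of [x], which has to stay below [d]. *)
pose h := d / 3.
have h0 : 0 < h by rewrite divr_gt0.
have hd : h + h < d by rewrite /h; lra.
have ball_x (y : 'rV[R]_m) : `|y - x| <= h + h -> U y /\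
   `|partial i (partial j f) x - partial i (partial j f) y| < e / 2 /\
   `|partial j (partial i f) x - partial j (partial i f) y| < e / 2.
  by move=> yx; apply: dP; rewrite /= distrC (le_lt_trans yx hd).
have [p px pE] := mixed_difference i j h0 (fun y yx => (ball_x y yx).1) cf.
have [q qx qE] := mixed_difference j i h0 (fun y yx => (ball_x y yx).1) cf.
have pq : partial j (partial i f) p = partial i (partial j f) q.
  apply: (mulfI (lt0r_neq0 h0)); apply: (mulfI (lt0r_neq0 h0)).
  have swap (a b c c' : R) : a - b - (c - c') = a - c - (b - c') by ring.
  have E : f (x + h *: delta_mx 0 i + h *: delta_mx 0 j)
         = f (x + h *: delta_mx 0 j + h *: delta_mx 0 i).
    by congr f; exact: addrAC.
  apply: etrans (esym pE) _; apply: etrans qE.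
  by apply: etrans (swap _ _ _ _) _; rewrite E.
have [_ [_ pe]] := ball_x p px; have [_ [qe _]] := ball_x q qx.
exact: dist_le_half pq pe qe.
Qed.

(** Induction on the exceptional times: the interval is cut at such a time when it is interior, and
    continuity on the closed pieces joins the two values. Without exceptional times this is the mean
    value theorem. *)
Lemma eq_of_derive0 (f : R -> R) (E : seq R) (a b : R) : a <= b ->
  (forall t, a <= t <= b -> f @ within `[a, b] (nbhs t) --> f t) ->
  (forall t, a < t < b -> t \notin E -> is_derive t 1 f 0) ->
  f b = f a.
Proof.
elim: E a b => [|e E IH] a b ab cf df.
  have [||c _] := @MVT_segment _ f (fun=> 0) a b ab.
  - by move=> t; rewrite in_itv /= => tab; exact: df.
  - by apply/subspace_continuousP => t; rewrite /= in_itv /=; exact: cf.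
  by rewrite mul0r => /eqP; rewrite subr_eq0 => /eqP.
have sub a' b' t : a <= a' -> b' <= b -> a' <= t <= b' ->
    f @ within `[a', b'] (nbhs t) --> f t.
  move=> aa' bb' /andP[a't tb'].
  have tab : a <= t <= b by rewrite (le_trans aa' a't) (le_trans tb' bb').
  apply: cvg_trans (cf t tab); apply: cvg_app; apply: within_subset.
  by apply: subset_itv; rewrite bnd_simp.
have [/andP[ae eb]|eab] := boolP (a < e < b).
  have fbe : f b = f e.
    apply: IH (ltW eb) _ _ => [t teb|t /andP[et tb] tE].
      by apply: sub; rewrite // ltW.
    apply: df; first by rewrite tb (lt_trans ae et).
    by rewrite inE negb_or tE gt_eqF.
  rewrite fbe; apply: IH (ltW ae) _ _ => [t tae|t /andP[at_ te] tE].
    by apply: sub; rewrite // ltW.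
  apply: df; first by rewrite at_ (lt_trans te eb).
  by rewrite inE negb_or tE lt_eqF.
apply: IH => // t tab tE; apply: df => //; rewrite inE negb_or tE andbT.
by apply: contraNneq eab => <-.
Qed.

(* Continuous induction: the supremum of the reachable points is reachable and
   cannot be smaller than b. *)
Lemma interval_induction (P : R -> R -> Prop) (a b : R) : a < b ->
  (forall x y z, a <= x -> x < y -> y < z -> z <= b -> P x y -> P y z -> P x z) ->
  (forall t, a <= t <= b -> exists2 e : R, 0 < e &
     forall x y, a <= x -> x < y -> y <= b -> t - e < x -> y < t + e -> P x y) ->
  P a b.
Proof.
move=> ab Ptrans Ploc.
pose S := [set y | y <= b /\ (y = a \/ a < y /\ P a y)].
have Sa : S a by split; [exact: ltW|left].
have ubS : ubound S b by move=> y [].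
have hs : has_sup S by split; [exists a|exists b].
have as_ : a <= sup S by exact: sup_upper_bound.
have sb : sup S <= b by apply: sup_le_ub => //; exists a.
have [e e0 Pe] : exists2 e : R, 0 < e & forall x y, a <= x -> x < y -> y <= b ->
    sup S - e < x -> y < sup S + e -> P x y by apply: Ploc; rewrite as_.
have [y [yb Sy] ey] : exists2 y, S y & sup S - e < y by exact: sup_adherent.
have ys : y <= sup S by apply: sup_upper_bound => //; split.
have ay : a <= y by case: Sy => [->//|[/ltW]].
have reach z : y < z -> z <= b -> z < sup S + e -> P a z.
  move=> yz zb ze; case: Sy => [ya|[ay' Pay]].
    by apply: Pe; rewrite // -ya.
  by apply: Ptrans Pay (Pe _ _ ay yz zb ey ze).
have [sb'|bs] := ltP (sup S) b.
  pose z := Num.min b (sup S + e / 2).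
  have sz : sup S < z by rewrite lt_min sb' ltrDl divr_gt0.
  have zb : z <= b by rewrite ge_min lexx.
  have ze : z < sup S + e.
    by rewrite gt_min; apply/orP; right; rewrite ltrD2l; lra.
  have : z <= sup S.
    apply: sup_upper_bound => //; split=> //; right; split.
      exact: le_lt_trans as_ sz.
    exact: reach (le_lt_trans ys sz) zb ze.
  by rewrite leNgt sz.
have [yb'|by_] := ltP y b.
  by apply: reach => //; rewrite (le_lt_trans bs)// ltrDl.
have yE : y = b by apply/le_anti; rewrite yb.
case: Sy => [yaE|[_]]; last by rewrite yE.
by rewrite -yE yaE ltxx in ab.
Qed.

End RealAnalysis.

(** * Linear differential equations *)

Section LinearODE.
Context {R : realType}.
Notation mu := (@lebesgue_measure R).

(** The retraction of the line onto the unit interval. It makes the Picard iterates continuous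
    functions on the whole line, with estimates valid at every real. *)
Definition clamp (t : R) : R := if t <= 0 then 0 else if 1 <= t then 1 else t.

Lemma clampE t : 0 <= t <= 1 -> clamp t = t.
Proof.
move=> /andP[t0 t1]; rewrite /clamp; case: (lerP t 0) => [t0'|_]; first exact/le_anti/andP.
by case: (lerP 1 t) => // t1'; apply/le_anti/andP.
Qed.

Lemma clamp_itv t : 0 <= clamp t <= 1.
Proof. by rewrite /clamp; case: (lerP t 0) => ?; [|case: (lerP 1 t) => ?]; apply/andP; split; lra. Qed.

Lemma clamp_lipschitz s t : `|clamp s - clamp t| <= `|s - t|.
Proof.
have := ler_norm (s - t); have := ler_norm (t - s); rewrite distrC => st ts.
have := normr_ge0 (s - t); rewrite /clamp ler_norml.
by case: (lerP s 0) => ?; [|case: (lerP 1 s) => ?];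
  (case: (lerP t 0) => ?; [|case: (lerP 1 t) => ?]) => ?; apply/andP; split; lra.
Qed.

Lemma continuous_clamp : continuous clamp.
Proof.
move=> t; apply/cvgrPdist_lt => e e0; near=> s.
apply: le_lt_trans (clamp_lipschitz t s) _.
near: s; have := @cvg_id _ (nbhs t); move=> /cvgrPdist_lt; exact.
Unshelve. all: by end_near. Qed.

(** The integral starts at -1 so that 0 and 1 are interior to the interval of integration [[-1, 2]]
    and have two-sided derivatives; the subtracted constant normalizes the value at 0. *)
Definition antiderivative (f : R -> R) (t : R) : R :=
  \int[mu]_(s in `[-1, t]) f s - \int[mu]_(s in `[-1, 0]) f s.

Lemma antiderivative0 f : antiderivative f 0 = 0.
Proof. by rewrite /antiderivative subrr. Qed.

Lemma is_derive_antiderivative (f : R -> R) (t : R) : continuous f -> 0 <= t <= 1 ->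
  is_derive t 1 (antiderivative f) (f t).
Proof.
move=> cf /andP[t0 t1].
have intf : mu.-integrable `[-1, 2] (EFin \o f).
  apply: continuous_compact_integrable; first exact: segment_compact.
  exact: continuous_subspaceT.
have [df fE] : derivable (fun x : R => \int[mu]_(s in `[-1, x]) f s) t 1 /\
    derive1 (fun x : R => \int[mu]_(s in `[-1, x]) f s) t = f t.
  apply: (@continuous_FTC1_closed _ f (-1) t 2) => //.
    by rewrite (le_lt_trans t1)// ltr1n.
    by rewrite (lt_le_trans _ t0)// ltrN10.
  exact: cf.
rewrite derive1E in fE.
have dF := DeriveDef df fE.
have := is_deriveB dF (is_derive_cst (\int[mu]_(s in `[-1, 0]) f s) t 1).
by rewrite subr0.
Qed.

Lemma antiderivative_le (f : R -> R) (c t : R) : continuous f -> (forall s, `|f s| <= c) ->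
  0 <= t <= 1 -> `|antiderivative f t| <= c.
Proof.
move=> cf fc /andP[t0 t1].
have [s /andP[s0 st]|s _] := @MVT_le _ (antiderivative f) f 0 t t0.
  by apply: is_derive_antiderivative; rewrite // s0 (le_trans st).
rewrite antiderivative0 !subr0 => ->; rewrite normrM (ger0_norm t0).
by apply: le_trans (fc s); rewrite ler_piMr.
Qed.

Lemma antiderivative_dist (f g : R -> R) (c t : R) : continuous f -> continuous g ->
  (forall s, `|f s - g s| <= c) -> 0 <= t <= 1 ->
  `|antiderivative f t - antiderivative g t| <= c.
Proof.
move=> cf cg fg /andP[t0 t1].
have [s /andP[s0 st]|s _] := @MVT_le _ (fun t => antiderivative f t - antiderivative g t)
    (fun t => f t - g t) 0 t t0.
  by apply: is_deriveB; apply: is_derive_antiderivative; rewrite // s0 (le_trans st).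
rewrite !antiderivative0 !subr0 => ->; rewrite normrM (ger0_norm t0).
by apply: le_trans (fg s); rewrite ler_piMr.
Qed.

(** The intervals of radius [C * 2 / 2 ^+ k] around [u k] are nested, so the supremum of their left
    ends lies in all of them. The explicit rate serves as a uniform estimate when [u] depends on a
    parameter. *)
Lemma geometric_limit (u : nat -> R) (C : R) : 0 <= C ->
  (forall k, `|u k.+1 - u k| <= C / 2 ^+ k) ->
  exists l, forall k, `|u k - l| <= C * 2 / 2 ^+ k.
Proof.
move=> C0 uC; pose a k := u k - C * 2 / 2 ^+ k; pose b k := u k + C * 2 / 2 ^+ k.
have p2 k : 0 <= C / 2 ^+ k by rewrite divr_ge0// exprn_ge0.
have half k : C * 2 / 2 ^+ k.+1 = C / 2 ^+ k by rewrite exprS; field; apply: lt0r_neq0; rewrite exprn_gt0.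
have dbl k : C * 2 / 2 ^+ k = 2 * (C / 2 ^+ k) by rewrite mulrAC mulrC.
have aS k : a k <= a k.+1.
  by rewrite /a half dbl; have := uC k; have := p2 k; rewrite ler_norml; lra.
have bS k : b k.+1 <= b k.
  by rewrite /b half dbl; have := uC k; have := p2 k; rewrite ler_norml; lra.
have a_le i d : a i <= a (i + d)%N.
  by elim: d => [|d IH]; rewrite ?addn0// addnS (le_trans IH).
have b_le i d : b (i + d)%N <= b i.
  by elim: d => [|d IH]; rewrite ?addn0// addnS (le_trans _ IH).
have ab i j : a i <= b j.
  apply: le_trans (a_le i j) _; rewrite addnC; apply: le_trans (b_le j i).
  by rewrite /a /b dbl; have := p2 (j + i)%N; lra.
exists (sup (range a)) => k.
have hs : has_sup (range a) by split; [exists (a 0%N); exists 0%N|exists (b 0%N) => _ [i _ <-]].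
have al : a k <= sup (range a) by apply: sup_upper_bound => //; exists k.
have lb : sup (range a) <= b k by apply: sup_le_ub => [|_ [i _ <-]//]; exists (a 0%N); exists 0%N.
by rewrite ler_norml; move: al lb; rewrite /a /b; lra.
Qed.

Section Picard.
Variables (r m : nat) (K : R -> 'M[R]_m) (V0 : 'M[R]_(r, m)) (c : R).
Hypothesis cK : forall i j, continuous (fun t => K t i j).
Hypothesis Kc : forall t i j, `|K t i j| <= c.
Hypothesis c_small : m%:R * c <= 2^-1.

Let ccont (X : R -> 'M[R]_(r, m)) := forall i j, continuous (fun t => X t i j).

Definition picard (X : R -> 'M[R]_(r, m)) (t : R) : 'M[R]_(r, m) :=
  \matrix_(i, j) (V0 i j + antiderivative (fun s => (X s *m K s) i j) (clamp t)).

Let mulK_le (A : 'M[R]_(r, m)) (e t : R) i j : 0 <= e ->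
  (forall k, `|A i k| <= e) -> `|(A *m K t) i j| <= e / 2.
Proof.
move=> e0 Ae; rewrite mxE (le_trans (ler_norm_sum _ _ _))//.
apply: (@le_trans _ _ (\sum_(k < m) (e * c))).
  by apply: ler_sum => k _; rewrite normrM ler_pM.
rewrite sumr_const card_ord -[_ *+ m]mulr_natl mulrCA.
by rewrite ler_wpM2l.
Qed.

Let mulK_cont X i j : ccont X -> continuous (fun s => (X s *m K s) i j).
Proof.
move=> cX s; under eq_fun do rewrite mxE.
apply: cvg_bigsum => k.
by apply: cvgM; [exact: cX|exact: cK].
Qed.

Let picard_cont X : ccont X -> ccont (picard X).
Proof.
move=> cX i j t; under eq_fun do rewrite mxE.
apply: cvgD; first exact: cvg_cst.
apply: (@cvg_comp _ _ _ clamp (antiderivative _) _ _ _ (@continuous_clamp t)).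
have [df _] := is_derive_antiderivative (@mulK_cont X i j cX) (clamp_itv t).
exact/differentiable_continuous/derivable1_diffP.
Qed.

Let picard_contract X Y (e : R) : ccont X -> ccont Y -> 0 <= e ->
  (forall t i j, `|X t i j - Y t i j| <= e) ->
  forall t i j, `|picard X t i j - picard Y t i j| <= e / 2.
Proof.
move=> cX cY e0 XY t i j; rewrite !mxE opprD addrACA subrr add0r.
apply: antiderivative_dist (clamp_itv t); try exact: mulK_cont.
move=> s; have -> : (X s *m K s) i j - (Y s *m K s) i j = ((X s - Y s) *m K s) i j.
  by rewrite mulmxBl !mxE.
by apply: mulK_le => // k; rewrite !mxE.
Qed.

(** [c_small] makes the integral operator halve distances, measured entrywise and uniformly in time,
    so the iterates converge geometrically on the whole unit interval. *)
Lemma linear_ODE_small : exists X : R -> 'M[R]_(r, m), X 0 = V0 /\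
  forall t : R, 0 <= t <= 1 -> is_derive t 1 X (X t *m K t).
Proof.
pose X_ k := iter k picard (fun=> V0).
have cX k : ccont (X_ k).
  by elim: k => [|k IH]; [move=> i j; exact: cst_continuous|exact: picard_cont].
pose C := `|V0|.
have C0 : 0 <= C := normr_ge0 _.
have dX k t i j : `|X_ k.+1 t i j - X_ k t i j| <= C / 2 ^+ k.
  elim: k t i j => [|k IH] t i j.
    rewrite expr0 divr1 /= mxE addrC addrA addNr add0r.
    apply: antiderivative_le (clamp_itv t); first exact: mulK_cont (cX 0%N).
    move=> s; apply: le_trans (_ : C / 2 <= C); last by lra.
    by apply: mulK_le => // k; exact: norm_mx_coord.
  rewrite exprSr invfM mulrA.
  by apply: (picard_contract (cX k.+1) (cX k)) => //; rewrite divr_ge0// exprn_ge0.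
have [X Xlim] : exists X : R -> 'M[R]_(r, m), forall k t i j,
    `|X_ k t i j - X t i j| <= C * 2 / 2 ^+ k.
  have lim_ t (ij : 'I_r * 'I_m) : exists l, forall k, `|X_ k t ij.1 ij.2 - l| <= C * 2 / 2 ^+ k.
    by apply: geometric_limit => // k; exact: dX.
  exists (fun t => \matrix_(i, j) sval (cid (lim_ t (i, j)))) => k t i j.
  by rewrite mxE; exact: (svalP (cid (lim_ t (i, j))) k).
have small (e : R) : 0 < e -> exists k, C * 2 / 2 ^+ k <= e.
  move=> e0; have : (fun k => C * 2 / 2 ^+ k) @ \oo --> 0.
    have := @cvg_geometric _ (C * 2) (2^-1 : R).
    rewrite ger0_norm ?invr_ge0// invf_lt1// ltr1n => /(_ isT).
    have -> : geometric (C * 2) (2^-1 : R) = (fun k => C * 2 / 2 ^+ k).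
      by apply/funext => k; rewrite /geometric/= exprVn.
    by [].
  move=> /cvgrPdist_lt /(_ e e0)[N _ /(_ N (leqnn N))]; rewrite /= sub0r normrN => Ne.
  by exists N; rewrite ltW// (le_lt_trans (ler_norm _)).
have cXl : ccont X.
  move=> i j t; apply/cvgrPdist_le => e e0.
  have [k ke] := small (e / 3) ltac:(by rewrite divr_gt0).
  have /cvgrPdist_le /(_ (e / 3)) := cX k i j t.
  rewrite divr_gt0// => /(_ isT); apply: filterS => s ts.
  have := Xlim k t i j; have := Xlim k s i j; move: ts ke; rewrite !ler_norml; lra.
(* Both [X] and [picard X] are within a multiple of [2 ^- k] of the iterate of rank [k.+1]. *)
have XE t i j : X t i j = picard X t i j.
  apply/eqP; rewrite -subr_eq0 -normr_le0; apply/ler_addgt0Pl => e e0; rewrite addr0.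
  have [k ke] := small (e / 2) ltac:(by rewrite divr_gt0).
  have ge0 : 0 <= C * 2 / 2 ^+ k by rewrite divr_ge0 ?exprn_ge0 ?mulr_ge0.
  have H := picard_contract (cX k) cXl ge0 (Xlim k) t i j.
  have := Xlim k.+1 t i j; rewrite exprS invfM mulrCA [2^-1 * _]mulrC => H'.
  by move: H H' ke; rewrite !ler_norml /X_ /=; lra.
(* The solution is given without [clamp]: the fixed point [X] is constant outside the unit interval
   and need not have two-sided derivatives at its ends. *)
exists (fun t => \matrix_(i, j) (V0 i j + antiderivative (fun s => (X s *m K s) i j) t)).
split; first by apply/matrixP => i j; rewrite mxE antiderivative0 addr0.
move=> t t01; apply/is_derive_mxP => i j; under eq_fun do rewrite mxE.
have -> : (\matrix_(k, l) (V0 k l + antiderivative (fun s => (X s *m K s) k l) t))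
    = X t.
  by apply/matrixP => k l; rewrite XE !mxE clampE.
have dF := is_derive_antiderivative (@mulK_cont X i j cXl) t01.
by have := is_deriveD (is_derive_cst (V0 i j) t 1) dF; rewrite add0r.
Qed.

End Picard.
End LinearODE.

(** * The Levi-Civita connection *)

Section BilinearForms.
Context {R : realType} {m : nat}.
Implicit Types (A B : 'M[R]_m) (u v w z : 'rV[R]_m).

Definition bform A u v : R := (u *m A *m v^T) 0 0.

Lemma bformE A u v : bform A u v = \sum_j \sum_l u 0 j * A j l * v 0 l.
Proof.
rewrite /bform mxE exchange_big; apply: eq_bigr => l _.
by rewrite mxE mulr_suml; apply: eq_bigr => j _; rewrite mxE.
Qed.

Lemma bformDm A B u v : bform (A + B) u v = bform A u v + bform B u v.
Proof. by rewrite /bform mulmxDr mulmxDl mxE. Qed.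

Lemma bformDl A u v w : bform A (u + v) w = bform A u w + bform A v w.
Proof. by rewrite /bform !mulmxDl mxE. Qed.

Lemma bformNr A u v : bform A u (- v) = - bform A u v.
Proof. by rewrite /bform linearN mulmxN mxE. Qed.

Lemma bform_mul A B C u v : bform (B *m A *m C^T) u v = bform A (u *m B) (v *m C).
Proof. by rewrite /bform trmx_mul !mulmxA. Qed.

Lemma bform_mull A B u v : bform (B *m A) u v = bform A (u *m B) v.
Proof. by rewrite /bform !mulmxA. Qed.

Lemma bform_mulr A B u v : bform (A *m B^T) u v = bform A u (v *m B).
Proof. by rewrite /bform trmx_mul !mulmxA. Qed.

Lemma bform_tr A u v : bform A^T u v = bform A v u.
Proof.
have -> : bform A^T u v = ((v *m A *m u^T)^T) 0 0 by rewrite /bform !trmx_mul !trmxK mulmxA.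
by rewrite mxE.
Qed.

Lemma bform_inj A B : (forall u v, bform A u v = bform B u v) -> A = B.
Proof.
move=> AB; apply/matrixP => i j; have := AB (delta_mx 0 i) (delta_mx 0 j).
by rewrite /bform -!rowE !trmx_delta -!colE !mxE.
Qed.

End BilinearForms.

Section LeviCivita.
Context {R : realType} {m : nat}.
Implicit Types (G : 'rV[R]_m -> 'M[R]_m) (y u v w z : 'rV[R]_m).

Definition connection_mx G y u : 'M[R]_m :=
  \matrix_(j, k) \sum_i christoffel G y k i j * u 0 i.

Lemma connection_mxZ G y k u : connection_mx G y (k *: u) = k *: connection_mx G y u.
Proof.
apply/matrixP => i j; rewrite !mxE mulr_sumr; apply: eq_bigr => l _.
by rewrite mxE mulrCA.
Qed.

Lemma connection_mxE G y u w :
  w *m connection_mx G y u = \row_k \sum_i \sum_j christoffel G y k i j * u 0 i * w 0 j.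
Proof.
apply/rowP => k; rewrite !mxE exchange_big; apply: eq_bigr => j _.
by rewrite mxE mulr_sumr; apply: eq_bigr => i _; rewrite mulrC.
Qed.

(* [D u] stands for the derivative of the metric in the direction [u]. *)
Definition koszul (D : 'rV[R]_m -> 'M[R]_m) u w z : R :=
  2^-1 * (bform (D u) w z + bform (D w) u z - bform (D z) u w).

(** Compatibility with the metric: exchanging [w] and [z] changes the sign of the last two terms
    together, and they cancel in the sum. *)
Lemma koszul_metric D u w z : (forall v, (D v)^T = D v) ->
  koszul D u w z + koszul D u z w = bform (D u) w z.
Proof.
move=> Ds; rewrite /koszul -[bform (D u) z w]bform_tr Ds.
by move: (bform _ w z) (bform _ u z) (bform _ u w) => a b c; lra.
Qed.

Section KoszulComplexStructure.
Variables (J : 'M[R]_m).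
Hypotheses (JJ : J *m J = - 1%:M) (JT : J^T = - J).

Lemma bform_skew A u v : J *m A = A *m J -> bform A (u *m J) v = - bform A u (v *m J).
Proof.
move=> JA; have E : u *m J *m A *m v^T = - (u *m A *m (v *m J)^T).
  by rewrite trmx_mul JT mulNmx mulmxN opprK -(mulmxA u J A) JA !mulmxA.
by rewrite /bform E mxE.
Qed.

Lemma bform_mulJJ A u v : J *m A = A *m J -> bform A (u *m J) (v *m J) = bform A u v.
Proof. by move=> JA; rewrite bform_skew// -mulmxA JJ mulmxN mulmx1 bformNr opprK. Qed.

(* The last hypothesis is the closedness of the form [g(., . J)]. *)
Lemma koszul_skew D u w z : (forall v, (D v)^T = D v) ->
  (forall v, J *m D v = D v *m J) ->
  (forall a b c, bform (D a) b (c *m J) + bform (D b) c (a *m J)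
                 + bform (D c) a (b *m J) = 0) ->
  koszul D u (w *m J) z = - koszul D u w (z *m J).
Proof.
move=> Ds DJ closed; rewrite /koszul -mulrN; congr (_ * _).
have Dsym v a b : bform (D v) a b = bform (D v) b a by rewrite -[in LHS]Ds bform_tr.
(* The classical expression of the covariant derivative of [J] through the exterior derivative of
   the Kaehler form, evaluated at [(u, w, z)] and at [(u, w *m J, z *m J)]; the Nijenhuis term is
   absent because [J] is constant. *)
have c1 := closed u w z; have := closed u (w *m J) (z *m J).
rewrite -!mulmxA JJ !mulmxN !mulmx1 !bformNr (bform_mulJJ _ _ (DJ _)).
rewrite (bform_skew _ _ (DJ u)) (Dsym _ z u).
move: c1; rewrite (Dsym w z) (bform_skew _ _ (DJ w)).
by move: (bform _ _ _) (bform _ _ _) (bform _ _ _) (bform _ _ _) (bform _ _ _)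
  => x1 x2 x3 x4 x5; lra.
Qed.

End KoszulComplexStructure.

Lemma derive_mx_partial G y u j l : differentiable G y ->
  'D_u G y j l = \sum_i u 0 i * partial i (fun x => G x j l) y.
Proof.
move=> dG; rewrite derive_mx; last exact: diff_derivable.
rewrite mxE derive_sum_partial//.
exact: differentiable_entry.
Qed.

Lemma bform_derive G y u v w : differentiable G y ->
  bform ('D_u G y) v w =
    \sum_i \sum_j \sum_l u 0 i * v 0 j * w 0 l * partial i (fun x => G x j l) y.
Proof.
move=> dG; rewrite bformE.
under eq_bigr => j _ do under eq_bigr => l _ do
  rewrite derive_mx_partial// mulr_sumr mulr_suml.
under eq_bigr => j _ do rewrite exchange_big.
rewrite exchange_big; apply: eq_bigr => i _; apply: eq_bigr => j _.
by apply: eq_bigr => l _; ring.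
Qed.

Lemma christoffel_lower G y i j l : (G y)^T = G y -> G y \in unitmx ->
  \sum_k christoffel G y k i j * G y k l =
  2^-1 * (partial i (fun x => G x j l) y + partial j (fun x => G x i l) y
          - partial l (fun x => G x i j) y).
Proof.
move=> Gs Gu; rewrite /christoffel.
under eq_bigr do rewrite -mulrA mulr_suml.
rewrite -mulr_sumr exchange_big /= (bigD1 l)//= [X in _ + X]big1 ?addr0.
  congr (_ * _).
  transitivity ((\sum_k G y l k * invmx (G y) k l) *
    (partial i (fun x => G x j l) y + partial j (fun x => G x i l) y
     - partial l (fun x => G x i j) y)).
    rewrite mulr_suml; apply: eq_bigr => k _.
    have -> : G y k l = G y l k by rewrite -{1}Gs mxE.
    by rewrite mulrAC [invmx _ _ _ * _]mulrC.
  have -> : \sum_k G y l k * invmx (G y) k l = (G y *m invmx (G y)) l l by rewrite mxE.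
  by rewrite mulmxV// mxE eqxx mul1r.
move=> h hl.
have -> : \sum_i0 invmx (G y) i0 h * (partial i (fun x => G x j h) y
    + partial j (fun x => G x i h) y - partial h (fun x => G x i j) y) * G y i0 l
  = (G y *m invmx (G y)) l h * (partial i (fun x => G x j h) y
    + partial j (fun x => G x i h) y - partial h (fun x => G x i j) y).
  rewrite mxE mulr_suml; apply: eq_bigr => k _.
  have -> : G y k l = G y l k by rewrite -{1}Gs mxE.
  by rewrite mulrAC [invmx _ _ _ * _]mulrC.
by rewrite mulmxV// mxE eq_sym (negbTE hl) mul0r.
Qed.

(** The passage from Christoffel symbols to the Koszul formula: the later properties of the
    connection follow from identities between bilinear forms, without indices. *)
Lemma koszulE G y u w z : differentiable G y -> (G y)^T = G y -> G y \in unitmx ->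
  bform (G y) (w *m connection_mx G y u) z = koszul (fun v => 'D_v G y) u w z.
Proof.
move=> dG Gs Gu.
pose T i j l := u 0 i * w 0 j * z 0 l *
  (2^-1 * (partial i (fun x => G x j l) y + partial j (fun x => G x i l) y
          - partial l (fun x => G x i j) y)).
transitivity (\sum_i \sum_j \sum_l T i j l).
  rewrite bformE connection_mxE.
  under eq_bigr => k _ do under eq_bigr => l _ do
    (rewrite mxE mulr_suml mulr_suml;
     under eq_bigr => i _ do rewrite mulr_suml mulr_suml).
  under eq_bigr => k _ do rewrite exchange_big.
  rewrite exchange_big; apply: eq_bigr => i _.
  under eq_bigr => k _ do rewrite exchange_big.
  rewrite exchange_big; apply: eq_bigr => j _.
  rewrite exchange_big; apply: eq_bigr => l _.
  rewrite /T -christoffel_lower// mulr_sumr; apply: eq_bigr => k _; ring.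
rewrite /koszul (bform_derive u w z dG) (bform_derive w u z dG) (bform_derive z u w dG).
have -> : \sum_i \sum_j \sum_l w 0 i * u 0 j * z 0 l * partial i (fun x => G x j l) y
    = \sum_i \sum_j \sum_l w 0 j * u 0 i * z 0 l * partial j (fun x => G x i l) y.
  exact: exchange_big.
have -> : \sum_i \sum_j \sum_l z 0 i * u 0 j * w 0 l * partial i (fun x => G x j l) y
    = \sum_i \sum_j \sum_l z 0 l * u 0 i * w 0 j * partial l (fun x => G x i j) y.
  by rewrite exchange_big; apply: eq_bigr => i _; exact: exchange_big.
rewrite -sumrN -!big_split mulr_sumr; apply: eq_bigr => i _.
rewrite -sumrN -!big_split mulr_sumr; apply: eq_bigr => j _.
rewrite -sumrN -!big_split mulr_sumr; apply: eq_bigr => l _.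
by rewrite /T /=; ring.
Qed.

Lemma closed_2form_derive W y u v w : differentiable W y -> closed_2form W y ->
  bform ('D_u W y) v w + bform ('D_v W y) w u + bform ('D_w W y) u v = 0.
Proof.
move=> dW Wc.
rewrite (bform_derive u v w dW) (bform_derive v w u dW) (bform_derive w u v dW).
have -> : \sum_i \sum_j \sum_l v 0 i * w 0 j * u 0 l * partial i (fun x => W x j l) y
    = \sum_i \sum_j \sum_l v 0 j * w 0 l * u 0 i * partial j (fun x => W x l i) y.
  by rewrite [RHS]exchange_big; apply: eq_bigr => i _; exact: exchange_big.
have -> : \sum_i \sum_j \sum_l w 0 i * u 0 j * v 0 l * partial i (fun x => W x j l) y
    = \sum_i \sum_j \sum_l w 0 l * u 0 i * v 0 j * partial l (fun x => W x i j) y.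
  by rewrite exchange_big; apply: eq_bigr => i _; exact: exchange_big.
rewrite -!big_split big1// => i _; rewrite -!big_split big1// => j _.
rewrite -!big_split big1// => l _ /=.
have := Wc i j l; set p := partial _ _ _; set q := partial _ _ _; set r := partial _ _ _.
by move=> pqr; rewrite -[RHS](mulr0 (u 0 i * v 0 j * w 0 l)) -pqr; ring.
Qed.

End LeviCivita.

Section Compatibility.
Context {R : realType} {m : nat}.
Implicit Types (G : 'rV[R]_m -> 'M[R]_m) (y u v w z : 'rV[R]_m).

Lemma is_derive_uniq (V W : normedModType R) (f : V -> W) (x v : V) (a b : W) :
  is_derive x v f a -> is_derive x v f b -> a = b.
Proof. by move=> [_ <-] [_ <-]. Qed.

Lemma derive_tr_sym (U : set 'rV[R]_m) G y u : open U -> U y -> differentiable G y ->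
  (forall z, U z -> (G z)^T = G z) -> ('D_u G y)^T = 'D_u G y.
Proof.
move=> oU Uy dG Gs.
apply: (is_derive_uniq (is_derive_trmx (differentiable_is_derive u dG))).
apply: near_eq_is_derive (differentiable_is_derive u dG).
by apply: filterS (open_nbhs_sub oU Uy) => z /Gs.
Qed.

Lemma derive_mulmxr (p : nat) (A : 'M[R]_(m, p)) G y u : differentiable G y ->
  is_derive y u (fun z => G z *m A) ('D_u G y *m A).
Proof.
move=> dG; have := is_derive_mulmx (differentiable_is_derive u dG) (is_derive_cst A y u).
by rewrite mulmx0 addr0.
Qed.

Lemma derive_mulmxl (p : nat) (A : 'M[R]_(p, m)) G y u : differentiable G y ->
  is_derive y u (fun z => A *m G z) (A *m 'D_u G y).
Proof.
move=> dG; have := is_derive_mulmx (is_derive_cst A y u) (differentiable_is_derive u dG).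
by rewrite mul0mx add0r.
Qed.

Variables (U : set 'rV[R]_m) (G : 'rV[R]_m -> 'M[R]_m) (y : 'rV[R]_m).
Hypotheses (oU : open U) (Uy : U y) (dG : differentiable G y).
Hypothesis Gs : forall z, U z -> (G z)^T = G z.
Hypothesis Gu : G y \in unitmx.

Let DGs v : ('D_v G y)^T = 'D_v G y.
Proof. exact: derive_tr_sym oU Uy dG Gs. Qed.

Let K u a b : bform (G y) (a *m connection_mx G y u) b = koszul (fun v => 'D_v G y) u a b.
Proof. exact: koszulE dG (Gs Uy) Gu. Qed.

Lemma connection_metric u :
  'D_u G y = connection_mx G y u *m G y + G y *m (connection_mx G y u)^T.
Proof.
apply: bform_inj => a b; rewrite bformDm bform_mull bform_mulr.
rewrite -[bform (G y) a _]bform_tr (Gs Uy) (K u a b) (K u b a).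
exact/esym/koszul_metric.
Qed.

Section Parallel_complex_structure.
Variables (J : 'M[R]_m) (W : 'rV[R]_m -> 'M[R]_m).
Hypotheses (JJ : J *m J = - 1%:M) (JT : J^T = - J).
Hypothesis GJ : forall z, U z -> J *m G z *m J^T = G z.
Hypothesis WE : forall z, U z -> W z = G z *m J^T.
Hypothesis Wc : closed_2form W y.

Let commGJ z : U z -> J *m G z = G z *m J.
Proof.
by move=> Uz; rewrite -[in RHS](GJ Uz) JT mulmxN mulNmx -!mulmxA JJ !mulmxN mulmx1 opprK.
Qed.

Let commDJ u : J *m 'D_u G y = 'D_u G y *m J.
Proof.
apply: (is_derive_uniq (derive_mulmxl J u dG)).
apply: near_eq_is_derive (derive_mulmxr J u dG).
by apply: filterS (open_nbhs_sub oU Uy) => z /commGJ.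
Qed.

Let dW : differentiable W y.
Proof.
apply: (@near_eq_differentiable _ _ _ (fun z => G z *m J^T)).
  by apply: filterS (open_nbhs_sub oU Uy) => z /WE.
exact: differentiable_mulmx (differentiable_cst _ _).
Qed.

Let DWE u a b : bform ('D_u W y) a b = bform ('D_u G y) a (b *m J).
Proof.
rewrite -bform_mulr; congr (bform _ a b).
apply: (is_derive_uniq (differentiable_is_derive u dW)).
apply: near_eq_is_derive (derive_mulmxr J^T u dG).
by apply: filterS (open_nbhs_sub oU Uy) => z /WE.
Qed.

Let closed u v w : bform ('D_u G y) v (w *m J) + bform ('D_v G y) w (u *m J)
  + bform ('D_w G y) u (v *m J) = 0.
Proof.
rewrite -(DWE u v w) -(DWE v w u) -(DWE w u v).
exact: closed_2form_derive.
Qed.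

(** In a holomorphic chart [J] is a constant matrix, so for it to be parallel means to commute with
    the connection matrix. Pairing with the nondegenerate metric reduces this to [koszul_skew]. *)
Lemma connection_commute u : connection_mx G y u *m J = J *m connection_mx G y u.
Proof.
have G_inj (A B : 'M[R]_m) : (forall a b, bform (G y) (a *m A) b = bform (G y) (a *m B) b) -> A = B.
  move=> AB; have : A *m G y = B *m G y.
    by apply: bform_inj => a b; rewrite !bform_mull.
  by move/(congr1 (fun M => M *m invmx (G y))); rewrite !mulmxK.
apply: G_inj => a b; rewrite !mulmxA (bform_skew JT _ _ (commGJ Uy)).
rewrite (K u (a *m J) b) (K u a (b *m J)).
by rewrite (koszul_skew JJ JT u a b DGs commDJ closed).
Qed.

End Parallel_complex_structure.
End Compatibility.

(** * Behaviour of the connection under changes of coordinates *)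

Section ChangeOfCoordinates.
Context {R : realType} {m : nat}.
Implicit Types (y u v w z : 'rV[R]_m).

(* [H u] is the derivative in the direction [u] of the Jacobian matrix [B];
   its symmetry is that of second derivatives. *)
Lemma koszul_change (Da Db : 'rV[R]_m -> 'M[R]_m) (H : 'rV[R]_m -> 'M[R]_m)
    (B G : 'M[R]_m) u w z : G^T = G ->
  (forall a b, a *m H b = b *m H a) ->
  (forall a, Da a = H a *m G *m B^T + B *m Db (a *m B) *m B^T + B *m G *m (H a)^T) ->
  koszul Da u w z = koszul Db (u *m B) (w *m B) (z *m B) + bform G (w *m H u) (z *m B).
Proof.
move=> Gs Hs DaE.
have Gsym a b : bform G a b = bform G b a by rewrite -[in LHS]Gs bform_tr.
have E a b c : bform (Da a) b c = bform G (b *m H a) (c *m B)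
    + bform (Db (a *m B)) (b *m B) (c *m B) + bform G (b *m B) (c *m H a).
  by rewrite DaE !bformDm !bform_mul.
rewrite /koszul !E (Hs u w) (Hs z u) (Hs z w) (Gsym (u *m B)) (Gsym (w *m B)).
move: (bform (Db _) _ _) (bform (Db _) _ _) (bform (Db _) _ _) => x1 x2 x3.
by move: (bform _ _ _) (bform _ _ _) (bform _ _ _) => x4 x5 x6; lra.
Qed.

Lemma mulmx_sym_tensor (p : nat) (A B : 'M[R]_(m, p)) (T : 'I_m -> 'I_m -> 'I_p -> R) u w :
  (forall i k, A i k = \sum_l u 0 l * T l i k) ->
  (forall i k, B i k = \sum_l w 0 l * T l i k) ->
  (forall l i k, T l i k = T i l k) -> w *m A = u *m B.
Proof.
move=> AE BE Ts; apply/rowP => k; rewrite !mxE.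
under eq_bigr do rewrite AE mulr_sumr.
under [RHS]eq_bigr do rewrite BE mulr_sumr.
rewrite exchange_big; apply: eq_bigr => l _; apply: eq_bigr => i _.
by rewrite Ts mulrCA.
Qed.

Lemma jacobianE (p : nat) (phi : 'rV[R]_m -> 'rV[R]_p) y i k : differentiable phi y ->
  ('J phi y) i k = partial i (fun x => phi x 0 k) y.
Proof.
move=> dphi; have := deriveEjacobian (delta_mx 0 i) dphi.
rewrite -rowE derive_mx; last exact: diff_derivable.
by move/rowP/(_ k); rewrite !mxE.
Qed.

Section Jacobian.
Variables (p : nat) (U : set 'rV[R]_m) (phi : 'rV[R]_m -> 'rV[R]_p).
Hypotheses (oU : open U) (sphi : smooth_mx_on U phi).

Lemma smooth_jacobian : smooth_mx_on U (fun y => 'J phi y).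
Proof.
move=> i k n; apply: (@Ck_eq _ _ _ _ (partial i (fun x => phi x 0 k))) => //.
  by move=> y Uy; rewrite jacobianE//; exact: smooth_mx_differentiable Uy.
by have [_] := sphi 0 k n.+1; exact.
Qed.

Lemma derive_jacobian_sym y u w : U y ->
  w *m 'D_u (fun y => 'J phi y) y = u *m 'D_w (fun y => 'J phi y) y.
Proof.
move=> Uy; have dB := smooth_mx_differentiable smooth_jacobian Uy.
have DB v i k : ('D_v (fun y => 'J phi y) y) i k =
    \sum_l v 0 l * partial l (partial i (fun x => phi x 0 k)) y.
  rewrite derive_mx; last exact: diff_derivable.
  rewrite mxE derive_sum_partial; last exact: differentiable_entry.
  apply: eq_bigr => l _; congr (_ * _); apply: (eq_partial _ oU) => // z Uz.
  exact/jacobianE/(smooth_mx_differentiable sphi).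
apply: (mulmx_sym_tensor (DB u) (DB w)) => l i k.
exact: schwarz oU Uy (sphi 0 k 2).
Qed.

End Jacobian.

Variables (U : set 'rV[R]_m) (phi : 'rV[R]_m -> 'rV[R]_m).
Variables (Ga Gb : 'rV[R]_m -> 'M[R]_m) (y : 'rV[R]_m).
Hypotheses (oU : open U) (Uy : U y) (sphi : smooth_mx_on U phi).
Hypothesis GaE : forall z, U z -> Ga z = 'J phi z *m Gb (phi z) *m ('J phi z)^T.
Hypotheses (dGb : differentiable Gb (phi y)) (Gbs : (Gb (phi y))^T = Gb (phi y)).
Hypotheses (Gbu : Gb (phi y) \in unitmx) (Bu : 'J phi y \in unitmx).

(** Tested against vectors [z *m B] with the metric [G], both sides become Koszul expressions; the
    second derivative of the coordinate change is the defect computed in [koszul_change]. *)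
Lemma connection_change u :
  connection_mx Ga y u *m 'J phi y =
  'D_u (fun z => 'J phi z) y + 'J phi y *m connection_mx Gb (phi y) (u *m 'J phi y).
Proof.
set B := 'J phi y; set G := Gb (phi y).
have dphi := smooth_mx_differentiable sphi Uy.
have dB := smooth_mx_differentiable (smooth_jacobian oU sphi) Uy.
have dGphi : differentiable (Gb \o phi) y by exact: differentiable_comp.
have DGphi v : 'D_v (Gb \o phi) y = 'D_(v *m B) Gb (phi y).
  rewrite deriveE// diff_comp//= [RHS]deriveE//.
  by rewrite -[v *m B](deriveEjacobian v dphi) [in RHS]deriveE.
have dGa0 : differentiable (fun z => 'J phi z *m Gb (phi z) *m ('J phi z)^T) y.
  apply: differentiable_mulmx; first exact: differentiable_mulmx.
  apply: differentiable_mx => i j; under eq_fun do rewrite mxE.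
  exact: differentiable_entry.
have GaE_near : \forall z \near y, 'J phi z *m Gb (phi z) *m ('J phi z)^T = Ga z.
  by apply: filterS (open_nbhs_sub oU Uy) => z /GaE.
have dGa : differentiable Ga y := near_eq_differentiable GaE_near dGa0.
pose H v := 'D_v (fun z => 'J phi z) y.
have DGa v : 'D_v Ga y = H v *m G *m B^T + B *m 'D_(v *m B) Gb (phi y) *m B^T
    + B *m G *m (H v)^T.
  apply: (is_derive_uniq (differentiable_is_derive v dGa)).
  apply: near_eq_is_derive GaE_near _.
  have dBv := differentiable_is_derive v dB.
  have := is_derive_mulmx (is_derive_mulmx dBv (differentiable_is_derive v dGphi))
    (is_derive_trmx dBv).
  by rewrite DGphi mulmxDl.
have GaU : Ga y = B *m G *m B^T by exact: GaE.
have Gas : (Ga y)^T = Ga y by rewrite GaU !trmx_mul trmxK Gbs mulmxA.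
have Gau : Ga y \in unitmx by rewrite GaU !unitmx_mul unitmx_tr Bu Gbu.
have inj (A C : 'M[R]_m) :
    (forall w z, bform G (w *m A) (z *m B) = bform G (w *m C) (z *m B)) -> A = C.
  move=> AC; have : A *m (G *m B^T) = C *m (G *m B^T).
    by apply: bform_inj => w z; rewrite !mulmxA !bform_mul.
  have Gu' : G *m B^T \in unitmx by rewrite unitmx_mul unitmx_tr Bu Gbu.
  by move/(congr1 (fun M => M *m invmx (G *m B^T))); rewrite !mulmxK.
apply: inj => w z; rewrite mulmxDr bformDl !mulmxA.
rewrite (koszulE (u *m B) (w *m B) (z *m B) dGb Gbs Gbu).
have := koszulE u w z dGa Gas Gau; rewrite GaU bform_mul => ->.
have Hs a b : a *m H b = b *m H a.
  exact: derive_jacobian_sym oU sphi _ _ _ Uy.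
rewrite [RHS]addrC.
exact: (koszul_change (Db := fun v => 'D_v Gb (phi y)) u w z Gbs Hs DGa).
Qed.

End ChangeOfCoordinates.

Section Jacobians.
Context {R : realType}.

Lemma mulmx_row_inj m n (A B : 'M[R]_(m, n)) : (forall v : 'rV_m, v *m A = v *m B) -> A = B.
Proof. by move=> AB; apply/row_matrixP => i; rewrite !rowE. Qed.

Lemma jacobian_comp m n p (f : 'rV[R]_m -> 'rV[R]_n) (g : 'rV[R]_n -> 'rV[R]_p) y :
  differentiable f y -> differentiable g (f y) ->
  'J (g \o f) y = 'J f y *m 'J g (f y).
Proof.
move=> df dg; have dgf : differentiable (g \o f) y by exact: differentiable_comp.
apply: mulmx_row_inj => v; rewrite mulmxA -(deriveEjacobian v df).
apply: etrans (esym (deriveEjacobian v dgf)) _; apply: etrans (deriveEjacobian _ dg).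
by rewrite (deriveE v dgf) diff_comp//= -(deriveE v df) -(deriveE _ dg).
Qed.

Lemma near_eq_jacobian m n (f g : 'rV[R]_m -> 'rV[R]_n) y :
  {near y, f =1 g} -> differentiable f y -> 'J f y = 'J g y.
Proof.
move=> fg df; have dg := near_eq_differentiable fg df.
apply: mulmx_row_inj => v; apply: etrans (esym (deriveEjacobian v df)) _.
by apply: etrans (deriveEjacobian v dg); exact: near_eq_derive.
Qed.

Lemma jacobian_id m (y : 'rV[R]_m) : 'J id y = 1%:M.
Proof.
have did : differentiable (@id 'rV[R]_m) y by [].
by apply: mulmx_row_inj => v; rewrite -(deriveEjacobian v did) derive_id mulmx1.
Qed.

End Jacobians.

(** * Charts and components of vectors and bilinear forms *)

Section Charts.
Context {R : realType} {m : nat} (X : manifold R m).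
Implicit Types (a b : chart X) (x : X) (y : 'rV[R]_m) (v : 'rV[R]_m).

Lemma coord_image a x : dom X a x -> chart_image a (coord X a x).
Proof. by move=> ax; exists x. Qed.

Lemma paramK a y : chart_image a y -> coord X a (param X a y) = y.
Proof. by move=> [x ax <-]; rewrite coordK. Qed.

Lemma param_dom a y : chart_image a y -> dom X a (param X a y).
Proof. by move=> [x ax <-]; rewrite coordK. Qed.

Lemma coord_continuous_at a x : dom X a x -> {for x, continuous (coord X a)}.
Proof. by move=> ax; apply: (@coord_continuous _ _ X a x); rewrite inE. Qed.

Lemma param_continuous_at a y : chart_image a y -> {for y, continuous (param X a)}.
Proof. by move=> ay; apply: (@param_continuous _ _ X a y); rewrite inE. Qed.

Lemma open_chart_image a : open (chart_image a).
Proof. exact: (@image_open _ _ X a). Qed.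
Arguments open_chart_image a : clear implicits.

Lemma open_coord_image a (W : set X) : open W -> open (coord X a @` (dom X a `&` W)).
Proof.
move=> oW; rewrite openE => _ [x [ax Wx] <-].
have ay : chart_image a (coord X a x) by exists x.
have nW : \forall z \near coord X a x, W (param X a z).
  by apply: (param_continuous_at ay); rewrite /= coordK//; exact: open_nbhs_sub.
have nI : \forall z \near coord X a x, chart_image a z.
  exact: open_nbhs_sub (open_chart_image a) ay.
change (nbhs (coord X a x) (coord X a @` (dom X a `&` W))).
apply: filterS2 nW nI => z Wz [x' ax' x'z].
by exists x' => //; split=> //; rewrite -x'z coordK in Wz.
Qed.

Definition overlap a b := coord X a @` (dom X a `&` dom X b).

Lemma open_overlap a b : open (overlap a b).
Proof. by apply: open_coord_image; exact: dom_open. Qed.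
Arguments open_overlap a b : clear implicits.

Lemma overlap_coord a b x : dom X a x -> dom X b x -> overlap a b (coord X a x).
Proof. by move=> ax bx; exists x. Qed.

Lemma transition_differentiable a b x : dom X a x -> dom X b x ->
  differentiable (coord X b \o param X a) (coord X a x).
Proof.
move=> ax bx.
exact: smooth_mx_differentiable (transition_smooth a b) (overlap_coord ax bx).
Qed.

Lemma chart_changeM a b c x : dom X a x -> dom X b x -> dom X c x ->
  chart_change a b x *m chart_change b c x = chart_change a c x.
Proof.
move=> ax bx cx; rewrite /chart_change.
have dab := transition_differentiable ax bx.
have y0 : (coord X b \o param X a) (coord X a x) = coord X b x by rewrite /= coordK.
have dbc := transition_differentiable bx cx; rewrite -y0 in dbc *.
apply: etrans (esym (jacobian_comp dab dbc)) _.
apply: near_eq_jacobian; last exact: differentiable_comp.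
apply: filterS (open_nbhs_sub (open_overlap a b) (overlap_coord ax bx)).
by move=> _ [x' [ax' bx'] <-] /=; rewrite coordK// coordK.
Qed.

Lemma chart_change_id a x : dom X a x -> chart_change a a x = 1%:M.
Proof.
move=> ax; rewrite /chart_change -(jacobian_id (coord X a x)).
apply: near_eq_jacobian; last exact: transition_differentiable.
by apply: filterS (open_nbhs_sub (open_chart_image a) (coord_image ax)) => y /paramK.
Qed.

Lemma chart_changeK a b x : dom X a x -> dom X b x ->
  chart_change a b x *m chart_change b a x = 1%:M.
Proof. by move=> ax bx; rewrite chart_changeM// chart_change_id. Qed.

Lemma chart_change_unit a b x : dom X a x -> dom X b x -> chart_change a b x \in unitmx.
Proof. by move=> ax bx; have [U _] := mulmx1_unit (chart_changeK ax bx); exact: U. Qed.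

Lemma vector_in_change a b x v : dom X a x -> dom X b x ->
  vector_in b x v = vector_in a x v *m chart_change a b x.
Proof.
by move=> ax bx; rewrite /vector_in -mulmxA chart_changeM//; exact: dom_chart_at.
Qed.

Lemma vector_inK a x v : dom X a x ->
  vector_in a x (v *m chart_change a (chart_at X x) x) = v.
Proof.
by move=> ax; rewrite /vector_in -mulmxA chart_changeK ?mulmx1//; exact: dom_chart_at.
Qed.

Lemma bilinear_inE (h : X -> 'M[R]_m) a x : dom X a x ->
  bilinear_in h a (coord X a x) =
  chart_change a (chart_at X x) x *m h x *m (chart_change a (chart_at X x) x)^T.
Proof. by move=> ax; rewrite /bilinear_in (coordK ax). Qed.

Lemma bilinear_in_change (h : X -> 'M[R]_m) a b y : overlap a b y ->
  bilinear_in h a y = 'J (coord X b \o param X a) y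
    *m bilinear_in h b ((coord X b \o param X a) y)
    *m ('J (coord X b \o param X a) y)^T.
Proof.
move=> [x [ax bx] <-].
have phi : (coord X b \o param X a) (coord X a x) = coord X b x by rewrite /= coordK.
rewrite phi (bilinear_inE _ ax) (bilinear_inE _ bx).
rewrite -(chart_changeM ax bx (dom_chart_at x)).
by rewrite trmx_mul !mulmxA.
Qed.

Lemma bilinear_in_coord (h : X -> 'M[R]_m) a x u v : dom X a x ->
  bform (bilinear_in h a (coord X a x)) (vector_in a x u) (vector_in a x v) = bform (h x) u v.
Proof.
move=> ax; rewrite (bilinear_inE _ ax) bform_mul /vector_in -!mulmxA.
by rewrite (chart_changeK (dom_chart_at x) ax) !mulmx1.
Qed.

End Charts.
Arguments open_chart_image {R m X} a.
Arguments open_overlap {R m X} a b.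

(** * Parallel transport *)

Section ParallelFields.
Context {R : realType} {m : nat} {X : manifold R m}.
Implicit Types (c gamma : R -> X) (V W : R -> 'rV[R]_m) (t s : R) (a b : chart X).

Lemma C1_curve_derivable c t a : C1_curve_at c t -> dom X a (c t) ->
  is_derive t 1 (coord X a \o c) (derive1 (coord X a \o c) t).
Proof.
move=> [_ cc] /cc[dc _]; rewrite derive1E; apply: derivableP.
exact: nbhs_singleton dc.
Qed.

Lemma curve_near_dom c t a : {for t, continuous c} -> dom X a (c t) ->
  \forall s \near t, dom X a (c s).
Proof. by move=> cc ac; apply: cc; exact: open_nbhs_sub (dom_open a) ac. Qed.

Lemma curve_coord_change c t a b : {for t, continuous c} ->
  dom X a (c t) -> dom X b (c t) ->
  \forall s \near t, ((coord X b \o param X a) \o (coord X a \o c)) s = (coord X b \o c) s.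
Proof.
move=> cc ac bc; apply: filterS (curve_near_dom cc ac) => s acs.
by rewrite /= coordK.
Qed.

Lemma velocity_change c t a b : C1_curve_at c t -> dom X a (c t) -> dom X b (c t) ->
  derive1 (coord X b \o c) t = derive1 (coord X a \o c) t *m chart_change a b (c t).
Proof.
move=> Cc ac bc; have dphi := transition_differentiable ac bc.
have d := is_derive1_comp (F := coord X b \o param X a) (u := coord X a \o c) dphi
  (C1_curve_derivable Cc ac).
apply: (is_derive_uniq (C1_curve_derivable Cc bc)).
apply: near_eq_is_derive (curve_coord_change Cc.1 ac bc) _.
by apply: (is_derive_eq d); rewrite (deriveEjacobian _ dphi).
Qed.

Definition parallel_at (g : X -> 'M[R]_m) gamma V t : Prop :=
  forall a, dom X a (gamma t) ->
  is_derive t 1 (fun s => vector_in a (gamma s) (V s))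
    (- (vector_in a (gamma t) (V t) *m connection_mx (bilinear_in g a)
          (coord X a (gamma t)) (derive1 (coord X a \o gamma) t))).

Definition continuous_field (A : set R) gamma V t : Prop :=
  forall a, dom X a (gamma t) ->
  (fun s => vector_in a (gamma s) (V s)) @ within A (nbhs t) -->
  vector_in a (gamma t) (V t).

Lemma parallelP g gamma V : parallel g gamma V <->
  (forall t, 0 <= t <= 1 -> continuous_field `[0, 1] gamma V t) /\
  (exists E : seq R, forall t, 0 < t < 1 -> t \notin E -> parallel_at g gamma V t).
Proof.
split=> [[cV [E dV]]|[cV [E dV]]]; split=> //; exists E => t t01 tE a ac.
  by rewrite connection_mxE; exact: dV.
by rewrite -connection_mxE; exact: dV.
Qed.

Lemma gauge_change (w : 'rV[R]_m) (A A' B H : 'M[R]_m) : A *m B = H + B *m A' ->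
  - (w *m A) *m B + w *m H = - (w *m B *m A').
Proof.
by move=> E; rewrite mulNmx -(mulmxA w A B) E mulmxDr opprD addrAC addNr add0r mulmxA.
Qed.

Lemma metric_balance (v w : 'rV[R]_m) (A G D : 'M[R]_m) : D = A *m G + G *m A^T ->
  ((- (v *m A) *m G + v *m D) *m w^T + v *m G *m (- (w *m A))^T) 0 0 = 0.
Proof.
move=> ->; rewrite linearN /= trmx_mul mulmxN mulNmx mulmxDr !mulmxA.
by rewrite addrA addNr add0r subrr mxE.
Qed.

Section Riemannian.
Variable g : X -> 'M[R]_m.
Hypothesis riem : riemannian g.

Lemma metric_sym a y : (bilinear_in g a y)^T = bilinear_in g a y.
Proof.
have [gs _ _] := riem.
by rewrite /bilinear_in !trmx_mul trmxK gs mulmxA.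
Qed.

Lemma metric_unit_at x : g x \in unitmx.
Proof.
have [_ gp _] := riem; rewrite -row_free_unit -kermx_eq0.
apply/eqP/row_matrixP => i; rewrite row0; apply/eqP; apply: contraT => v0.
have := gp x _ v0; have /sub_kermxP -> := row_sub i (kermx (g x)).
by rewrite mul0mx mxE ltxx.
Qed.

Lemma metric_unit a y : chart_image a y -> bilinear_in g a y \in unitmx.
Proof.
move=> [x ax <-]; rewrite (bilinear_inE _ ax) !unitmx_mul unitmx_tr metric_unit_at.
by rewrite (chart_change_unit ax (dom_chart_at x)).
Qed.

Lemma metric_differentiable a y : chart_image a y -> differentiable (bilinear_in g a) y.
Proof. by have [_ _ gs] := riem; exact: smooth_mx_differentiable. Qed.

(** One chart suffices: along the curve, the derivative of the Jacobian matrix produces exactly the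
    inhomogeneous term of [connection_change], and the two cancel. *)
Lemma parallel_at_chart gamma V t a : C1_curve_at gamma t -> dom X a (gamma t) ->
  is_derive t 1 (fun s => vector_in a (gamma s) (V s))
    (- (vector_in a (gamma t) (V t) *m connection_mx (bilinear_in g a)
          (coord X a (gamma t)) (derive1 (coord X a \o gamma) t))) ->
  parallel_at g gamma V t.
Proof.
move=> Cg ac dV b bc.
set y := coord X a (gamma t); set u := derive1 (coord X a \o gamma) t.
pose phi := coord X b \o param X a.
have sphi := transition_smooth a b.
have oU : open (overlap a b) := open_overlap a b.
have Uy : overlap a b y := overlap_coord ac bc.
have phiy : phi y = coord X b (gamma t) by rewrite /phi /= coordK.
have bimg : chart_image b (phi y) by rewrite phiy; exact: coord_image.
have Bu : 'J phi y \in unitmx := chart_change_unit ac bc.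
have CC := connection_change oU Uy sphi (@bilinear_in_change _ _ X g a b)
  (metric_differentiable bimg) (metric_sym b _) (metric_unit bimg) Bu u.
have dB := smooth_mx_differentiable (smooth_jacobian oU sphi) Uy.
have dJ := is_derive1_comp (F := fun z => 'J phi z) (u := coord X a \o gamma) dB
  (C1_curve_derivable Cg ac).
have dW := is_derive_mulmx dV dJ.
have nearW : \forall s \near t, vector_in a (gamma s) (V s) *m 'J phi (coord X a (gamma s))
    = vector_in b (gamma s) (V s).
  apply: filterS2 (curve_near_dom Cg.1 ac) (curve_near_dom Cg.1 bc) => s acs bcs.
  exact/esym/vector_in_change.
apply: (is_derive_eq (near_eq_is_derive nearW dW)).
rewrite (vector_in_change _ ac bc) (velocity_change Cg ac bc).
rewrite (phiy : (coord X b \o param X a) y = _) in CC.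
exact: gauge_change CC.
Qed.

(** The chart is fixed at time [t], and nearby values of the product are computed in it; the
    derivative of the metric is then cancelled by the two connection terms through
    [connection_metric]. *)
Lemma bform_parallel gamma V W t : C1_curve_at gamma t ->
  parallel_at g gamma V t -> parallel_at g gamma W t ->
  is_derive t 1 (fun s => bform (g (gamma s)) (V s) (W s)) 0.
Proof.
move=> Cg pV pW; pose a := chart_at X (gamma t).
have ac : dom X a (gamma t) by exact: dom_chart_at.
set y := coord X a (gamma t); set u := derive1 (coord X a \o gamma) t.
have oI := open_chart_image a; have yI := coord_image ac.
have CM := connection_metric oI yI (metric_differentiable yI)
  (fun z _ => metric_sym a z) (metric_unit yI) u.
have dG := is_derive1_comp (F := bilinear_in g a) (u := coord X a \o gamma)
  (metric_differentiable yI) (C1_curve_derivable Cg ac).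
have dF := is_derive_mulmx (is_derive_mulmx (pV a ac) dG) (is_derive_trmx (pW a ac)).
have nearF : \forall s \near t,
    (vector_in a (gamma s) (V s) *m bilinear_in g a (coord X a (gamma s)) *m
    (vector_in a (gamma s) (W s))^T) 0 0 = bform (g (gamma s)) (V s) (W s).
  apply: filterS (curve_near_dom Cg.1 ac) => s acs.
  exact: bilinear_in_coord acs.
have dF0 := (is_derive_mxP _ _ _ _).1 dF 0 0.
apply: (is_derive_eq (near_eq_is_derive nearF dF0)).
exact: metric_balance CM.
Qed.

Lemma bform_continuous (A : set R) gamma V W t : gamma @ within A (nbhs t) --> gamma t ->
  continuous_field A gamma V t -> continuous_field A gamma W t ->
  (fun s => bform (g (gamma s)) (V s) (W s)) @ within A (nbhs t) -->
  bform (g (gamma t)) (V t) (W t).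
Proof.
move=> cg cV cW; pose a := chart_at X (gamma t).
have ac : dom X a (gamma t) by exact: dom_chart_at.
have nearF : \forall s \near within A (nbhs t),
    (vector_in a (gamma s) (V s) *m bilinear_in g a (coord X a (gamma s)) *m
    (vector_in a (gamma s) (W s))^T) 0 0 = bform (g (gamma s)) (V s) (W s).
  have nd : \forall s \near within A (nbhs t), dom X a (gamma s).
    by apply: cg; exact: open_nbhs_sub (dom_open a) ac.
  by apply: filterS nd => s acs; exact: bilinear_in_coord acs.
apply: cvg_trans (near_eq_cvg nearF) _.
have FF : Filter (within A (nbhs t)) by exact: within_filter.
have cG : (fun s => bilinear_in g a (coord X a (gamma s))) @ within A (nbhs t) -->
    bilinear_in g a (coord X a (gamma t)).
  have cc : coord X a @ nbhs (gamma t) --> coord X a (gamma t).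
    exact: coord_continuous_at.
  have cG0 : bilinear_in g a @ nbhs (coord X a (gamma t)) --> bilinear_in g a (coord X a (gamma t)).
    exact: differentiable_continuous (metric_differentiable (coord_image ac)).
  exact: cvg_comp (cvg_comp _ _ cg cc) cG0.
rewrite -(bilinear_in_coord g (V t) (W t) ac).
have cF := cvg_mulmx (FF := FF) (cvg_mulmx (FF := FF) (cV a ac) cG)
  (cvg_trmx (FF := FF) (cW a ac)).
exact: (cvg_mxP (FF := FF) _ _).1 cF 0 0.
Qed.

End Riemannian.
End ParallelFields.

(** * Affine reparametrization and gluing of parallel fields *)

Section AffineReparametrization.
Context {R : realType} {m : nat} {X : manifold R m}.
Implicit Types (c gamma : R -> X) (V W : R -> 'rV[R]_m) (t s al be : R) (a b : chart X).

Definition affine (al be s : R) : R := al + be * s.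

Lemma affine_is_derive al be t : is_derive t 1 (affine al be) be.
Proof. exact: is_derive_affine. Qed.

Lemma affine_continuous al be : continuous (affine al be).
Proof.
move=> t; have [dh _] := affine_is_derive al be t.
exact/differentiable_continuous/derivable1_diffP.
Qed.

Lemma affine_comp (al be al' be' : R) (T : Type) (f : R -> T) :
  (f \o affine al be) \o affine al' be' = f \o affine (al + be * al') (be * be').
Proof. by apply/funext => s; rewrite /= /affine mulrDr mulrA addrA. Qed.

Lemma affineK al be : be != 0 -> cancel (affine al be) (affine (- al / be) be^-1).
Proof. by move=> be0 s; rewrite /affine; field. Qed.

Lemma affineVK al be : be != 0 -> cancel (affine (- al / be) be^-1) (affine al be).
Proof. by move=> be0 s; rewrite /affine; field. Qed.

Lemma affineVE al be s : be != 0 -> affine (- al / be) be^-1 s = (s - al) / be.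
Proof. by move=> be0; rewrite /affine; field. Qed.

Lemma near_affine al be t (P : R -> Prop) :
  (\forall s \near affine al be t, P s) -> \forall s \near t, P (affine al be s).
Proof. by move=> nP; apply: (@affine_continuous al be t). Qed.

Lemma C1_curve_near c c' t : {near t, c =1 c'} -> C1_curve_at c t -> C1_curve_at c' t.
Proof.
move=> cc' [cont Cc]; have ct := nbhs_singleton cc'.
split.
  by rewrite /prop_for /continuous_at -ct; apply: cvg_trans cont; exact: near_eq_cvg cc'.
move=> a ac; rewrite -ct in ac; have [dc dcc] := Cc a ac.
have coordE : \forall s \near t, {near s, coord X a \o c =1 coord X a \o c'}.
  move/near_join : cc'; apply: filterS => s; apply: filterS => s' /= -> //.
split.
  by apply: filterS2 dc coordE => s ds es; exact: near_eq_derivable es ds.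
have dE : \forall s \near t, derive1 (coord X a \o c) s = derive1 (coord X a \o c') s.
  by apply: filterS coordE => s es; rewrite !derive1E; exact: near_eq_derive.
rewrite /prop_for /continuous_at -(nbhs_singleton dE).
by apply: cvg_trans dcc; exact: near_eq_cvg dE.
Qed.

Lemma derive1_affine (U : normedModType R) (f : R -> U) al be t :
  derivable f (affine al be t) 1 ->
  is_derive t 1 (f \o affine al be) (be *: derive1 f (affine al be t)).
Proof.
move=> df; apply: is_derive_comp_scal (affine_is_derive al be t).
by rewrite derive1E; apply: derivableP.
Qed.

Lemma C1_curve_affine c al be t :
  C1_curve_at c (affine al be t) -> C1_curve_at (c \o affine al be) t.
Proof.
move=> [cont Cc]; split.
  by apply: continuous_comp => //; exact: affine_continuous.
move=> a ac; have [dc dcc] := Cc a ac.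
have dn : \forall s \near t, is_derive (s : R) 1 (coord X a \o (c \o affine al be))
    (be *: derive1 (coord X a \o c) (affine al be s)).
  by apply: filterS (near_affine dc) => s; exact: derive1_affine.
split; first by apply: filterS dn => s [].
have dE : \forall s \near t, be *: derive1 (coord X a \o c) (affine al be s)
    = derive1 (coord X a \o (c \o affine al be)) s.
  by apply: filterS dn => s [_ E]; rewrite [RHS]derive1E E.
rewrite /prop_for /continuous_at -(nbhs_singleton dE).
apply: cvg_trans (near_eq_cvg dE) _.
have cc : (derive1 (coord X a \o c) \o affine al be) @ t -->
    derive1 (coord X a \o c) (affine al be t).
  by apply: continuous_comp dcc; exact: affine_continuous.
exact: cvgZr.
Qed.

Lemma parallel_at_near (g : X -> 'M[R]_m) gamma gamma' V V' t :
  {near t, gamma =1 gamma'} -> {near t, V =1 V'} ->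
  parallel_at g gamma V t -> parallel_at g gamma' V' t.
Proof.
move=> gg VV pV a ac; have gt := nbhs_singleton gg; have Vt := nbhs_singleton VV.
rewrite -gt in ac *; rewrite -Vt.
have -> : derive1 (coord X a \o gamma') t = derive1 (coord X a \o gamma) t.
  rewrite !derive1E; apply: near_eq_derive.
  by apply: filterS gg => s /= ->.
apply: near_eq_is_derive (pV a ac).
by apply: filterS2 gg VV => s -> ->.
Qed.

(** The equation is linear in the velocity, so both sides are multiplied by [be]. *)
Lemma parallel_at_affine (g : X -> 'M[R]_m) gamma V al be t :
  C1_curve_at gamma (affine al be t) -> parallel_at g gamma V (affine al be t) ->
  parallel_at g (gamma \o affine al be) (V \o affine al be) t.
Proof.
move=> Cg pV a ac.
have [dF FE] := pV a ac; have dFh := derive1_affine dF.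
apply: (is_derive_eq dFh); rewrite derive1E FE.
have [du _] := C1_curve_derivable Cg ac.
have [_ uE] := derive1_affine du; rewrite -derive1E in uE.
have -> : derive1 (coord X a \o (gamma \o affine al be)) t =
  be *: derive1 (coord X a \o gamma) (affine al be t) by exact: uE.
by rewrite connection_mxZ -scalemxAr scalerN.
Qed.

End AffineReparametrization.

Section Gluing.
Context {R : realType} {m : nat} {X : manifold R m}.
Implicit Types (gamma : R -> X) (V W : R -> 'rV[R]_m) (t s al be : R) (A B : set R).

Lemma within_cvg_eq (T : topologicalType) (f f' : R -> T) A t (l : T) :
  (forall s, A s -> f s = f' s) ->
  f @ within A (nbhs t) --> l -> f' @ within A (nbhs t) --> l.
Proof.
move=> ff fl P nP; have nf : nbhs t [set s | A s -> P (f s)] := fl P nP.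
by apply: filterS nf => s Ps As; rewrite /= -(ff s As); exact: Ps.
Qed.

Lemma continuous_field_affine A B gamma V al be t :
  (forall s, A s -> B (affine al be s)) ->
  continuous_field B gamma V (affine al be t) ->
  continuous_field A (gamma \o affine al be) (V \o affine al be) t.
Proof.
move=> AB cV a ac; apply: cvg_trans (cV a ac) => P nP.
have := near_affine nP; apply: filterS => s Ps As; exact/Ps/AB.
Qed.

Lemma continuous_field_eq A gamma V V' t : A t -> (forall s, A s -> V s = V' s) ->
  continuous_field A gamma V t -> continuous_field A gamma V' t.
Proof.
move=> At VV cV a ac; rewrite -(VV t At).
by apply: within_cvg_eq (cV a ac) => s /VV ->.
Qed.

Lemma continuous_field_path A gamma gamma' V t : A t ->
  (forall s, A s -> gamma s = gamma' s) ->
  continuous_field A gamma V t -> continuous_field A gamma' V t.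
Proof.
move=> At gg cV a; rewrite -(gg t At) => ac.
by apply: within_cvg_eq (cV a ac) => s /gg ->.
Qed.

Lemma within_cvgU (T : topologicalType) (f : R -> T) A B t (l : T) :
  f @ within A (nbhs t) --> l -> f @ within B (nbhs t) --> l ->
  f @ within (A `|` B) (nbhs t) --> l.
Proof.
move=> fA fB P nP.
have nA : nbhs t [set s | A s -> P (f s)] := fA P nP.
have nB : nbhs t [set s | B s -> P (f s)] := fB P nP.
change (nbhs t [set s | (A `|` B) s -> P (f s)]).
by apply: filterS2 nA nB => s PA PB [As|Bs]; [exact: PA|exact: PB].
Qed.

Lemma within_cvg_away (T : topologicalType) (f : R -> T) A t (l : T) :
  closed A -> ~ A t -> f @ within A (nbhs t) --> l.
Proof.
move=> cA At P nP; have oA : open (~` A) by exact: closed_openC.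
change (nbhs t [set s | A s -> P (f s)]).
by apply: filterS (open_nbhs_sub oA At) => s As /As.
Qed.

Lemma within_cvg_segment (T : topologicalType) (f : R -> T) (x y z t : R) (l : T) :
  x <= y -> y <= z ->
  (x <= t <= y -> f @ within `[x, y] (nbhs t) --> l) ->
  (y <= t <= z -> f @ within `[y, z] (nbhs t) --> l) ->
  f @ within `[x, z] (nbhs t) --> l.
Proof.
move=> xy yz f1 f2.
have -> : `[x, z]%classic = `[x, y] `|` `[y, z].
  apply/seteqP; split=> s /=; rewrite !in_itv /=.
    by move=> /andP[xs sz]; case: (leP s y) => [sy|/ltW ys]; [left|right]; apply/andP.
  by case=> /andP[? ?]; apply/andP; split=> //; [exact: le_trans yz|exact: le_trans xy _].
have itvP (u v : R) : reflect (`[u, v]%classic t) (u <= t <= v).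
  by rewrite /= in_itv /=; exact: idP.
apply: within_cvgU.
  have [/itvP|/itvP nt] := boolP (x <= t <= y); first by move/itvP.
  by apply: within_cvg_away nt; exact: interval_closed.
have [/itvP|/itvP nt] := boolP (y <= t <= z); first by move/itvP.
by apply: within_cvg_away nt; exact: interval_closed.
Qed.

(** The part of piecewise C^1 regularity that transport uses. It does not mention a subdivision, so
    it passes directly to affine pieces and to the reversed path. *)
Definition regular_path gamma : Prop :=
  (forall t, 0 <= t <= 1 -> gamma @ within `[0, 1] (nbhs t) --> gamma t) /\
  exists E : seq R, forall t, 0 < t < 1 -> t \notin E -> C1_curve_at gamma t.

Lemma near_itvoo (x y t : R) : x < t < y -> \forall s \near t, x < s < y.
Proof.
move=> txy; have tI : t \in `]x, y[%R by rewrite in_itv.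
by have := near_in_itvoo tI; apply: filterS => s; rewrite in_itv.
Qed.

Lemma parallel_eq_path g gamma gamma' V :
  (forall t, 0 <= t <= 1 -> gamma t = gamma' t) ->
  parallel g gamma V -> parallel g gamma' V.
Proof.
move=> gg /parallelP[cV [E pV]]; apply/parallelP; split.
  move=> t t01; apply: continuous_field_path (cV t t01).
    by rewrite /= in_itv.
  by move=> s; rewrite /= in_itv; exact: gg.
exists E => t t01 tE; apply: parallel_at_near (pV t t01 tE); last by near=> s.
have := near_itvoo t01; apply: filterS => s /andP[s0 s1].
by apply: gg; rewrite !ltW.
Unshelve. all: by end_near. Qed.

Lemma affine_itv al be s : 0 <= al <= 1 -> 0 <= al + be <= 1 -> 0 <= s <= 1 ->
  0 <= affine al be s <= 1.
Proof.
move=> /andP[a0 a1] /andP[ab0 ab1] /andP[s0 s1].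
have -> : affine al be s = (1 - s) * al + s * (al + be) by rewrite /affine; ring.
apply/andP; split; first by rewrite addr_ge0// mulr_ge0// subr_ge0.
have : (1 - s) * al + s * (al + be) <= (1 - s) * 1 + s * 1.
  by rewrite lerD// ler_wpM2l// subr_ge0.
by rewrite !mulr1 subrK.
Qed.

Lemma affine_itvoo al be s : be != 0 -> 0 <= al <= 1 -> 0 <= al + be <= 1 -> 0 < s < 1 ->
  0 < affine al be s < 1.
Proof.
move=> be0 /andP[a0 a1] /andP[ab0 ab1] /andP[s0 s1]; rewrite /affine.
have [b0|b0|b0] := ltgtP be 0; last by rewrite b0 eqxx in be0.
- have h1 : 0 < - be * s by rewrite mulr_gt0// oppr_gt0.
  have h2 : 0 < - be * (1 - s) by rewrite mulr_gt0 ?oppr_gt0// subr_gt0.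
  by apply/andP; split; lra.
- have h1 : 0 < be * s by rewrite mulr_gt0.
  have h2 : 0 < be * (1 - s) by rewrite mulr_gt0// subr_gt0.
  by apply/andP; split; lra.
Qed.

Lemma regular_affine gamma al be : be != 0 -> 0 <= al <= 1 -> 0 <= al + be <= 1 ->
  regular_path gamma -> regular_path (gamma \o affine al be).
Proof.
move=> be0 a01 ab01 [cg [E CE]]; split.
  move=> t t01; apply: cvg_trans (cg _ (affine_itv a01 ab01 t01)) => P nP.
  have := near_affine nP; apply: filterS => s Ps s01; apply: Ps.
  by move: s01; rewrite /= !in_itv /=; exact: affine_itv.
exists [seq affine (- al / be) be^-1 s | s <- E] => t t01 tE.
apply: C1_curve_affine; apply: CE (affine_itvoo be0 a01 ab01 t01) _.
by apply: contra tE => tE; apply/mapP; exists (affine al be t); rewrite // affineK.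
Qed.

Lemma parallel_affine g gamma V al be : be != 0 -> 0 <= al <= 1 -> 0 <= al + be <= 1 ->
  regular_path gamma -> parallel g gamma V ->
  parallel g (gamma \o affine al be) (V \o affine al be).
Proof.
move=> be0 a01 ab01 [cg [E CE]] /parallelP[cV [E' pV]]; apply/parallelP; split.
  move=> t t01; apply: (@continuous_field_affine _ `[0, 1]).
    by move=> s; rewrite /= !in_itv /=; exact: affine_itv.
  exact: cV (affine_itv a01 ab01 t01).
exists [seq affine (- al / be) be^-1 s | s <- E ++ E'] => t t01 tE.
have tE' : affine al be t \notin E ++ E'.
  by apply: contra tE => tE; apply/mapP; exists (affine al be t); rewrite // affineK.
rewrite mem_cat negb_or in tE'; case/andP: tE' => tE1 tE2.
have t01' := affine_itvoo be0 a01 ab01 t01.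
by apply: parallel_at_affine; [exact: CE|exact: pV].
Qed.

Lemma parallel_glue g gamma V1 V2 th : regular_path gamma -> 0 < th < 1 ->
  parallel g (gamma \o affine 0 th) V1 ->
  parallel g (gamma \o affine th (1 - th)) V2 -> V1 1 = V2 0 ->
  exists V, [/\ parallel g gamma V, V 0 = V1 0 & V 1 = V2 1].
Proof.
move=> rg /andP[th0 th1] /parallelP[cV1 [E1 pV1]] /parallelP[cV2 [E2 pV2]] V12.
have thN0 : th != 0 by rewrite gt_eqF.
have th1N0 : 1 - th != 0 by rewrite gt_eqF// subr_gt0.
have th1p : 0 < 1 - th by rewrite subr_gt0.
pose h1 := affine 0 th; pose k1 := affine (- 0 / th) th^-1.
pose h2 := affine th (1 - th); pose k2 := affine (- th / (1 - th)) (1 - th)^-1.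
have g1 : (gamma \o h1) \o k1 = gamma by apply/funext => s; rewrite /= /h1 /k1 affineVK.
have g2 : (gamma \o h2) \o k2 = gamma by apply/funext => s; rewrite /= /h2 /k2 affineVK.
have k1E s : k1 s = s / th by rewrite /k1 affineVE// subr0.
have k2E s : k2 s = (s - th) / (1 - th) by rewrite /k2 affineVE.
pose V t := if t <= th then V1 (k1 t) else V2 (k2 t).
have VE1 s : 0 <= s <= th -> (V1 \o k1) s = V s by move=> /andP[_ sth]; rewrite /V sth.
have VE2 s : th <= s <= 1 -> (V2 \o k2) s = V s.
  move=> /andP[ths s1]; rewrite /V; case: leP => // sth.
  have -> : s = th by apply/le_anti/andP.
  by rewrite /= k1E k2E subrr mul0r divff// V12.
exists V; split; last 2 first.
- by rewrite /V (ltW th0) k1E mul0r.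
- by rewrite /V leNgt th1 /= k2E divff.
have k1i s : 0 <= s <= th -> 0 <= k1 s <= 1.
  by move=> /andP[s0 st]; rewrite k1E divr_ge0 ?(ltW th0)//= ler_pdivrMr// mul1r.
have k2i s : th <= s <= 1 -> 0 <= k2 s <= 1.
  move=> /andP[s0 st]; rewrite k2E divr_ge0 ?subr_ge0 ?(ltW th1)//=.
  by rewrite ler_pdivrMr// mul1r lerD2r.
apply/parallelP; split.
  move=> t t01 a ac; apply: (within_cvg_segment (y := th)); rewrite ?(ltW th0) ?(ltW th1)//.
    move=> tth; have tI : `[0, th]%classic t by rewrite /= in_itv.
    suff H : continuous_field `[0, th] gamma V t by exact: H.
    apply: (continuous_field_eq (V := V1 \o k1) tI).
      by move=> s; rewrite /= in_itv; exact: VE1.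
    rewrite -[X in continuous_field _ X]g1.
    apply: (@continuous_field_affine _ `[0, 1]); last exact: cV1 (k1i t tth).
    by move=> s; rewrite /= !in_itv; exact: k1i.
  move=> tth; have tI : `[th, 1]%classic t by rewrite /= in_itv.
  suff H : continuous_field `[th, 1] gamma V t by exact: H.
  apply: (continuous_field_eq (V := V2 \o k2) tI).
    by move=> s; rewrite /= in_itv; exact: VE2.
  rewrite -[X in continuous_field _ X]g2.
  apply: (@continuous_field_affine _ `[0, 1]); last exact: cV2 (k2i t tth).
  by move=> s; rewrite /= !in_itv; exact: k2i.
have [_ [E CE]] := rg.
(* The junction time is exceptional, since only continuity is known there; the exceptional times of
   the two pieces are carried over by their affine maps. *)
exists (th :: E ++ [seq h1 s | s <- E1] ++ [seq h2 s | s <- E2]) => t /andP[t0 t1].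
rewrite in_cons !mem_cat !negb_or => /and4P[tth tE tE1 tE2].
have Cg : C1_curve_at gamma t by apply: CE; rewrite // t0 t1.
have [tlt|tgt|teq] := ltgtP t th; last by rewrite teq eqxx in tth.
  have nV : {near t, V1 \o k1 =1 V}.
    have := near_itvoo (x := 0) (y := th) (t := t); rewrite t0 tlt => /(_ isT).
    by apply: filterS => s /andP[s0 st]; apply: VE1; rewrite !ltW.
  apply: parallel_at_near nV _; first by near=> s.
  rewrite -[X in parallel_at _ X]g1; apply: parallel_at_affine.
    by apply: C1_curve_affine; rewrite -/(h1 (k1 t)) /h1 /k1 affineVK.
  apply: pV1; first by rewrite -/(k1 t) k1E divr_gt0//= ltr_pdivrMr// mul1r.
  by apply: contra tE1 => kE; apply/mapP; exists (k1 t); rewrite // /h1 /k1 affineVK.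
have nV : {near t, V2 \o k2 =1 V}.
  have := near_itvoo (x := th) (y := 1) (t := t); rewrite t1 tgt => /(_ isT).
  by apply: filterS => s /andP[s0 st]; apply: VE2; rewrite !ltW.
apply: parallel_at_near nV _; first by near=> s.
rewrite -[X in parallel_at _ X]g2; apply: parallel_at_affine.
  by apply: C1_curve_affine; rewrite -/(h2 (k2 t)) /h2 /k2 affineVK.
apply: pV2.
  by rewrite -/(k2 t) k2E divr_gt0 ?subr_gt0//= ltr_pdivrMr// mul1r ltrD2r.
by apply: contra tE2 => kE; apply/mapP; exists (k2 t); rewrite // /h2 /k2 affineVK.
Unshelve. all: by end_near. Qed.

Lemma parallelD g gamma V W k : parallel g gamma V -> parallel g gamma W ->
  parallel g gamma (fun s => V s + k *: W s).
Proof.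
move=> /parallelP[cV [E pV]] /parallelP[cW [F pW]]; apply/parallelP.
have vE a s : vector_in a (gamma s) (V s + k *: W s) =
    vector_in a (gamma s) (V s) + k *: vector_in a (gamma s) (W s).
  by rewrite /vector_in mulmxDl scalemxAl.
split.
  move=> t t01 a ac; rewrite vE; under eq_fun do rewrite vE.
  by apply: cvgD; [exact: cV|apply: cvgZr; exact: cW].
exists (E ++ F) => t t01; rewrite mem_cat negb_or => /andP[tE tF] a ac.
under eq_fun do rewrite vE.
apply: (is_derive_eq (is_deriveD (pV t t01 tE a ac) (is_deriveZ k (pW t t01 tF a ac)))).
by rewrite vE mulmxDl -scalemxAl opprD scalerN.
Qed.

Lemma path_near_dom A gamma t a : gamma @ within A (nbhs t) --> gamma t ->
  dom X a (gamma t) -> nbhs t [set s | A s -> dom X a (gamma s)].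
Proof.
move=> cg ac; exact: (cg (dom X a) (open_nbhs_sub (dom_open a) ac)).
Qed.

Lemma within_cvg_near (T : topologicalType) (f f' : R -> T) A t (l : T) :
  nbhs t [set s | A s -> f s = f' s] ->
  f @ within A (nbhs t) --> l -> f' @ within A (nbhs t) --> l.
Proof.
move=> ff fl P nP; have nf : nbhs t [set s | A s -> P (f s)] := fl P nP.
by apply: filterS2 ff nf => s E Ps As; rewrite /= -(E As); exact: Ps.
Qed.

(** A constant matrix commuting with chart changes and with the connection maps solutions to
    solutions; for [Jstd] this yields complex linearity of transport. *)
Lemma parallelM g gamma V (J : 'M[R]_m) : regular_path gamma ->
  (forall a b x, dom X a x -> dom X b x -> J *m chart_change a b x = chart_change a b x *m J) ->
  (forall a y u, chart_image a y ->
     connection_mx (bilinear_in g a) y u *m J = J *m connection_mx (bilinear_in g a) y u) ->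
  parallel g gamma V -> parallel g gamma (fun s => V s *m J).
Proof.
move=> [cg [F CF]] JB JC /parallelP[cV [E pV]]; apply/parallelP.
have vE a s : dom X a (gamma s) ->
    vector_in a (gamma s) (V s) *m J = vector_in a (gamma s) (V s *m J).
  by move=> ac; rewrite /vector_in -!mulmxA (JB _ _ _ (dom_chart_at _) ac).
split.
  move=> t t01 a ac; rewrite -(vE a t ac).
  apply: within_cvg_near (cvg_mulmx (cV t t01 a ac) (cvg_cst J)).
  apply: filterS (path_near_dom (cg t t01) ac) => s As /As.
  exact: vE.
exists (E ++ F) => t t01; rewrite mem_cat negb_or => /andP[tE tF] a ac.
have Cg := CF t t01 tF.
have nE : \forall s \near t, vector_in a (gamma s) (V s) *m J = vector_in a (gamma s) (V s *m J).
  by apply: filterS (curve_near_dom Cg.1 ac) => s; exact: vE.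
have dVJ := is_derive_mulmx (pV t t01 tE a ac) (is_derive_cst J t 1).
apply: (is_derive_eq (near_eq_is_derive nE dVJ)).
by rewrite mulmx0 addr0 -(vE a t ac) mulNmx -!mulmxA (JC _ _ _ (coord_image ac)).
Qed.

End Gluing.

(** * Isometry, uniqueness, reversal and gluing of transport *)

Section Transport.
Context {R : realType} {m : nat} {X : manifold R m}.
Implicit Types (gamma : R -> X) (V W : R -> 'rV[R]_m) (t s : R) (v w : 'rV[R]_m).
Variable g : X -> 'M[R]_m.
Hypothesis riem : riemannian g.

Lemma parallel_bform gamma V W : regular_path gamma ->
  parallel g gamma V -> parallel g gamma W ->
  bform (g (gamma 1)) (V 1) (W 1) = bform (g (gamma 0)) (V 0) (W 0).
Proof.
move=> [cg [E CE]] /parallelP[cV [E1 pV]] /parallelP[cW [E2 pW]].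
apply: (@eq_of_derive0 _ (fun s => bform (g (gamma s)) (V s) (W s)) (E ++ E1 ++ E2)) => //.
  move=> t t01; refine (bform_continuous riem (cg t t01) (cV t t01) (cW t t01)).
move=> t t01; rewrite !mem_cat !negb_or => /and3P[tE tE1 tE2].
exact (bform_parallel riem (CE t t01 tE) (pV t t01 tE1) (pW t t01 tE2)).
Qed.

Lemma transport_isometry gamma v w v' w' : regular_path gamma ->
  transport g gamma v v' -> transport g gamma w w' ->
  bform (g (gamma 1)) v' w' = bform (g (gamma 0)) v w.
Proof.
by move=> rg [V [pV <- <-]] [W [pW <- <-]]; exact: parallel_bform.
Qed.

Lemma transportD gamma v w v' w' k : transport g gamma v v' -> transport g gamma w w' ->
  transport g gamma (v + k *: w) (v' + k *: w').
Proof.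
move=> [V [pV <- <-]] [W [pW <- <-]].
by exists (fun s => V s + k *: W s); split=> //; exact: parallelD.
Qed.

(** The difference of two solutions with the same initial vector is parallel and starts at 0, so by
    isometry its final vector has length 0; positivity of the metric concludes. *)
Lemma transport_uniq gamma v w w' : regular_path gamma ->
  transport g gamma v w -> transport g gamma v w' -> w = w'.
Proof.
move=> rg vw vw'; have [_ gp _] := riem.
have T := transportD (- 1) vw vw'.
have := transport_isometry rg T T; rewrite !scaleN1r subrr.
have -> : bform (g (gamma 0)) 0 0 = 0 by rewrite /bform !mul0mx mxE.
move=> g0; apply/eqP; rewrite -subr_eq0; apply: contraT => ww.
by have := gp (gamma 1) _ ww; rewrite -/(bform _ _ _) g0 ltxx.
Qed.

Lemma transport_reverse gamma v w : regular_path gamma ->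
  transport g gamma v w -> transport g (gamma \o affine 1 (- 1)) w v.
Proof.
move=> rg [V [pV <- <-]]; exists (V \o affine 1 (- 1)).
have [a0 a1] : affine 1 (- 1) (0 : R) = 1 /\ affine 1 (- 1) (1 : R) = 0.
  by rewrite /affine mulr0 mulr1 addr0 subrr.
split; rewrite /= ?a0 ?a1//.
by apply: parallel_affine => //; rewrite ?oppr_eq0 ?oner_eq0 ?subrr ?ler01 ?lexx.
Qed.

Lemma transport_glue gamma th u v w : regular_path gamma -> 0 < th < 1 ->
  transport g (gamma \o affine 0 th) u v ->
  transport g (gamma \o affine th (1 - th)) v w -> transport g gamma u w.
Proof.
move=> rg th01 [V1 [pV1 <- <-]] [V2 [pV2 V12 <-]].
have [V [pV V0 V1E]] := parallel_glue rg th01 pV1 pV2 (esym V12).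
by exists V; rewrite V0 V1E.
Qed.

Lemma transport_eq_path gamma gamma' v w :
  (forall t, 0 <= t <= 1 -> gamma t = gamma' t) ->
  transport g gamma v w -> transport g gamma' v w.
Proof. by move=> gg [V [pV V0 V1]]; exists V; split=> //; exact: parallel_eq_path pV. Qed.

End Transport.

(** * Smoothness of matrix inverses and Christoffel symbols *)

Section SmoothMatrices.
Context {R : realType} {m : nat} (U : set 'rV[R]_m).
Hypothesis oU : open U.

Lemma smooth_mx_cst r s (A : 'M[R]_(r, s)) : smooth_mx_on U (fun=> A).
Proof. by move=> i j k; exact: Ck_cst. Qed.

Lemma smooth_mx_mul r s p (F : 'rV[R]_m -> 'M[R]_(r, s)) (G : 'rV[R]_m -> 'M[R]_(s, p)) :
  smooth_mx_on U F -> smooth_mx_on U G -> smooth_mx_on U (fun x => F x *m G x).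
Proof.
move=> sF sG i j k; apply: (@Ck_eq _ _ _ _ (fun x => \sum_l F x i l * G x l j)) => //.
  by move=> x _; rewrite mxE.
by apply: Ck_sum => // l; apply: Ck_mul => //; [exact: sF|exact: sG].
Qed.

Lemma smooth_det r (F : 'rV[R]_m -> 'M[R]_r) :
  smooth_mx_on U F -> smooth_on U (fun x => \det (F x)).
Proof.
move=> sF k; apply: Ck_sum => // s; apply: Ck_mul => //; first exact: Ck_cst.
by apply: Ck_prod => // i; exact: sF.
Qed.

(** By Cramer's formula the entries of the inverse are cofactors divided by the determinant. *)
Lemma smooth_invmx r (F : 'rV[R]_m -> 'M[R]_r) :
  smooth_mx_on U F -> (forall x, U x -> F x \in unitmx) ->
  smooth_mx_on U (fun x => invmx (F x)).
Proof.
move=> sF uF i j k.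
apply: (@Ck_eq _ _ _ _ (fun x => (\det (F x))^-1 * ((-1) ^+ (j + i) *
    \det (row' j (col' i (F x)))))) => //.
  by move=> x Ux; rewrite /invmx uF// !mxE.
apply: Ck_mul => //.
  apply: Ck_inv => //; last exact: smooth_det.
  by move=> x /uF; rewrite unitmxE unitfE.
apply: Ck_mul => //; first exact: Ck_cst.
apply: smooth_det => i' j' k'.
by apply: Ck_eq (sF (lift j i') (lift i j') k') => // x _; rewrite !mxE.
Qed.

Lemma smooth_partial i (f : 'rV[R]_m -> R) : smooth_on U f -> smooth_on U (partial i f).
Proof. by move=> sf k; have [_] := sf k.+1; exact. Qed.

Lemma smooth_christoffel (G : 'rV[R]_m -> 'M[R]_m) k i j :
  smooth_mx_on U G -> (forall x, U x -> G x \in unitmx) ->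
  smooth_on U (fun x => christoffel G x k i j).
Proof.
move=> sG uG d; apply: Ck_mul => //; first exact: Ck_cst.
apply: Ck_sum => // l; apply: Ck_mul => //; first exact: smooth_invmx.
apply: Ck_add => //; last by apply: Ck_opp => //; exact: smooth_partial.
by apply: Ck_add => //; exact: smooth_partial.
Qed.

End SmoothMatrices.

(** * Parallel fields along curves with small connection *)

Section ConnectionAlongCurve.
Context {R : realType} {m : nat} {X : manifold R m}.
Implicit Types (c gamma : R -> X) (V W : R -> 'rV[R]_m) (t s : R) (v w : 'rV[R]_m).
Variable g : X -> 'M[R]_m.
Hypothesis riem : riemannian g.

Definition curve_connection (a : chart X) c t : 'M[R]_m :=
  connection_mx (bilinear_in g a) (coord X a (c t)) (derive1 (coord X a \o c) t).

Lemma curve_coord_continuous c t a : {for t, continuous c} -> dom X a (c t) ->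
  {for t, continuous (coord X a \o c)}.
Proof. by move=> cc ac; apply: continuous_comp cc _; exact: coord_continuous_at. Qed.

Lemma curve_connection_continuous a c t : C1_curve_at c t -> dom X a (c t) ->
  {for t, continuous (curve_connection a c)}.
Proof.
move=> Cc ac; have [_ _ sg] := riem; have [_ dcc] := Cc.2 a ac.
apply/cvg_mxP => i j; rewrite mxE; under eq_fun do rewrite mxE.
apply: cvg_bigsum => k; apply: cvgM.
  have cC : {for coord X a (c t), continuous (fun y => christoffel (bilinear_in g a) y j k i)}.
    apply: (smooth_christoffel (open_chart_image a) j k i (sg a) _ 0).
      by move=> y; exact: metric_unit.
    by rewrite inE; exact: coord_image.
  exact: (continuous_comp (curve_coord_continuous Cc.1 ac) cC).
exact: (cvg_mxP _ _).1 dcc 0 k.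
Qed.

(** The equation is solved in the single chart [a], which contains the whole curve, and the solution
    is then rewritten in the preferred charts. [clamp] extends the coefficients, controlled on the
    unit interval only, to the line. *)
Lemma small_parallel (a : chart X) c (B : R) v :
  (forall t, 0 <= t <= 1 -> [/\ C1_curve_at c t, dom X a (c t) &
     forall i j, `|curve_connection a c t i j| <= B]) ->
  m%:R * B <= 2^-1 ->
  exists V, [/\ V 0 = v, forall t, 0 <= t <= 1 -> continuous_field `[0, 1] c V t &
     forall t, 0 < t < 1 -> parallel_at g c V t].
Proof.
move=> Cc mB; pose K t := - curve_connection a c (clamp t).
have cK i j : continuous (fun t => K t i j).
  move=> t; have [Ct at_ _] := Cc _ (clamp_itv t).
  have cc := continuous_comp (@continuous_clamp _ t) (curve_connection_continuous Ct at_).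
  have cc' : K @ t --> K t by exact: cvgN.
  exact: (cvg_mxP _ _).1 cc' i j.
have Kb t i j : `|K t i j| <= B.
  by rewrite /K mxE normrN; have [_ _] := Cc _ (clamp_itv t); exact.
have [S [S0 dS]] := linear_ODE_small (vector_in a (c 0) v) cK Kb mB.
have [V VD] : exists V, forall t, V t = S t *m chart_change a (chart_at X (c t)) (c t).
  exists (fun t => S t *m chart_change a (chart_at X (c t)) (c t)); exact (fun t => erefl _).
have VE t : dom X a (c t) -> vector_in a (c t) (V t) = S t by move=> at_; rewrite VD; exact: vector_inK.
have i0 : 0 <= (0 : R) <= 1 by rewrite lexx ler01.
exists V; split.
- have [_ a0 _] := Cc 0 i0; rewrite VD S0 /vector_in -mulmxA.
  by rewrite (chart_changeK (dom_chart_at _) a0) mulmx1.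
- move=> t t01 b bt; have [Ct at_ _] := Cc t t01.
  have cS : S @ t --> S t.
    by have [dSt _] := dS t t01; exact/differentiable_continuous/derivable1_diffP.
  have cJ : (fun s => chart_change a b (c s)) @ t --> chart_change a b (c t).
    have cJ0 := smooth_mx_differentiable (smooth_jacobian (open_overlap a b)
      (transition_smooth a b)) (overlap_coord at_ bt).
    exact: continuous_comp (curve_coord_continuous Ct.1 at_) (differentiable_continuous cJ0).
  apply: cvg_within_filter; rewrite (vector_in_change (V t) at_ bt) (VE t at_).
  apply: cvg_trans (cvg_mulmx cS cJ); apply: near_eq_cvg.
  apply: filterS2 (curve_near_dom Ct.1 at_) (curve_near_dom Ct.1 bt) => s as_ bs.
  rewrite -(VE s as_); exact (esym (vector_in_change (V s) as_ bs)).
- move=> t t01; have t01' : 0 <= t <= 1 by case/andP: t01 => *; rewrite !ltW.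
  have [Ct at_ _] := Cc t t01'; apply: (parallel_at_chart riem Ct at_).
  have nS : \forall s \near t, S s = vector_in a (c s) (V s).
    by apply: filterS (curve_near_dom Ct.1 at_) => s as_; rewrite (VE s as_).
  apply: (is_derive_eq (near_eq_is_derive nS (dS t t01'))).
  by rewrite (VE t at_) /K (clampE t01') mulmxN.
Qed.

End ConnectionAlongCurve.

(** * Piecewise C^1 paths *)

Section PiecewiseC1.
Context {R : realType} {m : nat} {X : manifold R m}.
Implicit Types (c gamma : R -> X) (t s : R) (v w : 'rV[R]_m) (tau : nat -> R).

Lemma subdivision_find tau N t : (0 < N)%N -> tau 0%N <= t <= tau N ->
  exists2 i, (i < N)%N & tau i <= t <= tau i.+1.
Proof.
elim: N => // N IH _ /andP[t0 tN].
have [tlt|tge] := leP t (tau N).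
  case: N => [|N] in IH tN tlt *.
    by exists 0%N => //; rewrite t0.
  by have [|i iN ti] := IH isT; [rewrite t0|exists i => //; exact: ltnW].
by exists N => //; rewrite tN ltW.
Qed.

Lemma subdivision_le tau N i j : (forall k, (k < N)%N -> tau k < tau k.+1) ->
  (i <= j)%N -> (j <= N)%N -> tau i <= tau j.
Proof.
move=> tauS; elim: j => [|j IH]; first by rewrite leqn0 => /eqP ->.
rewrite leq_eqVlt => /orP[/eqP -> //|ij jN].
by apply: le_trans (IH ij (ltnW jN)) (ltW (tauS j jN)).
Qed.

Lemma pwC1_regular gamma x y : pwC1_path gamma x y -> regular_path gamma.
Proof.
move=> [_ _ [N [tau [tau0 tauN pieces]]]].
have tauS k : (k < N)%N -> tau k < tau k.+1 by case/pieces.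
have N0 : (0 < N)%N by case: N tauN {pieces tauS} => // E; move: tau0; rewrite E => /eqP; rewrite oner_eq0.
split.
  move=> t; rewrite -tau0 -tauN => t01.
  suff H k : (k <= N)%N -> tau 0%N <= t <= tau k ->
    gamma @ within `[tau 0%N, tau k] (nbhs t) --> gamma t by exact: H.
  elim: k => [_ /andP[t0 t0']|k IH kN tk].
    have tE : t = tau 0%N by apply/le_anti; rewrite t0 t0'.
    move=> P nP; change (nbhs t [set s | `[tau 0%N, tau 0%N]%classic s -> P (gamma s)]).
    apply: (@filterE _ (nbhs t)) => s; rewrite /= in_itv /= => /le_anti sE.
    by rewrite -sE -tE; exact: nbhs_singleton nP.
  apply: (within_cvg_segment (y := tau k)).
  - by apply: subdivision_le tauS _ (ltnW kN).
  - exact/ltW/tauS.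
  - exact: IH (ltnW kN).
  - move=> tk'; have [_ [c cP]] := pieces k kN.
    have [Cc ct] := cP t tk'.
    apply: (@within_cvg_eq _ _ c).
      by move=> s; rewrite /= in_itv /= => /cP[_].
    by rewrite -ct; apply: cvg_within_filter; exact: Cc.1.
(* Away from the subdivision points the path coincides near each time with one of the C^1 curves of
   its definition. *)
exists [seq tau i | i <- iota 0 N.+1] => t /andP[t0 t1] tE.
have [|i iN /andP[it ti]] := @subdivision_find tau N t N0; first by rewrite tau0 tauN !ltW.
have it' : tau i < t.
  rewrite lt_neqAle it andbT; apply: contra tE => /eqP <-.
  by apply: map_f; rewrite mem_iota /= ltnS ltnW.
have ti' : t < tau i.+1.
  rewrite lt_neqAle ti andbT; apply: contra tE => /eqP ->.
  by apply: map_f; rewrite mem_iota.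
have [_ [c cP]] := pieces i iN.
have [Cc _] := cP t ltac:(by rewrite it ti).
apply: C1_curve_near Cc.
have := near_itvoo (x := tau i) (y := tau i.+1) (t := t).
rewrite it' ti' => /(_ isT); apply: filterS => s /andP[s1 s2].
by have [] := cP s ltac:(by rewrite !ltW).
Qed.

Lemma pwC1_affine1 gamma x y : pwC1_path gamma x y -> pwC1_path (gamma \o affine 1 (- 1)) y x.
Proof.
move=> [g0 g1 [N [tau [tau0 tauN pieces]]]]; split.
- by rewrite /= /affine mulr0 addr0.
- by rewrite /= /affine mulr1 subrr.
exists N, (fun i => 1 - tau (N - i)%N); split.
- by rewrite subn0 tauN subrr.
- by rewrite subnn tau0 subr0.
move=> i iN; have iN' : (N - i.+1 < N)%N by lia.
have E : (N - i = (N - i.+1).+1)%N by lia.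
have [lt [c cP]] := pieces _ iN'; split; first by rewrite E; lra.
exists (c \o affine 1 (- 1)) => t; rewrite E => /andP[t1 t2].
have [Cc ct] : C1_curve_at c (affine 1 (- 1) t) /\ c (affine 1 (- 1) t) = gamma (affine 1 (- 1) t).
  by apply: cP; rewrite /affine; apply/andP; split; lra.
by split; [exact: C1_curve_affine|exact: ct].
Qed.

Definition path_concat gamma gamma' t : X :=
  if t <= 2^-1 then gamma (affine 0 2 t) else gamma' (affine (- 1) 2 t).

Lemma path_concatE2 gamma gamma' t : gamma 1 = gamma' 0 -> 2^-1 <= t ->
  path_concat gamma gamma' t = gamma' (affine (- 1) 2 t).
Proof.
move=> g t2; rewrite /path_concat; case: leP => // t2'.
have -> : t = 2^-1 by apply/le_anti/andP.
have -> : affine 0 2 (2^-1 : R) = 1 by rewrite /affine; field.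
by have -> : affine (- 1) 2 (2^-1 : R) = 0 by rewrite /affine; field.
Qed.

Lemma pwC1_concat gamma gamma' x y z :
  pwC1_path gamma x y -> pwC1_path gamma' y z -> pwC1_path (path_concat gamma gamma') x z.
Proof.
move=> [g0 g1 [N [tau [tau0 tauN pieces]]]] [g0' g1' [N' [tau' [tau0' tauN' pieces']]]].
have gg : gamma 1 = gamma' 0 by rewrite g1 g0'.
split.
- by rewrite /path_concat invr_ge0 ler0n /affine mulr0 addr0.
- rewrite path_concatE2// ?invf_le1 ?ler1n//.
  by have -> : affine (- 1) 2 (1 : R) = 1 by rewrite /affine; ring.
(* At [i = N] both formulas give 1/2, so the common subdivision point is counted once. *)
exists (N + N')%N, (fun i => if (i <= N)%N then tau i / 2 else (1 + tau' (i - N)%N) / 2).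
split.
- by rewrite leq0n tau0 mul0r.
- case: ifP => [NN|_]; last by rewrite addKn tauN'; field.
  have E : N' = 0%N by lia.
  by move: tauN'; rewrite E tau0' => /eqP; rewrite eq_sym oner_eq0.
move=> i iN; have [iltN|iltN] := ltnP i N.
  rewrite (ltnW iltN); have [lt [c cP]] := pieces i iltN; split; first by lra.
  exists (c \o affine 0 2) => t /andP[t1 t2].
  have tauS k : (k < N)%N -> tau k < tau k.+1 by case/pieces.
  have := subdivision_le tauS iltN (leqnn N); rewrite tauN => tle.
  have [Cc ct] : C1_curve_at c (affine 0 2 t) /\ c (affine 0 2 t) = gamma (affine 0 2 t).
    by apply: cP; rewrite /affine; apply/andP; split; lra.
  split; first exact: C1_curve_affine.
  have t12 : t <= 2^-1 by lra.
  by rewrite /path_concat t12.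
have iN' : (i - N < N')%N by lia.
have E1 : (if (i <= N)%N then tau i / 2 else (1 + tau' (i - N)%N) / 2) = (1 + tau' (i - N)%N) / 2.
  case: ifP => // iN2; have -> : i = N by lia.
  by rewrite subnn tau0' tauN addr0.
have E2 : (i.+1 - N = (i - N).+1)%N by lia.
have [lt [c cP]] := pieces' _ iN'; rewrite E1 E2.
split; first by lra.
exists (c \o affine (- 1) 2) => t /andP[t1 t2].
have tauS k : (k < N')%N -> tau' k < tau' k.+1 by case/pieces'.
have := subdivision_le tauS (leq0n _) (ltnW iN'); rewrite tau0' => tle.
have [Cc ct] : C1_curve_at c (affine (- 1) 2 t) /\ c (affine (- 1) 2 t) = gamma' (affine (- 1) 2 t).
  by apply: cP; rewrite /affine; apply/andP; split; lra.
split; first exact: C1_curve_affine.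
by rewrite path_concatE2//; lra.
Qed.

End PiecewiseC1.

(** * Existence of parallel transport *)

Section TransportExistence.
Context {R : realType} {m : nat} {X : manifold R m}.
Implicit Types (c gamma : R -> X) (t s : R) (v w : 'rV[R]_m) (tau : nat -> R).
Variable g : X -> 'M[R]_m.
Hypothesis riem : riemannian g.

(** Stated as a relation between two times, for all initial vectors at once, so that it is
    transitive and [interval_induction] applies. *)
Definition transportable gamma (x y : R) : Prop :=
  forall v, exists w, transport g (gamma \o affine x (y - x)) v w.

Lemma transportable_trans gamma x y z : regular_path gamma ->
  0 <= x -> x < y -> y < z -> z <= 1 ->
  transportable gamma x y -> transportable gamma y z -> transportable gamma x z.
Proof.
move=> rg x0 xy yz z1 Txy Tyz v; have [u vu] := Txy v; have [w uw] := Tyz u.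
have zx : 0 < z - x by rewrite subr_gt0 (lt_trans xy).
have zxN0 : z - x != 0 by rewrite gt_eqF.
pose th := (y - x) / (z - x).
have th01 : 0 < th < 1.
  apply/andP; split; first by apply: divr_gt0 zx; rewrite subr_gt0.
  by rewrite /th ltr_pdivrMr ?mul1r ?ltrD2r.
exists w; apply: (transport_glue (th := th) (v := u) _ th01).
- apply: regular_affine => //; first by rewrite x0 ltW// (lt_le_trans _ z1)// (lt_trans xy).
  by rewrite addrC subrK z1 andbT ltW// (le_lt_trans x0)// (lt_trans xy).
- rewrite affine_comp; have -> : x + (z - x) * 0 = x by ring.
  by have -> : (z - x) * th = y - x by rewrite /th; field.
- rewrite affine_comp; have -> : x + (z - x) * th = y by rewrite /th; field.
  by have -> : (z - x) * (1 - th) = z - y by rewrite /th; field.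
Qed.

Lemma curve_connection_affine a c al be t : C1_curve_at c (affine al be t) ->
  dom X a (c (affine al be t)) ->
  curve_connection g a (c \o affine al be) t = be *: curve_connection g a c (affine al be t).
Proof.
move=> Cc ac; have [dc _] := C1_curve_derivable Cc ac.
have [_ uE] := derive1_affine dc.
rewrite /curve_connection -connection_mxZ; congr connection_mx.
by rewrite derive1E -[RHS]uE.
Qed.

Lemma norm_le_succ (A B : 'M[R]_m) : `|A - B| < 1 -> `|B| <= `|A| + 1.
Proof.
by move=> AB; rewrite -lerBlDl (le_trans (lerB_dist _ _))// distrC ltW.
Qed.

(** Rescaling a subinterval to unit time multiplies the connection by the length of the subinterval;
    close to [t] the connection is bounded, so short subintervals satisfy the smallness condition of
    [small_parallel]. *)
Lemma transportable_near c gamma x y t : x <= t <= y ->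
  (forall s, x <= s <= y -> C1_curve_at c s /\ c s = gamma s) ->
  exists2 e : R, 0 < e & forall u z, x <= u -> u < z -> z <= y -> t - e < u -> z < t + e ->
    transportable gamma u z.
Proof.
move=> txy cP; have [Ct _] := cP t txy.
pose a := chart_at X (c t); have at_ : dom X a (c t) by exact: dom_chart_at.
have cK := curve_connection_continuous riem Ct at_.
pose B := `|curve_connection g a c t| + 1.
have B0 : 0 < B by rewrite ltr_wpDl.
have nK : \forall s \near t, `|curve_connection g a c s| <= B.
  have /cvgrPdist_lt /(_ 1 ltr01) := cK; apply: filterS => s.
  exact: norm_le_succ.
have /nbhs_ballP[d /= d0 dP] : \forall s \near t, dom X a (c s) /\ `|curve_connection g a c s| <= B.
  exact: filterI (curve_near_dom Ct.1 at_) nK.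
(* The length is below [2 / M], which bounds its product with [m%:R * B] by 1/2; the summand 1 keeps
   [M] positive. *)
pose M := 4 * (m%:R * B + 1).
have M0 : 0 < M by rewrite mulr_gt0// ltr_wpDl// mulr_ge0// ltW.
exists (Num.min d M^-1); first by rewrite lt_min d0 invr_gt0.
move=> u z xu uz zy; rewrite !(ltrBlDr, lt_min) => tu zt v.
have ed : Num.min d M^-1 <= d by rewrite ge_min lexx.
have eM : Num.min d M^-1 <= M^-1 by rewrite ge_min lexx orbT.
set e := Num.min d M^-1 in tu zt ed eM.
have zu0 : 0 < z - u by rewrite subr_gt0.
pose s_ s := affine u (z - u) s.
have si s : 0 <= s <= 1 -> u <= s_ s <= z.
  move=> /andP[s0 s1]; have h1 : 0 <= (z - u) * s by rewrite mulr_ge0// subr_ge0 ltW.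
  have h2 : 0 <= (z - u) * (1 - s) by rewrite mulr_ge0 ?subr_ge0// ltW.
  by rewrite /s_ /affine; apply/andP; split; lra.
have sxy s : 0 <= s <= 1 -> x <= s_ s <= y.
  by move=> /si/andP[us sz]; rewrite (le_trans xu us) (le_trans sz zy).
have sd s : 0 <= s <= 1 -> dom X a (c (s_ s)) /\ `|curve_connection g a c (s_ s)| <= B.
  move=> /si/andP[us sz]; apply: dP; rewrite /ball /= ltr_norml; apply/andP; split; lra.
have [||V [V0 cV pV]] := @small_parallel _ _ _ g riem a (c \o affine u (z - u)) ((z - u) * B) v.
- move=> s s01; have [ds Bs] := sd s s01; have [Cs _] := cP _ (sxy s s01).
  split; [exact: C1_curve_affine|exact: ds|move=> i j].
  rewrite (curve_connection_affine Cs ds) mxE normrM (gtr0_norm zu0).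
  exact: ler_wpM2l (ltW zu0) _ _ (le_trans (norm_mx_coord _ _ _) Bs).
- have zu : z - u <= 2 * M^-1 by lra.
  have MK : M^-1 * (m%:R * B) <= 4^-1.
    rewrite mulrC ler_pdivrMr// /M mulrA mulVf ?mul1r ?lerDl//.
  have : (z - u) * (m%:R * B) <= 2 * M^-1 * (m%:R * B).
    by rewrite ler_wpM2r// mulr_ge0// ltW.
  by rewrite -[2 * _ * _]mulrA mulrCA => h; lra.
exists (V 1); apply: (transport_eq_path (gamma := c \o affine u (z - u))).
  by move=> s s01; have [_ E] := cP _ (sxy s s01); exact: E.
exists V; split=> //; apply/parallelP; split=> //.
by exists [::] => s s01 _; exact: pV.
Qed.

(** Continuous induction inside each C^1 piece, then ordinary induction over the pieces. *)
Lemma transport_exists gamma x y v : pwC1_path gamma x y ->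
  exists w, transport g gamma v w.
Proof.
move=> pg; have rg := pwC1_regular pg.
have [_ _ [N [tau [tau0 tauN pieces]]]] := pg.
have tauS k : (k < N)%N -> tau k < tau k.+1 by case/pieces.
have N0 : (0 < N)%N by case: N tauN {pieces tauS} => // E; move: tau0; rewrite E => /eqP; rewrite oner_eq0.
have ge0 k : (k <= N)%N -> 0 <= tau k by rewrite -tau0; exact: (subdivision_le tauS).
have le1 k : (k <= N)%N -> tau k <= 1 by move=> kN; rewrite -tauN; exact: (subdivision_le tauS kN (leqnn N)).
have piece k : (k < N)%N -> transportable gamma (tau k) (tau k.+1).
  move=> kN; apply: (@interval_induction _ (transportable gamma)); first exact: tauS.
    move=> u z w tu uz zw wt; apply: transportable_trans => //.
      exact: le_trans (ge0 k (ltnW kN)) tu.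
    exact: le_trans wt (le1 k.+1 kN).
  move=> t tk; have [_ [c cP]] := pieces k kN.
  exact: transportable_near tk cP.
have reach k : (0 < k <= N)%N -> transportable gamma (tau 0%N) (tau k).
  elim: k => // k IH /= kN; have [->|k0] := posnP k; first exact: piece.
  apply: (@transportable_trans _ _ (tau k)) => //.
  - by rewrite tau0.
  - have := tauS 0%N N0; move=> /lt_le_trans; apply.
    by apply: subdivision_le tauS k0 (ltnW kN).
  - exact: tauS.
  - exact: le1.
  - by apply: IH; rewrite k0 ltnW.
  - exact: piece.
have [w vw] := reach N ltac:(by rewrite N0 leqnn) v; exists w.
apply: transport_eq_path vw => t _.
by rewrite tau0 tauN /= /affine add0r subr0 mul1r.
Qed.

End TransportExistence.

(** * Complex determinants and Lagrangian frames *)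

Section ComplexMatrices.
Context {R : realType}.
Local Notation C := R[i].
Local Notation J n := (Jstd R n).

Definition complex_mx k l (P Q : 'M[R]_(k, l)) : 'M[C]_(k, l) :=
  \matrix_(i, j) Complex (P i j) (Q i j).

Definition complexify k n (D : 'M[R]_(k, n + n)) : 'M[C]_(k, n) :=
  complex_mx (lsubmx D) (rsubmx D).

Lemma complex_mxE k l (P Q : 'M[R]_(k, l)) :
  complex_mx P Q = map_mx (real_complex R) P + 'i%C *: map_mx (real_complex R) Q.
Proof. by apply/matrixP => i j; rewrite !mxE [LHS]complexE. Qed.

Lemma complex_mxM k l h (P Q : 'M[R]_(k, l)) (P' Q' : 'M[R]_(l, h)) :
  complex_mx P Q *m complex_mx P' Q' = complex_mx (P *m P' - Q *m Q') (P *m Q' + Q *m P').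
Proof.
rewrite !complex_mxE map_mxB map_mxD !map_mxM mulmxDl !mulmxDr.
rewrite -!scalemxAl -!scalemxAr scalerA -expr2 sqr_i scaleN1r scalerDr.
by rewrite !addrA [in LHS]addrAC; congr (_ + _); rewrite addrAC.
Qed.

Lemma complex_mx_real k l (P : 'M[R]_(k, l)) :
  complex_mx P 0 = map_mx (real_complex R) P.
Proof. by rewrite complex_mxE map_mx0 scaler0 addr0. Qed.

Section Commuting.
Variables (n : nat).

Lemma Jstd_sqr : J n *m J n = - 1%:M.
Proof.
rewrite /Jstd mulmx_block !mul0mx !mulmx0 !mulmxN !mulNmx !mulmx1 !add0r !addr0.
by rewrite [in RHS]scalar_mx_block opp_block_mx !oppr0.
Qed.

Lemma Jstd_tr : (J n)^T = - J n.
Proof. by rewrite /Jstd tr_block_mx !trmx0 linearN /= trmx1 opp_block_mx !oppr0 opprK. Qed.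

Definition Jlinear (A : 'M[R]_(n + n)) : Prop := J n *m A = A *m J n.

Lemma JlinearP (A : 'M[R]_(n + n)) : Jlinear A ->
  A = block_mx (ulsubmx A) (ursubmx A) (- ursubmx A) (ulsubmx A).
Proof.
rewrite /Jlinear -{1 2}[A]submxK /Jstd !mulmx_block !mul0mx !mulmx0 !mulmxN !mulNmx.
rewrite !mul1mx !mulmx1 !add0r !addr0 => /eq_block_mx[dl dr _ _].
by rewrite -{1}[A]submxK dl dr.
Qed.

Lemma complexifyM k (D : 'M[R]_(k, n + n)) (A : 'M[R]_(n + n)) : Jlinear A ->
  complexify (D *m A) = complexify D *m complexify (usubmx A).
Proof.
move=> /JlinearP AE; rewrite /complexify complex_mxM.
set P := ulsubmx A in AE; set Q := ursubmx A in AE.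
have -> : lsubmx (usubmx A) = P by [].
have -> : rsubmx (usubmx A) = Q by [].
rewrite -{1 2}[D]hsubmxK AE mul_row_block row_mxKl row_mxKr.
by rewrite mulmxN.
Qed.

Lemma complexifyMl k l (S : 'M[R]_(l, k)) (D : 'M[R]_(k, n + n)) :
  complexify (S *m D) = map_mx (real_complex R) S *m complexify D.
Proof.
rewrite /complexify -complex_mx_real complex_mxM !mul0mx subr0 addr0.
by rewrite -{1 2}[D]hsubmxK mul_mx_row row_mxKl row_mxKr.
Qed.

Lemma detCE (A : 'M[R]_(n + n)) : detC A = \det (complexify (usubmx A)).
Proof. by []. Qed.

Lemma JlinearM (A B : 'M[R]_(n + n)) : Jlinear A -> Jlinear B -> Jlinear (A *m B).
Proof. by rewrite /Jlinear => JA JB; rewrite mulmxA JA -!mulmxA JB. Qed.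

Lemma detC_mul (A B : 'M[R]_(n + n)) : Jlinear B -> detC (A *m B) = detC A * detC B.
Proof.
move=> JB; rewrite !detCE -det_mulmx -complexifyM//; congr (\det (complexify _)).
by rewrite -{1}[A]vsubmxK mul_col_mx col_mxKu.
Qed.

Lemma detC1 : detC (1%:M : 'M[R]_(n + n)) = 1.
Proof.
rewrite -[RHS](det1 _ n); congr (\det _); apply/matrixP => i j.
rewrite !mxE eq_lshift eq_lrshift /=; case: eqP => _ //=.
Qed.

Lemma Jlinear_inv (A : 'M[R]_(n + n)) : A \in unitmx -> Jlinear A -> Jlinear (invmx A).
Proof.
move=> uA JA; rewrite /Jlinear -[LHS](mulKmx uA) [A *m _]mulmxA -JA.
by rewrite -[J n *m A *m _]mulmxA mulmxV// mulmx1.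
Qed.

Lemma detC_inv (A : 'M[R]_(n + n)) : A \in unitmx -> Jlinear A ->
  detC A * detC (invmx A) = 1.
Proof. by move=> uA JA; rewrite -detC_mul ?mulmxV ?detC1//; exact: Jlinear_inv. Qed.

Lemma detC_neq0 (A : 'M[R]_(n + n)) : A \in unitmx -> Jlinear A -> detC A != 0.
Proof.
move=> uA JA; apply: contra_eq_neq (detC_inv uA JA) => ->.
by rewrite mul0r eq_sym oner_eq0.
Qed.

(** For a complex linear map the real transpose corresponds to the conjugate transpose of its
    complex matrix. *)
Lemma detC_tr (A : 'M[R]_(n + n)) : Jlinear A -> detC A^T = ((detC A)^*)%C.
Proof.
move=> JA; rewrite !detCE -det_map_mx -[RHS]det_tr; congr (\det _).
have AE := JlinearP JA.
apply/matrixP => i j; rewrite !mxE /=; congr Complex.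
by rewrite {1}AE block_mxEdl !mxE.
Qed.

Lemma Jlinear_tr (A : 'M[R]_(n + n)) : Jlinear A -> Jlinear A^T.
Proof.
rewrite /Jlinear => /(congr1 trmx); rewrite !trmx_mul Jstd_tr mulmxN mulNmx.
by move/oppr_inj.
Qed.

Lemma detC_isometry (A G G' : 'M[R]_(n + n)) : Jlinear A -> Jlinear G ->
  A *m G *m A^T = G' -> detC A * ((detC A)^*)%C * detC G = detC G'.
Proof.
move=> JA JG <-; rewrite detC_mul; last exact: Jlinear_tr.
by rewrite detC_mul// detC_tr// mulrAC.
Qed.

(** The metric matrix [G] is itself complex linear and invertible, so its complex determinant
    cancels from the two sides. *)
Lemma detC_unitary (A G : 'M[R]_(n + n)) : Jlinear A -> Jlinear G -> G \in unitmx ->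
  A *m G *m A^T = G -> detC A * ((detC A)^*)%C = 1.
Proof.
move=> JA JG uG AG; apply: (mulIf (detC_neq0 uG JG)); rewrite mul1r.
exact: detC_isometry.
Qed.

End Commuting.
End ComplexMatrices.

(** * Positive definite forms and Lagrangian frames *)

Section PositiveDefinite.
Context {R : realType}.

Definition posdef n (S : 'M[R]_n) : Prop :=
  S^T = S /\ forall v : 'rV[R]_n, v != 0 -> 0 < bform S v v.

Lemma posdef_congruent n k (S : 'M[R]_n) (D : 'M[R]_(k, n)) :
  posdef S -> row_free D -> posdef (D *m S *m D^T).
Proof.
move=> [Ss Sp] fD; split; first by rewrite !trmx_mul trmxK Ss mulmxA.
move=> v v0; have -> : bform (D *m S *m D^T) v v = bform S (v *m D) (v *m D).
  by rewrite /bform trmx_mul !mulmxA.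
by apply: Sp; apply: contra_neq v0 => vD; apply: (row_free_inj fD); rewrite vD mul0mx.
Qed.

Lemma posdef_unit n (S : 'M[R]_n) : posdef S -> S \in unitmx.
Proof.
move=> [_ Sp]; rewrite -row_free_unit -kermx_eq0.
apply/eqP/row_matrixP => i; rewrite row0; apply/eqP; apply: contraT => v0.
have := Sp _ v0; have /sub_kermxP := row_sub i (kermx S).
by rewrite /bform => ->; rewrite mul0mx mxE ltxx.
Qed.

(** One step of symmetric Gauss elimination: [T] clears the first row and column beyond the pivot
    [a], the induction treats the remaining block, and [r] scales the pivot to 1. *)
Lemma posdef_to1 n (S : 'M[R]_n) : posdef S ->
  exists2 Q : 'M[R]_n, Q \in unitmx & Q *m S *m Q^T = 1%:M.
Proof.
elim: n S => [|n IH] S Sp.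
  by exists 1%:M; rewrite ?unitmx1//; apply/matrixP => -[].
change 'M[R]_(1 + n) in S; have [Ss Spos] := Sp.
pose a : R := ulsubmx S 0 0; pose b := ursubmx S; pose d := drsubmx S.
have SE : S = block_mx a%:M b b^T d.
  rewrite -[LHS]submxK /b trmx_ursub Ss; congr block_mx.
  by apply/matrixP => i j; rewrite !ord1 [RHS]mxE eqxx.
have a0 : 0 < a.
  pose e : 'rV[R]_(1 + n) := row_mx 1%:M 0.
  have -> : a = bform S e e.
    rewrite /bform SE mul_row_block tr_row_mx mul_row_col trmx0 mulmx0 addr0 mul0mx addr0.
    by rewrite trmx1 mulmx1 mul1mx mxE eqxx mulr1n.
  apply: Spos; apply/eqP => /(congr1 (fun v : 'rV_(1 + n) => lsubmx v 0 0)).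
  by rewrite row_mxKl !mxE => /eqP; rewrite oner_eq0.
have aN0 : a != 0 by rewrite gt_eqF.
pose T : 'M[R]_(1 + n) := block_mx 1%:M 0 (- (a^-1 *: b^T)) 1%:M.
have uT : T \in unitmx by rewrite unitmxE det_lblock !det1 mulr1 unitr1.
(* The Schur complement of the pivot. It is the restriction of the form to the last rows of [T],
   hence positive definite. *)
pose S' := d - a^-1 *: (b^T *m b).
have TST : T *m S *m T^T = block_mx a%:M 0 0 S'.
  rewrite SE /T tr_block_mx !trmx1 trmx0 !mulmx_block.
  rewrite !mul1mx !mul0mx !addr0 !mulmx1 !mulmx0 !addr0.
  have e1 : - (a^-1 *: b^T) *m a%:M + b^T = 0.
    by rewrite mulNmx -scalemxAl mul_mx_scalar scalerA mulVf// scale1r addNr.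
  have e2 : a%:M *m (- (a^-1 *: b^T))^T + b = 0.
    by rewrite linearN linearZ /= trmxK mulmxN -scalemxAr mul_scalar_mx scalerA mulVf// scale1r addNr.
  rewrite e1 e2 mul0mx add0r; congr block_mx.
  by rewrite mulNmx -scalemxAl addrC.
have S'p : posdef S'.
  have -> : S' = row_mx 0 1%:M *m T *m S *m (row_mx 0 1%:M *m T)^T.
    rewrite trmx_mul !mulmxA -[_ *m T *m S]mulmxA -[_ *m (T *m S) *m _]mulmxA TST.
    by rewrite mul_row_block !mul0mx !add0r !mul1mx tr_row_mx mul_row_col mul0mx add0r trmx1 mulmx1.
  apply: (posdef_congruent Sp); apply/row_freeP.
  exists (invmx T *m col_mx 0 1%:M); rewrite !mulmxA mulmxK//.
  by rewrite mul_row_col mul0mx add0r mul1mx.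
have [Q uQ QS] := IH S' S'p.
pose r := (Num.sqrt a)^-1.
have ra : r * a * r = 1.
  rewrite /r -{2}[a]sqr_sqrtr ?ltW// expr2; field.
  by rewrite sqrtr_eq0 -ltNge.
pose P : 'M[R]_(1 + n) := block_mx r%:M 0 0 Q.
have uP : P \in unitmx.
  rewrite unitmxE det_lblock det_scalar1 unitrM -unitmxE uQ andbT unitfE.
  by rewrite invr_eq0 sqrtr_eq0 -ltNge.
exists (P *m T); first by rewrite unitmx_mul uT andbT.
have -> : P *m T *m S *m (P *m T)^T = P *m (T *m S *m T^T) *m P^T.
  by rewrite trmx_mul !mulmxA.
rewrite TST /P tr_block_mx !trmx0 !mulmx_block !mul0mx !mulmx0 !addr0 !add0r QS.
rewrite tr_scalar_mx -!scalar_mxM ra !mul0mx; exact: esym (@scalar_mx_block _ 1 n 1).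
Qed.

Lemma posdef_congruence n (S S' : 'M[R]_n) : posdef S -> posdef S' ->
  exists2 Q : 'M[R]_n, Q \in unitmx & Q *m S *m Q^T = S'.
Proof.
move=> /posdef_to1[Q uQ QS] /posdef_to1[Q' uQ' QS'].
exists (invmx Q' *m Q); first by rewrite unitmx_mul unitmx_inv uQ' uQ.
have -> : invmx Q' *m Q *m S *m (invmx Q' *m Q)^T =
    invmx Q' *m (Q *m S *m Q^T) *m (invmx Q')^T by rewrite trmx_mul !mulmxA.
rewrite QS -QS' !mulmxA mulVmx// mul1mx -mulmxA -trmx_mul.
by rewrite mulVmx// trmx1 mulmx1.
Qed.

End PositiveDefinite.

Section LagrangianFrames.
Context {R : realType} {n : nat}.
Local Notation J := (Jstd R n).
Variable G : 'M[R]_(n + n).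
Hypotheses (Gp : posdef G) (JG : J *m G *m J^T = G).

Definition lagrangian_frame (D : 'M[R]_(n, n + n)) : Prop :=
  row_free D /\ D *m G *m J^T *m D^T = 0.

(** The complex linear endomorphism of C^n sending the standard real basis of R^n to the rows of
    [D]; it allows frames to be treated as square matrices to which [detC] applies. *)
Definition complex_frame (D : 'M[R]_(n, n + n)) : 'M[R]_(n + n) := col_mx D (D *m J).

Lemma JG_commute : Jlinear G.
Proof.
rewrite /Jlinear -[in RHS]JG Jstd_tr mulmxN mulNmx -!mulmxA Jstd_sqr.
by rewrite !mulmxN mulmx1 opprK.
Qed.

(** The off-diagonal blocks are, up to sign, the values of the Kaehler form on the span of [D],
    which vanish; the diagonal blocks agree because [J] is an isometry. *)
Lemma complex_frame_gram D : lagrangian_frame D ->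
  complex_frame D *m G *m (complex_frame D)^T =
  block_mx (D *m G *m D^T) 0 0 (D *m G *m D^T).
Proof.
move=> [_ lD]; rewrite /complex_frame tr_col_mx mul_col_mx mul_col_row trmx_mul.
rewrite !mulmxA lD; congr block_mx.
  have := congr1 trmx lD; rewrite !trmx_mul !trmxK trmx0 (proj1 Gp) => <-.
  by rewrite !mulmxA.
by rewrite -[D *m J *m G *m J^T]mulmxA -[D *m J *m _]mulmxA [J *m _]mulmxA JG.
Qed.

Lemma complex_frame_linear D : Jlinear (complex_frame D).
Proof.
rewrite /Jlinear /complex_frame {1}/Jstd mul_block_col mul_col_mx !mul0mx !mul1mx add0r addr0.
by rewrite mulNmx mul1mx -mulmxA Jstd_sqr mulmxN mulmx1.
Qed.

Lemma complex_frame_unit D : lagrangian_frame D -> complex_frame D \in unitmx.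
Proof.
move=> lD; have uS := posdef_unit (posdef_congruent Gp lD.1).
have : block_mx (D *m G *m D^T) 0 0 (D *m G *m D^T) \in unitmx.
  by rewrite unitmxE det_lblock unitrM -!unitmxE uS.
by rewrite -complex_frame_gram// !unitmx_mul => /andP[/andP[]].
Qed.

Lemma detC_complex_frame D : detC (complex_frame D) = \det (complexify D).
Proof. by rewrite detCE /complex_frame col_mxKu. Qed.

Lemma det_complexify_neq0 D : lagrangian_frame D -> \det (complexify D) != 0.
Proof.
move=> lD; rewrite -detC_complex_frame; apply: detC_neq0 (complex_frame_linear D).
exact: complex_frame_unit.
Qed.

Lemma complex_frameM (A : 'M[R]_(n + n)) D : Jlinear A ->
  complex_frame D *m A = complex_frame (D *m A).
Proof. by move=> JA; rewrite /complex_frame mul_col_mx -!mulmxA JA. Qed.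

(** After [S] has given the two frames the same Gram matrix, their complex frames also have the same
    Gram matrix, so the complex linear map taking one to the other is an isometry. *)
Lemma unitary_between_frames D E : lagrangian_frame D -> lagrangian_frame E ->
  exists A : 'M[R]_(n + n), [/\ Jlinear A, A *m G *m A^T = G &
    exists2 S : 'M[R]_n, S \in unitmx & E = S *m D *m A].
Proof.
move=> lD lE.
have [S uS SD] := posdef_congruence (posdef_congruent Gp lD.1) (posdef_congruent Gp lE.1).
pose D' := S *m D.
have lD' : lagrangian_frame D'.
  have [fD oD] := lD; split.
    by rewrite /row_free /D' mxrankMfree// mxrank_unit.
  have -> : D' *m G *m J^T *m D'^T = S *m (D *m G *m J^T *m D^T) *m S^T.
    by rewrite /D' trmx_mul !mulmxA.
  by rewrite oD mulmx0 mul0mx.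
have gram : D' *m G *m D'^T = E *m G *m E^T by rewrite -SD /D' trmx_mul !mulmxA.
have uD := complex_frame_unit lD'.
pose A := invmx (complex_frame D') *m complex_frame E.
have JA : Jlinear A.
  apply: JlinearM; last exact: complex_frame_linear.
  exact: Jlinear_inv uD (complex_frame_linear _).
exists A; split=> //.
  have -> : A *m G *m A^T = invmx (complex_frame D') *m
      (complex_frame E *m G *m (complex_frame E)^T) *m (invmx (complex_frame D'))^T.
    by rewrite /A trmx_mul !mulmxA.
  rewrite (complex_frame_gram lE) -gram -(complex_frame_gram lD') !mulmxA mulVmx// mul1mx.
  by rewrite -mulmxA -trmx_mul mulVmx// trmx1 mulmx1.
exists S => //; apply/esym; have : complex_frame D' *m A = complex_frame E by rewrite /A mulKVmx.
by rewrite complex_frameM// /complex_frame => /eq_col_mx[].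
Qed.

End LagrangianFrames.

(** * C^1 curves in manifolds and joining of points *)

Section C1Curves.
Context {R : realType}.
Implicit Types (t s : R).

Definition C1_at m (u : R -> 'rV[R]_m) t : Prop :=
  (\forall s \near t, derivable u s 1) /\ {for t, continuous (derive1 u)}.

Lemma C1_at_near m (u u' : R -> 'rV[R]_m) t : {near t, u =1 u'} -> C1_at u t -> C1_at u' t.
Proof.
move=> uu [du cdu].
have nuu : \forall s \near t, {near s, u =1 u'} by exact: near_join uu.
split; first by apply: filterS2 du nuu => s ds es; exact: near_eq_derivable es ds.
have dE : \forall s \near t, derive1 u s = derive1 u' s.
  by apply: filterS nuu => s es; rewrite !derive1E; exact: near_eq_derive.
rewrite /prop_for /continuous_at -(nbhs_singleton dE).
by apply: cvg_trans cdu; exact: near_eq_cvg dE.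
Qed.

Lemma C1_at_continuous m (u : R -> 'rV[R]_m) t : C1_at u t -> {for t, continuous u}.
Proof. by move=> [/nbhs_singleton du _]; exact/differentiable_continuous/derivable1_diffP. Qed.

Lemma C1_at_comp m n (W : set 'rV[R]_m) (F : 'rV[R]_m -> 'rV[R]_n) (u : R -> 'rV[R]_m) t :
  open W -> smooth_mx_on W F -> W (u t) -> C1_at u t -> C1_at (F \o u) t.
Proof.
move=> oW sF Wt Cu; have cu := C1_at_continuous Cu; have [du cdu] := Cu.
have nW : \forall s \near t, W (u s) := cu W (open_nbhs_sub oW Wt).
have dn : \forall s \near t, is_derive (s : R) 1 (F \o u) (derive1 u s *m 'J F (u s)).
  apply: filterS2 du nW => s ds Ws; have dF := smooth_mx_differentiable sF Ws.
  have du' : is_derive s 1 u (derive1 u s) by rewrite derive1E; exact: derivableP.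
  by rewrite -(deriveEjacobian _ dF); exact: is_derive1_comp.
split; first by apply: filterS dn => s [].
have dE : \forall s \near t, derive1 u s *m 'J F (u s) = derive1 (F \o u) s.
  by apply: filterS dn => s [_ E]; rewrite [RHS]derive1E E.
rewrite /prop_for /continuous_at -(nbhs_singleton dE).
apply: cvg_trans (near_eq_cvg dE) _; apply: cvg_mulmx cdu _.
have cJ := differentiable_continuous (smooth_mx_differentiable (smooth_jacobian oW sF) Wt).
exact: continuous_comp cu cJ.
Qed.

Section ManifoldCurves.
Context {m : nat} {L : manifold R m}.

Lemma C1_curve_param (a : chart L) (u : R -> 'rV[R]_m) t :
  chart_image a (u t) -> C1_at u t -> C1_curve_at (param L a \o u) t.
Proof.
move=> at_ Cu; have cu := C1_at_continuous Cu; split.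
  by apply: continuous_comp cu _; exact: param_continuous_at.
move=> b bt; apply: (C1_at_comp (open_overlap a b) (transition_smooth a b)) => //.
exists (param L a (u t)); last exact: paramK.
by split=> //; exact: param_dom.
Qed.

Lemma C1_at_line (y v : 'rV[R]_m) t : C1_at (fun s => y + s *: v) t.
Proof.
have dl s : is_derive s 1 (fun s : R => y + s *: v) v.
  have did : differentiable (@id 'rV[R]_m) (y + s *: v) by [].
  by have := is_derive_line did; rewrite derive_id.
split; first by apply: (@filterE _ (nbhs t)) => s; have [] := dl s.
have -> : derive1 (fun s : R => y + s *: v) = fun=> v.
  by apply/funext => s; rewrite derive1E; have [_ ->] := dl s.
exact: cst_continuous.
Qed.

Lemma pwC1_segment (a : chart L) (y v : 'rV[R]_m) :
  (forall t, 0 <= t <= 1 -> chart_image a (y + t *: v)) ->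
  pwC1_path (param L a \o (fun t => y + t *: v)) (param L a y) (param L a (y + v)).
Proof.
move=> av; split; rewrite /= ?scale0r ?addr0 ?scale1r//.
exists 1%N, (fun i => i%:R); split=> // -[|//] _; split; first by rewrite ltr01.
exists (param L a \o (fun t => y + t *: v)) => t t01; split=> //.
exact: C1_curve_param (av t t01) (C1_at_line y v t).
Qed.

Variables (k : nat) (X : manifold R k) (j : L -> X).
Hypothesis sj : smooth_map j.

Lemma smooth_map_open (a : chart L) (b : chart X) :
  open (coord L a @` (dom L a `&` j @^-1` dom X b)).
Proof.
apply: open_coord_image; have [cj _] := sj.
by apply: open_comp => // *; exact: dom_open.
Qed.

Lemma C1_curve_map (c : R -> L) t : C1_curve_at c t -> C1_curve_at (j \o c) t.
Proof.
move=> [cc Cc]; have [cj smj] := sj; split.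
  by apply: continuous_comp cc _; exact: cj.
move=> b bt; pose a := chart_at L (c t); have at_ : dom L a (c t) by exact: dom_chart_at.
apply: (@C1_at_near _ ((coord X b \o j \o param L a) \o (coord L a \o c))).
  by apply: filterS (curve_near_dom cc at_) => s as_; rewrite /= coordK.
apply: (C1_at_comp (smooth_map_open (a := a) (b := b)) (smj a b)) (Cc a at_).
by exists (c t).
Qed.

Lemma pwC1_map (gamma : R -> L) p q : pwC1_path gamma p q -> pwC1_path (j \o gamma) (j p) (j q).
Proof.
move=> [g0 g1 [N [tau [tau0 tauN pieces]]]]; split; rewrite /= ?g0 ?g1//.
exists N, tau; split=> // i iN; have [lt [c cP]] := pieces i iN; split=> //.
exists (j \o c) => t ti; have [Cc ct] := cP t ti; split; first exact: C1_curve_map.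
by rewrite /= ct.
Qed.

End ManifoldCurves.

(** The set of points reachable from [p] is open and closed: a point close to [x] is joined to [x]
    by a straight segment in a chart, which can be traversed in both directions. *)
Lemma connected_pwC1 m (L : manifold R m) (p q : L) : connected [set: L] ->
  exists gamma : R -> L, pwC1_path gamma p q.
Proof.
move=> cL.
have local (x : L) : \forall z \near x, exists gamma : R -> L, pwC1_path gamma x z.
  pose a := chart_at L x; have ax : dom L a x by exact: dom_chart_at.
  have /nbhs_ballP[e /= e0 eB] := open_nbhs_sub (open_chart_image a) (coord_image ax).
  have cx := coord_continuous_at ax.
  have nB : \forall z \near x, ball (coord L a x) e (coord L a z).
    by apply: cx; exact: nbhsx_ballx.
  apply: filterS2 nB (open_nbhs_sub (dom_open a) ax) => z xz az.
  have P := @pwC1_segment _ L a (coord L a x) (coord L a z - coord L a x).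
  exists (param L a \o (fun t => coord L a x + t *: (coord L a z - coord L a x))).
  rewrite subrKC coordK// coordK// in P; apply: P => t /andP[t0 t1]; apply: eB.
  rewrite -ball_normE /= opprD addNKr normrN normrZ ger0_norm//.
  rewrite -ball_normE /= distrC in xz.
  by apply: le_lt_trans xz; rewrite ler_piMl.
pose reach := [set z | exists gamma : R -> L, pwC1_path gamma p z].
have reach_open : open reach.
  rewrite openE => z [gamma pz]; apply: filterS (local z) => z' [gamma' zz'].
  by exists (path_concat gamma gamma'); exact: pwC1_concat pz zz'.
have reach_closed : open (~` reach).
  rewrite openE => z nz; apply: filterS (local z) => z' [gamma' zz'] [gamma pz'].
  apply: nz; exists (path_concat gamma (gamma' \o affine 1 (- 1))).
  exact: pwC1_concat pz' (pwC1_affine1 zz').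
have reach_p : reach p by have [gamma pp] := nbhs_singleton (local p); exists gamma.
have rT : reach = [set: L].
  apply: cL; first by exists p.
    by exists reach => //; rewrite setTI.
  exists reach; last by rewrite setTI.
  by rewrite -openC.
by have : reach q by rewrite rT.
Qed.

End C1Curves.

(** * Holonomy and the Maslov map *)

Section KaehlerTransport.
Context {R : realType} {n : nat} {X : manifold R (n + n)} {g : X -> 'M[R]_(n + n)}.
Hypothesis hX : calabi_yau g.
Implicit Types (gamma : R -> X) (v w : 'rV[R]_(n + n)).
Local Notation J := (Jstd R n).

Let riem : riemannian g := cy_riemannian hX.

Lemma metric_posdef x : posdef (g x).
Proof. by have [gs gp _] := riem; split; [exact: gs|exact: gp]. Qed.

Lemma metric_Jlinear x : Jlinear (g x).
Proof. exact: JG_commute (cy_hermitian hX x). Qed.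

(** The Hermitian condition and the Kaehler matrix are given in preferred charts; Jacobians of
    holomorphic chart changes commute with [J], so both pass to the chart [a], where
    [connection_commute] applies. *)
Lemma kahler_connection a y u : chart_image a y ->
  connection_mx (bilinear_in g a) y u *m J = J *m connection_mx (bilinear_in g a) y u.
Proof.
move=> ay; have JB z : chart_image a z ->
    J *m chart_change a (chart_at X (param X a z)) (param X a z)
    = chart_change a (chart_at X (param X a z)) (param X a z) *m J.
  by move=> az; apply: (cy_complex hX); [exact: param_dom|exact: dom_chart_at].
have JBT z : chart_image a z ->
    (chart_change a (chart_at X (param X a z)) (param X a z))^T *m J^T
    = J^T *m (chart_change a (chart_at X (param X a z)) (param X a z))^T.
  by move=> /JB/(congr1 trmx); rewrite !trmx_mul.
apply: (connection_commute (W := bilinear_in (kahler_mx g) a) (open_chart_image a) ay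
  (metric_differentiable riem ay) (fun z _ => metric_sym riem a z) (metric_unit riem ay)
  (Jstd_sqr n) (Jstd_tr n)) => [z az|z az|].
- rewrite /bilinear_in; move: (JB z az) (JBT z az).
  move: (chart_change _ _ _) => B JB1 JBT1.
  rewrite -!mulmxA JBT1 !mulmxA JB1 -!mulmxA; congr (_ *m _); rewrite !mulmxA.
  by rewrite (cy_hermitian hX).
- rewrite /bilinear_in /kahler_mx; move: (JBT z az); move: (chart_change _ _ _) => B JBT1.
  by rewrite -!mulmxA JBT1.
- exact: cy_closed hX a y ay.
Qed.

(** An equivalence, so that the matrix both provides transports and determines them. *)
Definition transport_mx gamma (P : 'M[R]_(n + n)) : Prop :=
  forall v w, transport g gamma v w <-> w = v *m P.

Lemma transport_mxP gamma P : regular_path gamma ->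
  (forall v, transport g gamma v (v *m P)) -> transport_mx gamma P.
Proof.
move=> rg TP v w; split=> [vw|->]; last exact: TP.
exact (transport_uniq riem rg vw (TP v)).
Qed.

(** The rows of [P] are transports of the basis vectors. Multiplying a parallel field by [J] gives a
    parallel field, and uniqueness turns this into the commutation of [P] with [J]. *)
Lemma transport_mx_exists gamma x y : pwC1_path gamma x y ->
  exists P, [/\ transport_mx gamma P, Jlinear P & P *m g y *m P^T = g x].
Proof.
move=> pg; have rg := pwC1_regular pg; have [g0 g1 _] := pg.
pose f v := sval (cid (transport_exists riem v pg)).
have fP v : transport g gamma v (f v) := svalP (cid (transport_exists riem v pg)).
pose P : 'M[R]_(n + n) := \matrix_i f (delta_mx 0 i).
have T0 : transport g gamma 0 0.
  by have := transportD (- 1) (fP 0) (fP 0); rewrite !scaleN1r !subrr.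
have TP v : transport g gamma v (v *m P).
  rewrite {1}[v]row_sum_delta mulmx_sum_row.
  elim: (index_enum _) => [|i r IH]; first by rewrite !big_nil.
  rewrite !big_cons addrC [X in transport _ _ _ X]addrC.
  by apply: transportD => //; rewrite rowK.
have PM := transport_mxP rg TP.
exists P; split=> //.
- apply: mulmx_row_inj => v; rewrite !mulmxA.
  apply/esym/PM; have [V [pV V0 V1]] := TP v.
  exists (fun s => V s *m J); rewrite V0 V1; split=> //.
  apply: parallelM => //; first exact: cy_complex hX.
  by move=> a z u; exact: kahler_connection.
- apply: bform_inj => v w; rewrite bform_mul.
  by have := transport_isometry riem rg (TP v) (TP w); rewrite g0 g1.
Qed.

Lemma isometry_unit x y P : P *m g y *m P^T = g x -> P \in unitmx.
Proof.
move=> E; have := posdef_unit (metric_posdef x).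
by rewrite -E !unitmx_mul => /andP[/andP[]].
Qed.

Lemma transport_mx_concat gamma gamma' x y z P P' :
  pwC1_path gamma x y -> pwC1_path gamma' y z ->
  transport_mx gamma P -> transport_mx gamma' P' ->
  transport_mx (path_concat gamma gamma') (P *m P').
Proof.
move=> pg pg' TP TP'; have pc := pwC1_concat pg pg'.
apply: transport_mxP (pwC1_regular pc) _ => v.
have [_ g1 _] := pg; have [g0 _ _] := pg'.
have h01 : 0 < (2^-1 : R) < 1 by rewrite invr_gt0 ltr0n invf_lt1 ?ltr1n.
apply: (transport_glue (v := v *m P) (pwC1_regular pc) h01).
  apply: (transport_eq_path (gamma := gamma)); last exact/TP.
  move=> t /andP[t0 t1]; rewrite /= /path_concat.
  have -> : affine 0 2^-1 t <= 2^-1 by rewrite /affine; lra.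
  by congr gamma; rewrite /affine; field.
apply: (transport_eq_path (gamma := gamma')); last by apply/TP'; rewrite mulmxA.
move=> t /andP[t0 t1]; rewrite /= path_concatE2 ?g1 ?g0//.
  by congr gamma'; rewrite /affine; field.
by rewrite /affine; lra.
Qed.

Lemma transport_mx_reverse gamma x y P : pwC1_path gamma x y -> P \in unitmx ->
  transport_mx gamma P -> transport_mx (gamma \o affine 1 (- 1)) (invmx P).
Proof.
move=> pg uP TP; apply: transport_mxP (pwC1_regular (pwC1_affine1 pg)) _ => v.
apply: transport_reverse (pwC1_regular pg) _.
by apply/TP; rewrite mulmxKV.
Qed.

(** Going out along [gamma] and back along [gamma'] is a loop whose transport is [P *m invmx P'];
    the holonomy condition gives it complex determinant 1. *)
Lemma detC_transport_unique gamma gamma' x y P P' :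
  pwC1_path gamma x y -> pwC1_path gamma' x y ->
  transport_mx gamma P -> Jlinear P -> P *m g y *m P^T = g x ->
  transport_mx gamma' P' -> Jlinear P' -> P' *m g y *m P'^T = g x ->
  detC P = detC P'.
Proof.
move=> pg pg' TP JP PI TP' JP' PI'; have uP' := isometry_unit PI'.
have pr := pwC1_affine1 pg'.
have TPP := transport_mx_concat pg pr TP (transport_mx_reverse pg' uP' TP').
have [_] := cy_holonomy hX (pwC1_concat pg pr)
  (fun v => (TPP v (v *m (P *m invmx P'))).2 erefl).
rewrite detC_mul; last exact: Jlinear_inv.
move/(congr1 (fun z => z * detC P')); rewrite mul1r -mulrA [detC (invmx _) * _]mulrC.
by rewrite detC_inv// mulr1.
Qed.

End KaehlerTransport.

Lemma phase_norm {R : realType} (w : R[i]) : w != 0 -> `|w / (w^*)%C| = 1.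
Proof. by move=> w0; rewrite normf_div normcJ divff// normr_eq0. Qed.

Lemma phase_quotient {R : realType} (a dq d : R[i]) (s : R) :
  s != 0 -> d != 0 -> a * (a^*)%C = 1 -> dq = real_complex R s * d * a ->
  a ^+ 2 = dq / d / ((dq / d)^*)%C.
Proof.
move=> s0 d0 A1 E; have A0 : a != 0 by apply: contra_eq_neq A1 => ->; rewrite mul0r eq_sym oner_eq0.
have sc0 : real_complex R s != 0 by rewrite (inj_eq (@complexI R)).
have -> : dq / d = real_complex R s * a by rewrite E; field.
have -> : ((real_complex R s * a)^*)%C = real_complex R s * (a^*)%C.
  by case: a {A1 E A0} => x y; apply/eqP; rewrite eq_complex /=; apply/andP; split; apply/eqP; ring.
have -> : (a^*)%C = a^-1 by apply: (mulfI A0); rewrite A1 divff.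
rewrite -mulf_div divff// mul1r invrK expr2.
by [].
Qed.

(** * A formula for the squared determinant of a comparison *)

Section MaslovFormula.
Context {R : realType} {n : nat} {X : manifold R (n + n)} {g : X -> 'M[R]_(n + n)}.
Hypothesis hX : calabi_yau g.
Context {L : manifold R n} {j : L -> X}.
Hypothesis hj : lagrangian_embedding g j.
Implicit Types (p q : L) (gamma : R -> L).
Local Notation J := (Jstd R n).

Lemma differential_frame q : lagrangian_frame (g (j q)) (differential j q).
Proof.
have [[_ _ fD _] oD] := hj; split; first exact: fD.
apply: (mulmx_row_inj (B := 0)) => u; rewrite mulmx0.
apply/rowP => i; rewrite [RHS]mxE.
have := oD q u (delta_mx 0 i); rewrite /kahler_form /kahler_mx trmx_mul !mulmxA.
rewrite trmx_delta -colE [X in X = 0 -> _]mxE => <-.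
by [].
Qed.

Lemma transportedE p gamma P w : transport_mx (g := g) (j \o gamma) P ->
  transported g j p gamma w <-> exists u, w = u *m (differential j p *m P).
Proof.
move=> TP; split=> [[v [u _ <-] /TP ->]|[u ->]]; first by exists u; rewrite mulmxA.
by exists (u *m differential j p); [exists u|apply/TP; rewrite mulmxA].
Qed.

Lemma transported_frame p q P : Jlinear P -> P *m g (j q) *m P^T = g (j p) ->
  lagrangian_frame (g (j q)) (differential j p *m P).
Proof.
move=> JP PI; have uP := isometry_unit hX PI; have [fD oD] := differential_frame p.
split; first by rewrite /row_free mxrankMfree// row_free_unit.
have JPT : P^T *m J^T = J^T *m P^T by rewrite -!trmx_mul JP.
rewrite trmx_mul -!mulmxA (mulmxA J^T) -JPT.
have -> : P *m (g (j q) *m (P^T *m J^T *m (differential j p)^T))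
   = g (j p) *m J^T *m (differential j p)^T by rewrite -PI !mulmxA.
by rewrite !mulmxA.
Qed.

Lemma transported_lagrangian p q gamma : pwC1_path gamma p q ->
  lagrangian_subspace g (j q) (transported g j p gamma).
Proof.
move=> pg; have [[sj _ _ _] _] := hj.
have [P [TP JP PI]] := transport_mx_exists hX (pwC1_map sj pg).
have [fM oM] := transported_frame JP PI; set M := _ *m P in fM oM.
pose f : 'Hom('rV[R]_n, 'rV[R]_(n + n)) := linfun (mulmxr M).
have fE u : f u = u *m M by rewrite lfunE.
exists (limg f); split.
- apply/seteqP; split=> w.
    move=> /(transportedE _ _ TP)[u ->]; rewrite /= -fE; exact: memv_img (memvf u).
  move=> /memv_imgP[u _ ->]; apply/(transportedE _ _ TP); exists u; exact: fE.
- rewrite limg_dim_eq; first by rewrite dimvf /dim /= mul1n.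
  apply/eqP; rewrite -subv0; apply/subvP => u; rewrite memv_cap memv_ker fE => /andP[_ /eqP uM].
  by rewrite memv0; apply/eqP/(row_free_inj fM); rewrite uM mul0mx.
- move=> _ _ /memv_imgP[u _ ->] /memv_imgP[v _ ->].
  rewrite /kahler_form !fE /kahler_mx trmx_mul.
  have -> : u *m M *m (g (j q) *m J^T) *m (M^T *m v^T)
     = u *m (M *m g (j q) *m J^T *m M^T) *m v^T by rewrite !mulmxA.
  by rewrite oM mulmx0 mul0mx mxE.
Qed.

(** The square of the phase of [w]. Nonzero real factors of [w] cancel, in particular those coming
    from a change of basis in a tangent space of the Lagrangian. *)
Definition maslov_value p q (phi : R[i]) : R[i] :=
  let w := \det (complexify (differential j q))
           / (\det (complexify (differential j p)) * phi) in
  w / (w^*)%C.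

(** Each row of the frame at [q] lies in the image of the transported frame, which gives the real
    matrix [S]; since the frame at [q] has full rank, [S] is invertible. *)
Lemma comparison_frame p q gamma A P : transport_mx (g := g) (j \o gamma) P ->
  comparison g j p q gamma A ->
  exists2 S : 'M[R]_n, S \in unitmx & differential j q = S *m (differential j p *m P) *m A.
Proof.
move=> TP [_ _ TA].
have rows i : exists u : 'rV[R]_n, row i (differential j q) = u *m (differential j p *m P) *m A.
  have : tangent_image j q (row i (differential j q)) by exists (delta_mx 0 i); rewrite // rowE.
  by rewrite TA => -[v /(transportedE _ _ TP)[u ->] <-]; exists u.
pose S : 'M[R]_n := \matrix_i sval (cid (rows i)).
have SE : differential j q = S *m (differential j p *m P) *m A.
  apply/row_matrixP => i; rewrite !row_mul rowK.
  exact: svalP (cid (rows i)).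
exists S => //; rewrite -row_free_unit.
have [fD _] := differential_frame q.
rewrite /row_free eqn_leq rank_leq_row /= -{1}(eqP fD) SE -mulmxA.
exact: mxrankM_maxl.
Qed.

Lemma unitary_detC x A : unitary g x A -> detC A * ((detC A)^*)%C = 1.
Proof.
move=> [JA AI].
exact: detC_unitary (esym JA) (metric_Jlinear hX x) (posdef_unit (metric_posdef hX x)) AI.
Qed.

Lemma comparison_detC p q gamma A P : transport_mx (g := g) (j \o gamma) P -> Jlinear P ->
  P \in unitmx -> comparison g j p q gamma A -> detC A ^+ 2 = maslov_value p q (detC P).
Proof.
move=> TP JP uP cA; have [S uS SE] := comparison_frame TP cA.
have [_ uA _] := cA; have [JA _] := uA; have A1 := unitary_detC uA.
have := congr1 (fun D => \det (complexify D)) SE.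
rewrite (complexifyM _ (esym JA)) complexifyMl (complexifyM _ JP) !det_mulmx det_map_mx.
move=> E; have s0 : \det S != 0 by rewrite -unitfE -unitmxE.
have dp0 : \det (complexify (differential j p)) != 0.
  exact (det_complexify_neq0 (metric_posdef hX _) (cy_hermitian hX _) (differential_frame p)).
have P0 : detC P != 0 := detC_neq0 uP JP.
have d0 : \det (complexify (differential j p)) * detC P != 0 by rewrite mulf_neq0.
exact (phase_quotient s0 d0 A1 E).
Qed.

Lemma maslov_value_circle p q phi : phi != 0 -> circle R (maslov_value p q phi).
Proof.
move=> phi0; have d0 x : \det (complexify (differential j x)) != 0.
  exact (det_complexify_neq0 (metric_posdef hX _) (cy_hermitian hX _) (differential_frame x)).
exact (phase_norm (mulf_neq0 (d0 q) (invr_neq0 (mulf_neq0 (d0 p) phi0)))).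
Qed.

Lemma comparison_exists p q gamma : pwC1_path gamma p q -> exists A, comparison g j p q gamma A.
Proof.
move=> pg; have [[sj _ _ _] _] := hj.
have [P [TP JP PI]] := transport_mx_exists hX (pwC1_map sj pg).
have [A [JA AI [S uS SE]]] := unitary_between_frames (metric_posdef hX _) (cy_hermitian hX _)
  (transported_frame JP PI) (differential_frame q).
exists A; split=> //.
apply/seteqP; split=> w.
  move=> [u _ <-]; exists (u *m S *m (differential j p *m P)).
    by apply/(transportedE _ _ TP); exists (u *m S).
  by rewrite SE !mulmxA.
move=> [v /(transportedE _ _ TP)[u ->] <-]; exists (u *m invmx S) => //.
by rewrite SE !mulmxA mulmxKV.
Qed.

End MaslovFormula.

Lemma phase_mul {R : realType} (dq dp dp' phi psi : R[i]) :
  dp != 0 -> dp' != 0 -> phi != 0 -> psi != 0 ->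
  dq / (dp' * (phi * psi)) / ((dq / (dp' * (phi * psi)))^*)%C
  = dp / (dp' * phi) / ((dp / (dp' * phi))^*)%C
    * (dq / (dp * psi) / ((dq / (dp * psi))^*)%C).
Proof.
move=> dp0 dp'0 phi0 psi0; have -> : dq / (dp' * (phi * psi)) = dp / (dp' * phi) * (dq / (dp * psi)).
  by field; rewrite dp0 dp'0 phi0 psi0.
rewrite [in RHS]mulf_div; congr (_ / _).
exact (rmorphM (@Num.conj R[i]) _ _).
Qed.

Section MaslovMap.
Context {R : realType} {n : nat} {X : manifold R (n + n)} {g : X -> 'M[R]_(n + n)}.
Hypothesis hX : calabi_yau g.
Context {L : manifold R n}.
Hypothesis hL : connected [set: L].
Context {j : L -> X}.
Hypothesis hj : lagrangian_embedding g j.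
Implicit Types (p q r : L) (gamma : R -> L).

(** A relation, since paths are only known to exist; existence and uniqueness of [phi] make it a
    function of the end points. *)
Definition transport_det p q (phi : R[i]) : Prop :=
  exists gamma P, [/\ pwC1_path gamma p q, transport_mx (g := g) (j \o gamma) P,
    Jlinear P, P *m g (j q) *m P^T = g (j p) & phi = detC P].

Lemma transport_det_exists p q : exists phi, transport_det p q phi.
Proof.
have [gamma pg] := connected_pwC1 p q hL; have [[sj _ _ _] _] := hj.
have [P [TP JP PI]] := transport_mx_exists hX (pwC1_map sj pg).
by exists (detC P), gamma, P.
Qed.

Lemma transport_det_unique p q phi psi :
  transport_det p q phi -> transport_det p q psi -> phi = psi.
Proof.
move=> [c [P [pc TP JP PI ->]]] [d [Q [pd TQ JQ QI ->]]].
have [[sj _ _ _] _] := hj.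
exact (detC_transport_unique hX (pwC1_map sj pc) (pwC1_map sj pd) TP JP PI TQ JQ QI).
Qed.

Lemma transport_det_neq0 p q phi : transport_det p q phi -> phi != 0.
Proof.
move=> [c [P [pc TP JP PI ->]]].
exact (detC_neq0 (isometry_unit hX PI) JP).
Qed.

Lemma transport_det_mul p q r phi psi :
  transport_det p q phi -> transport_det q r psi -> transport_det p r (phi * psi).
Proof.
move=> [c [P [pc TP JP PI ->]]] [d [Q [pd TQ JQ QI ->]]].
have [[sj _ _ _] _] := hj.
exists (path_concat c d), (P *m Q); split.
- exact (pwC1_concat pc pd).
- have := transport_mx_concat hX (pwC1_map sj pc) (pwC1_map sj pd) TP TQ.
  congr (transport_mx (g := g) _ _); apply/funext => t.
  by rewrite /= /path_concat; case: ifP.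
- exact (JlinearM JP JQ).
- by rewrite trmx_mul -PI -QI !mulmxA.
- by rewrite detC_mul.
Qed.

Lemma comparison_transport_det p q gamma A phi : comparison g j p q gamma A ->
  transport_det p q phi -> detC A ^+ 2 = maslov_value (j := j) p q phi.
Proof.
move=> cA tphi; have [pg _ _] := cA; have [[sj _ _ _] _] := hj.
have [P [TP JP PI]] := transport_mx_exists hX (pwC1_map sj pg).
have -> : phi = detC P by apply: transport_det_unique tphi _; exists gamma, P.
exact (comparison_detC hX hj TP JP (isometry_unit hX PI) cA).
Qed.

Lemma maslov_mapE p (M : L -> circle R) q phi : maslov_map g j p M ->
  transport_det p q phi -> val (M q) = maslov_value (j := j) p q phi.
Proof.
move=> /(_ q)[[gamma [A cA]] /(_ _ _ cA) ->] tphi.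
exact (comparison_transport_det cA tphi).
Qed.

Lemma comparison_circle p q gamma gamma' A A' :
  comparison g j p q gamma A -> comparison g j p q gamma' A' ->
  circle R (detC A ^+ 2) /\ detC A ^+ 2 = detC A' ^+ 2.
Proof.
move=> cA cA'; have [phi tphi] := transport_det_exists p q.
rewrite (comparison_transport_det cA tphi) (comparison_transport_det cA' tphi).
by split=> //; exact (maslov_value_circle hX hj _ _ (transport_det_neq0 tphi)).
Qed.

Lemma maslov_map_unique p : exists! M : L -> circle R, maslov_map g j p M.
Proof.
pose f q := sval (cid (transport_det_exists p q)).
have fP q : transport_det p q (f q) := svalP (cid (transport_det_exists p q)).
have fC q : circle R (maslov_value (j := j) p q (f q)).
  exact (maslov_value_circle hX hj _ _ (transport_det_neq0 (fP q))).
exists (fun q => SigSub (mem_set (fC q))); split.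
  move=> q; split=> [|gamma A cA]; last exact (esym (comparison_transport_det cA (fP q))).
  have [gamma pg] := connected_pwC1 p q hL.
  by have [A cA] := comparison_exists hX hj pg; exists gamma, A.
move=> M' hM'; apply/funext => q; apply: val_inj.
exact (esym (maslov_mapE hM' (fP q))).
Qed.

Lemma maslov_map_basepoint p p' (M M' : L -> circle R) :
  maslov_map g j p M -> maslov_map g j p' M' ->
  exists2 c : R[i], `|c| = 1 & forall q, val (M' q) = c * val (M q).
Proof.
move=> hM hM'; have [phi tphi] := transport_det_exists p' p.
have d0 x : \det (complexify (differential j x)) != 0.
  exact (det_complexify_neq0 (metric_posdef hX _) (cy_hermitian hX _) (differential_frame hj x)).
have w0 := mulf_neq0 (d0 p) (invr_neq0 (mulf_neq0 (d0 p') (transport_det_neq0 tphi))).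
(* The constant is the value at [p] of the map based at [p']. *)
exists (maslov_value (j := j) p' p phi); first exact (phase_norm w0).
move=> q; have [psi tpsi] := transport_det_exists p q.
rewrite (maslov_mapE hM tpsi) (maslov_mapE hM' (transport_det_mul tphi tpsi)).
exact (phase_mul _ (d0 p) (d0 p') (transport_det_neq0 tphi) (transport_det_neq0 tpsi)).
Qed.

End MaslovMap.

(** * Smoothness of the Maslov map *)

Section SmoothComplex.
Context {R : realType} {m : nat} (U : set 'rV[R]_m).
Hypothesis oU : open U.
Implicit Types f h : 'rV[R]_m -> R[i].

Lemma smooth_eq (f h : 'rV[R]_m -> R) :
  (forall x, U x -> f x = h x) -> smooth_on U f -> smooth_on U h.
Proof. by move=> fh sf k; exact: Ck_eq (sf k). Qed.

Lemma smooth_C_eq f h : (forall x, U x -> f x = h x) -> smooth_C_on U f -> smooth_C_on U h.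
Proof. by move=> fh [sr si]; split; [apply: smooth_eq sr|apply: smooth_eq si] => x Ux /=; rewrite fh. Qed.

Lemma smooth_C_cst (c : R[i]) : smooth_C_on U (fun=> c).
Proof. by split=> k; exact: Ck_cst. Qed.

Lemma smooth_C_add f h : smooth_C_on U f -> smooth_C_on U h -> smooth_C_on U (fun x => f x + h x).
Proof.
move=> [fr fi] [hr hi]; split=> k.
  by apply: Ck_eq (Ck_add oU (fr k) (hr k)) => // x _ /=; case: (f x) (h x) => ? ? [].
by apply: Ck_eq (Ck_add oU (fi k) (hi k)) => // x _ /=; case: (f x) (h x) => ? ? [].
Qed.

Lemma smooth_C_mul f h : smooth_C_on U f -> smooth_C_on U h -> smooth_C_on U (fun x => f x * h x).
Proof.
move=> [fr fi] [hr hi]; split=> k.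
  apply: Ck_eq (Ck_add oU (Ck_mul oU (fr k) (hr k)) (Ck_opp oU (Ck_mul oU (fi k) (hi k)))) => //.
  by move=> x _ /=; case: (f x) (h x) => ? ? [].
apply: Ck_eq (Ck_add oU (Ck_mul oU (fr k) (hi k)) (Ck_mul oU (fi k) (hr k))) => //.
by move=> x _ /=; case: (f x) (h x) => ? ? [].
Qed.

Lemma smooth_C_sum (I : Type) (r : seq I) (f : I -> 'rV[R]_m -> R[i]) :
  (forall i, smooth_C_on U (f i)) -> smooth_C_on U (fun x => \sum_(i <- r) f i x).
Proof.
move=> sf; elim: r => [|i r IH].
  by apply: smooth_C_eq (smooth_C_cst 0) => x _; rewrite big_nil.
by apply: smooth_C_eq (smooth_C_add (sf i) IH) => x _; rewrite big_cons.
Qed.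

Lemma smooth_C_prod (I : Type) (r : seq I) (f : I -> 'rV[R]_m -> R[i]) :
  (forall i, smooth_C_on U (f i)) -> smooth_C_on U (fun x => \prod_(i <- r) f i x).
Proof.
move=> sf; elim: r => [|i r IH].
  by apply: smooth_C_eq (smooth_C_cst 1) => x _; rewrite big_nil.
by apply: smooth_C_eq (smooth_C_mul (sf i) IH) => x _; rewrite big_cons.
Qed.

Lemma smooth_C_det r (F : 'rV[R]_m -> 'M[R[i]]_r) :
  (forall i j, smooth_C_on U (fun x => F x i j)) -> smooth_C_on U (fun x => \det (F x)).
Proof.
move=> sF; apply: smooth_C_sum => s; apply: smooth_C_mul; first exact: smooth_C_cst.
exact: smooth_C_prod.
Qed.

Lemma smooth_C_complexify k r (F : 'rV[R]_m -> 'M[R]_(k, r + r)) i j :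
  smooth_mx_on U F -> smooth_C_on U (fun x => complexify (F x) i j).
Proof.
move=> sF; split; [move: (sF i (lshift r j))|move: (sF i (rshift r j))];
  by apply: smooth_eq => x _; rewrite /= !mxE.
Qed.

Lemma smooth_detC r (F : 'rV[R]_m -> 'M[R]_(r + r)) :
  smooth_mx_on U F -> smooth_C_on U (fun x => detC (F x)).
Proof.
move=> sF; apply: (smooth_C_eq (f := fun x => \det (complexify (usubmx (F x))))).
  by move=> x _; rewrite detCE.
apply: smooth_C_det => i j; apply: smooth_C_complexify => k l.
by apply: smooth_eq (sF (lshift r k) l) => x _; rewrite mxE.
Qed.

Lemma smooth_C_conj f : smooth_C_on U f -> smooth_C_on U (fun x => ((f x)^*)%C).
Proof.
move=> [fr fi]; split=> k.
  by apply: Ck_eq (fr k) => // x _ /=; case: (f x).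
by apply: Ck_eq (Ck_opp oU (fi k)) => // x _ /=; case: (f x).
Qed.

Lemma smooth_C_inv f : (forall x, U x -> f x != 0) -> smooth_C_on U f ->
  smooth_C_on U (fun x => (f x)^-1).
Proof.
move=> f0 [fr fi]; pose N x := complex.Re (f x) * complex.Re (f x) + complex.Im (f x) * complex.Im (f x).
have N0 x : U x -> N x != 0.
  move=> /f0; rewrite /N; case: (f x) => a b /=; apply: contra => /eqP N0.
  have a0 : a * a = 0 by have := sqr_ge0 a; have := sqr_ge0 b; rewrite !expr2; lra.
  have b0 : b * b = 0 by move: N0; rewrite a0 add0r.
  by move/eqP: a0; move/eqP: b0; rewrite !mulf_eq0 !orbb => /eqP -> /eqP ->.
have sN k : Ck k U (fun x => (N x)^-1).
  apply: Ck_inv => //; apply: Ck_add => //; apply: Ck_mul => //; first [exact: fr|exact: fi].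
split=> k.
  apply: Ck_eq (Ck_mul oU (fr k) (sN k)) => // x _; rewrite /= /N.
  by case: (f x) => a b /=; rewrite -!expr2.
apply: Ck_eq (Ck_opp oU (Ck_mul oU (fi k) (sN k))) => // x _; rewrite /= /N.
by case: (f x) => a b /=; rewrite -!expr2.
Qed.

End SmoothComplex.

(** * Differential of the complex determinant *)

Section DetCDerivative.
Context {R : realType}.

Definition is_derive_C (f : R -> R[i]) (t : R) (d : R[i]) : Prop :=
  is_derive t 1 (@complex.Re R \o f) (complex.Re d) /\
  is_derive t 1 (@complex.Im R \o f) (complex.Im d).

Lemma is_derive_C_cstM (c : R[i]) f t d : is_derive_C f t d -> is_derive_C (fun s => c * f s) t (c * d).
Proof.
move=> [dr di]; case: c => a b; split.
  have -> : @complex.Re R \o (fun s => Complex a b * f s)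
    = fun s => a * (@complex.Re R \o f) s + (- b) * (@complex.Im R \o f) s.
    by apply/funext => s /=; case: (f s) => x y /=; rewrite mulNr.
  have := is_deriveD (is_deriveZ a dr) (is_deriveZ (- b) di).
  by move=> h; apply: (is_derive_eq h); case: d {dr di h} => x y /=; rewrite /GRing.scale /= mulNr.
have -> : @complex.Im R \o (fun s => Complex a b * f s)
  = fun s => a * (@complex.Im R \o f) s + b * (@complex.Re R \o f) s.
  by apply/funext => s /=; case: (f s) => x y /=.
have := is_deriveD (is_deriveZ a di) (is_deriveZ b dr).
by move=> h; apply: (is_derive_eq h); case: d {dr di h} => x y.
Qed.

Lemma is_derive_C_affine (h : R -> R[i]) (al be t : R) d :
  is_derive_C h (al + be * t) d -> is_derive_C (fun s => h (al + be * s)) t ((real_complex R be) * d).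
Proof.
move=> [dr di]; have da := is_derive_affine al be t.
have E : real_complex R be * d = Complex (be * complex.Re d) (be * complex.Im d).
  by case: d {dr di} => x y; apply/eqP; rewrite eq_complex /= !mul0r subr0 addr0 !eqxx.
rewrite E; split.
  exact (is_derive_comp_scal (h := fun s => al + be * s) dr da).
exact (is_derive_comp_scal (h := fun s => al + be * s) di da).
Qed.

Lemma is_derive_C_eq (f h : R -> R[i]) (t : R) d :
  (forall s, f s = h s) -> is_derive_C f t d -> is_derive_C h t d.
Proof. by move=> /funext ->. Qed.

Lemma real_complex_cancel (k : R) (x z : R[i]) : k != 0 ->
  real_complex R k^-1 * (x * (real_complex R k * z)) = x * z.
Proof. by move=> k0; rewrite mulrCA (mulrA (real_complex R _)) -rmorphM /= mulVf ?mul1r. Qed.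

Lemma Ck_coord k m (U : set 'rV[R]_m) l : Ck k U (fun x => x 0 l).
Proof.
have d (x : 'rV[R]_m) : differentiable (fun x : 'rV[R]_m => x 0 l) x.
  by apply: (differentiable_entry (F := @id 'rV[R]_m)).
case: k => [|k] /=; first by move=> x _; exact/differentiable_continuous/d.
split=> [x _ //|i].
have -> : partial i (fun x : 'rV[R]_m => x 0 l) = fun=> (delta_mx 0 i : 'rV[R]_m) 0 l.
  apply/funext => x; rewrite /partial.
  have did : is_derive x (delta_mx 0 i) (@id 'rV[R]_m) (delta_mx 0 i) by apply: is_derive_id.
  by have /is_derive_mxP/(_ 0 l)[_ ->] := did.
exact: Ck_cst.
Qed.

Context {n : nat}.

(** The complex determinant as a function on row vectors, the setting in which [Ck] and [derive_C]
    are defined. *)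
Let detv (z : 'rV[R]_((n + n) * (n + n))) : R[i] := detC (vec_mx z : 'M[R]_(n + n)).

Lemma smooth_detv : smooth_C_on setT detv.
Proof.
apply: (@smooth_detC _ _ setT openT n (fun z => vec_mx z)).
by move=> i j k; apply: Ck_eq (Ck_coord k setT (mxvec_index i j)); [exact: openT|move=> x _; rewrite mxE].
Qed.

(** The differential of [detC] at the identity, which is the complex trace when [K] is complex
    linear. Kept as a derivative, it is linear in [K] without any expansion of determinants. *)
Definition dlogC (K : 'M[R]_(n + n)) : R[i] := derive_C (mxvec K) detv (mxvec 1%:M).

Lemma differentiable_detv z : differentiable (@complex.Re R \o detv) z /\
  differentiable (@complex.Im R \o detv) z.
Proof. by have [/(_ 1%N)[dr _] /(_ 1%N)[di _]] := smooth_detv; split; [exact: dr|exact: di]. Qed.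

Lemma is_derive_detv_line (z w : 'rV[R]_((n + n) * (n + n))) :
  is_derive_C (fun s => detv (z + s *: w)) 0 (derive_C w detv z).
Proof.
have [dr di] := differentiable_detv (z + 0 *: w).
have zE : z + 0 *: w = z by rewrite scale0r addr0.
by split; [have := is_derive_line dr|have := is_derive_line di]; rewrite zE.
Qed.

Lemma is_derive_C_uniq f t d d' : is_derive_C f t d -> is_derive_C f t d' -> d = d'.
Proof.
move=> [fr fi] [fr' fi']; apply/eqP; rewrite eq_complex.
by apply/andP; split; apply/eqP; [exact (is_derive_uniq fr fr')|exact (is_derive_uniq fi fi')].
Qed.

(* [detC (U + s U K) = detC U * detC (1 + s K)], so only the derivative of
   [detC] at the identity is involved. *)
Lemma is_derive_detC (U : R -> 'M[R]_(n + n)) (t : R) (K : 'M[R]_(n + n)) : Jlinear K ->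
  is_derive t 1 U (U t *m K) -> is_derive_C (fun s => detC (U s)) t (detC (U t) * dlogC K).
Proof.
move=> JK dU; have [dr di] := differentiable_detv (mxvec (U t)).
have dv : is_derive t 1 (fun s => mxvec (U s)) (mxvec (U t *m K)).
  apply/is_derive_mxP => i k; rewrite ord1; case/mxvec_indexP: k => k l.
  rewrite mxvecE; under eq_fun do rewrite mxvecE.
  by have /is_derive_mxP := dU; exact.
have -> : (fun s => detC (U s)) = fun s => detv (mxvec (U s)).
  by apply/funext => s; rewrite /detv mxvecK.
have -> : detC (U t) * dlogC K = derive_C (mxvec (U t *m K)) detv (mxvec (U t)).
  apply: is_derive_C_uniq (is_derive_detv_line _ _).
  have -> : (fun s => detv (mxvec (U t) + s *: mxvec (U t *m K)))
    = fun s => detC (U t) * detv (mxvec 1%:M + s *: mxvec K).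
    apply/funext => s; rewrite /detv -!linearZ -!linearD /= !mxvecK.
    have JsK : Jlinear (1%:M + s *: K).
      by rewrite /Jlinear mulmxDr mulmxDl mulmx1 mul1mx -scalemxAr -scalemxAl JK.
    by rewrite -(detC_mul _ JsK) mulmxDr mulmx1 -scalemxAr.
  exact: is_derive_C_cstM (is_derive_detv_line _ _).
by split; [exact (is_derive1_comp dr dv)|exact (is_derive1_comp di dv)].
Qed.

Lemma dlogC_sum K : complex.Im (dlogC K) =
  \sum_(e : 'I_(n + n) * 'I_(n + n)) K e.1 e.2 * complex.Im (dlogC (delta_mx e.1 e.2)).
Proof.
have [_ di] := differentiable_detv (mxvec 1%:M).
rewrite /dlogC /= deriveE// [in LHS](matrix_sum_delta K) pair_bigA /= !linear_sum.
by apply: eq_bigr => e _; rewrite !linearZ deriveE.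
Qed.

Lemma dlogCZ (k : R) (K : 'M[R]_(n + n)) : dlogC (k *: K) = real_complex R k * dlogC K.
Proof.
have [dr di] := differentiable_detv (mxvec 1%:M).
apply/eqP; rewrite eq_complex /=; apply/andP; split; apply/eqP.
  by rewrite mul0r subr0 !deriveE// !linearZ.
by rewrite mul0r addr0 !deriveE// !linearZ.
Qed.

Lemma dlogC_Im_sum (I : finType) (r : I -> R) (K : I -> 'M[R]_(n + n)) :
  complex.Im (dlogC (\sum_i r i *: K i)) = \sum_i r i * complex.Im (dlogC (K i)).
Proof.
have [_ di] := differentiable_detv (mxvec 1%:M).
rewrite /dlogC /= deriveE// !linear_sum.
by apply: eq_bigr => e _; rewrite !linearZ deriveE.
Qed.

End DetCDerivative.

(** * From directional derivatives to smoothness *)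

Section LineDerivative.
Context {R : realType} {m : nat} (U : set 'rV[R]_m).
Hypothesis oU : open U.
Implicit Types (f x y : 'rV[R]_m -> R) (al mu : 'I_m -> 'rV[R]_m -> R).

(** A Gateaux derivative, linear in the direction, at each point of [U]; neither continuity of [f]
    nor of the coefficients [al] is part of it. This is the information that transport along
    segments provides. *)
Definition line_derivative f al : Prop := forall z v, U z ->
  is_derive (0 : R) 1 (fun t => f (z + t *: v)) (\sum_i v 0 i * al i z).

Lemma near_segment z : U z ->
  \forall h \near (0 : 'rV[R]_m), forall t : R, 0 <= t <= 1 -> U (z + t *: h).
Proof.
move=> Uz; have /nbhs_ballP[e /= e0 eU] := open_nbhs_sub oU Uz.
near=> h => t t01; apply: eU; rewrite -ball_normE /= opprD addNKr normrN normrZ.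
have he : `|h| < e.
  near: h; have := @nbhsx_ballx _ _ (0 : 'rV[R]_m) e e0.
  by apply: filterS => h; rewrite -ball_normE /= sub0r normrN.
apply: le_lt_trans he; rewrite ler_piMl//; move: t01 => /andP[t0 t1].
by rewrite ger0_norm.
Unshelve. all: by end_near. Qed.

Lemma line_MVT_eq f al z h : line_derivative f al ->
  (forall t : R, 0 <= t <= 1 -> U (z + t *: h)) ->
  exists2 c : R, 0 <= c <= 1 & f (z + h) - f z = \sum_i h 0 i * al i (z + c *: h).
Proof.
move=> df Ut; have d (t : R) : 0 <= t <= 1 ->
    is_derive t 1 (fun s => f (z + s *: h)) (\sum_i h 0 i * al i (z + t *: h)).
  move=> t01; have dF := df (z + t *: h) h (Ut t t01).
  have da : is_derive t 1 (fun s : R => - t + 1 * s) 1 := is_derive_affine (- t) 1 t.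
  have dF' : is_derive ((fun s : R => - t + 1 * s) t) 1 (fun s => f (z + t *: h + s *: h))
      (\sum_i h 0 i * al i (z + t *: h)) by rewrite /= mul1r addNr.
  have := is_derive_comp_scal (h := fun s : R => - t + 1 * s) dF' da.
  rewrite scale1r; congr (is_derive _ _ _ _); apply/funext => s /=.
  by rewrite -addrA -scalerDl mul1r addNKr.
have [c c01 E] := MVT_le (ler01 : (0 : R) <= 1) d.
by exists c => //; move: E; rewrite scale1r scale0r addr0 subr0 mulr1.
Qed.

Lemma sum_norm_le (h : 'rV[R]_m) (a : 'I_m -> R) (C : R) : (forall i, `|a i| <= C) ->
  `|\sum_i h 0 i * a i| <= (m%:R * C) * `|h|.
Proof.
move=> aC; apply: le_trans (ler_norm_sum _ _ _) _.
apply: (@le_trans _ _ (\sum_(i < m) C * `|h|)).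
  apply: ler_sum => i _; rewrite normrM mulrC.
  by apply: ler_pM => //; exact: norm_mx_coord.
by rewrite sumr_const card_ord -[_ *+ m]mulr_natl mulrA.
Qed.

Lemma near_sub (z : 'rV[R]_m) (P : 'rV[R]_m -> Prop) :
  (\forall h \near (0 : 'rV[R]_m), P h) -> \forall y \near z, P (y - z).
Proof.
move=> /nbhs_ballP[e /= e0 eP]; apply/nbhs_ballP; exists e => //= y yz; apply: eP.
by move: yz; rewrite -!ball_normE /= sub0r normrN distrC.
Qed.

Lemma near0_norm_lt e : 0 < e -> \forall h \near (0 : 'rV[R]_m), `|h| < e.
Proof.
move=> e0; apply/nbhs_ballP; exists e => //= h.
by rewrite -ball_normE /= sub0r normrN.
Qed.

(** With locally bounded coefficients, the mean value theorem on segments issuing from [z] bounds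
    the increment of [f] by a multiple of the distance. *)
Lemma line_derivative_continuous f al z : line_derivative f al -> U z ->
  (exists C : R, \forall y \near z, forall i, `|al i y| <= C) -> {for z, continuous f}.
Proof.
move=> df Uz [C /nbhs_ballP[e /= e0 eC]].
have C0 : 0 <= m%:R * C.
  case: (posnP m) => [->|m0]; first by rewrite mul0r.
  rewrite mulr_ge0//; apply: le_trans (eC z (ballxx _ e0) (Ordinal m0)); exact: normr_ge0.
apply/(@cvgrPdist_le _ _ _ (nbhs z) (nbhs_filter z) f (f z)) => d d0; have d' : 0 < Num.min e (d / (m%:R * C + 1)).
  by rewrite lt_min e0 divr_gt0// ltr_wpDl.
apply: filterS2 (near_sub z (near_segment Uz)) (near_sub z (near0_norm_lt d')) => y Ut hd.
have [c c01 E] := line_MVT_eq df Ut.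
move: hd; rewrite lt_min => /andP[he hd].
rewrite [z + (y - z)]addrC subrK in E; rewrite distrC E.
apply: le_trans (sum_norm_le (C := C) _ _) _.
  apply: eC; rewrite -ball_normE /= opprD addNKr normrN normrZ.
  apply: le_lt_trans he; rewrite ler_piMl//; move: c01 => /andP[c0 c1].
  by rewrite ger0_norm.
rewrite ltr_pdivlMr in hd; last by rewrite ltr_wpDl.
by apply: le_trans (ltW hd); rewrite mulrC ler_wpM2l// lerDl.
Qed.

(** By the mean value theorem the remainder is the sum of the
    [h 0 i * (al i (z + c *: h) - al i z)], which is small relative to [h] when the coefficients are
    continuous at [z]. *)
Lemma line_derivative_differentiable f al z : line_derivative f al -> U z ->
  (forall i, {for z, continuous (al i)}) -> differentiable f z.
Proof.
move=> df Uz cal; pose l (h : 'rV[R]_m) : R := \sum_i h 0 i * al i z.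
have lin k : {morph l : u v / k *: u + v >-> k * u + v}.
  move=> u v; rewrite /l mulr_sumr -big_split; apply: eq_bigr => i _.
  by rewrite !mxE mulrDl mulrA.
have [l' l'E] : exists l' : {linear 'rV[R]_m -> R}, forall h, l' h = l h.
  by exists (HB.pack_for {linear 'rV[R]_m -> R} l (GRing.isLinear.Build R 'rV[R]_m R *:%R l lin)).
apply: (@differentiable_approxP _ _ _ _ _ l').
  have -> : (l' : _ -> _) = l by apply/funext.
  have : Ck 0 setT l.
    apply: Ck_sum; first exact: openT.
    by move=> i; apply: Ck_mul (Ck_coord _ _ i) (Ck_cst _ _ _); exact: openT.
  by move=> /= cl h; apply: cl; rewrite inE.
move=> e e0; have me : 0 < e / (m%:R + 1) by rewrite divr_gt0// ltr_wpDl.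
have /nbhs_ballP[d /= d0 dal] : \forall y \near z, forall i, `|al i y - al i z| <= e / (m%:R + 1).
  apply: (filter_forall (nbhs_filter z)) => i; have /(cvgrPdist_le (FF := nbhs_filter z))/(_ _ me) := cal i.
  by apply: filterS => y; rewrite distrC.
near=> h; have Ut : forall t : R, 0 <= t <= 1 -> U (z + t *: h).
  by near: h; exact: near_segment Uz.
have [c c01 E] := line_MVT_eq df Ut.
rewrite [h + z]addrC E l'E /l -sumrB.
rewrite (eq_bigr (fun i => h 0 i * (al i (z + c *: h) - al i z))); last by move=> i _; rewrite mulrBr.
apply: le_trans (sum_norm_le (C := e / (m%:R + 1)) _ _) _.
  apply: dal; rewrite -ball_normE /= opprD addNKr normrN normrZ.
  apply: (@le_lt_trans _ _ `|h|).
    rewrite ler_piMl//; move: c01 => /andP[c0 c1]; by rewrite ger0_norm.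
  by near: h; exact: near0_norm_lt.
rewrite ler_wpM2r// mulrA ler_pdivrMr; last by rewrite ltr_wpDl.
by rewrite mulrC ler_wpM2l ?ltW// ltrDl.
Unshelve. all: by end_near. Qed.

Lemma line_derivative_partial f al z i : line_derivative f al -> U z ->
  differentiable f z -> partial i f z = al i z.
Proof.
move=> df Uz fz; have := df z (delta_mx 0 i) Uz.
rewrite (bigD1 i)//= mxE !eqxx mul1r big1 ?addr0; last first.
  by move=> k ki; rewrite mxE (negPf ki) andbF mul0r.
move=> d; have fz0 : differentiable f (z + (0 : R) *: delta_mx 0 i) by rewrite scale0r addr0.
by have := is_derive_uniq (is_derive_line fz0) d; rewrite scale0r addr0.
Qed.

(** The coefficients of the derivatives contain [x] and [y] themselves. The bounds make them locally
    bounded, so [x] and [y] are continuous, hence the coefficients are continuous and [x] and [y]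
    differentiable; each further order follows from the previous one. *)
Lemma smooth_rotation x y mu : (forall i, smooth_on U (mu i)) ->
  (forall z, U z -> `|x z| <= 1) -> (forall z, U z -> `|y z| <= 1) ->
  line_derivative x (fun i z => - mu i z * y z) ->
  line_derivative y (fun i z => mu i z * x z) ->
  smooth_on U x /\ smooth_on U y.
Proof.
move=> smu x1 y1 dx dy.
have mu_cont i z : U z -> {for z, continuous (mu i)} by move=> Uz; apply: (smu i 0); rewrite inE.
have mu_bound z : U z -> exists C : R, \forall w \near z, forall i, `|mu i w| <= C.
  move=> Uz; exists (\sum_i `|mu i z| + 1); apply: (filter_forall (nbhs_filter z)) => i.
  have /(cvgrPdist_le (FF := nbhs_filter z))/(_ 1 ltr01) := mu_cont i z Uz.
  apply: filterS => w wz; rewrite -[mu i w](subrK (mu i z)) addrC.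
  apply: le_trans (ler_normD _ _) _; rewrite distrC; apply: lerD wz.
  by rewrite (bigD1 i)//= lerDl sumr_ge0.
have bound (w : 'rV[R]_m -> R) z (s : R) : `|s| = 1 -> (forall z, U z -> `|w z| <= 1) -> U z ->
    exists C, \forall u \near z, forall i, `|s * mu i u * w u| <= C.
  move=> s1 w1 Uz; have [C nC] := mu_bound z Uz; exists C.
  apply: filterS2 nC (open_nbhs_sub oU Uz) => u uC Uu i.
  by rewrite !normrM s1 mul1r; apply: le_trans (uC i); rewrite ler_piMr// w1.
have cx z : U z -> {for z, continuous x}.
  move=> Uz; apply: (line_derivative_continuous dx Uz).
  have [C nC] := bound y z (- 1) (normrN1 _) y1 Uz; exists C.
  by apply: filterS nC => u uC i; rewrite -[- _]mulN1r.
have cy z : U z -> {for z, continuous y}.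
  move=> Uz; apply: (line_derivative_continuous dy Uz).
  have [C nC] := bound x z 1 (normr1 _) x1 Uz; exists C.
  by apply: filterS nC => u uC i; rewrite -[mu i u]mul1r.
have Dx z : U z -> differentiable x z.
  move=> Uz; apply: (line_derivative_differentiable dx Uz) => i.
  by apply: cvgM (cy z Uz); apply: cvgN; exact: mu_cont.
have Dy z : U z -> differentiable y z.
  move=> Uz; apply: (line_derivative_differentiable dy Uz) => i.
  by apply: cvgM (cx z Uz); exact: mu_cont.
have sxy k : Ck k U x /\ Ck k U y.
  elim: k => [|k [sx sy]]; first by split=> z; rewrite inE; [exact: cx|exact: cy].
  split; split=> // i.
    apply: Ck_eq (Ck_mul oU (Ck_opp oU (smu i k)) sy) => // z Uz.
    by rewrite (line_derivative_partial i dx Uz (Dx z Uz)).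
  apply: Ck_eq (Ck_mul oU (smu i k) sx) => // z Uz.
  by rewrite (line_derivative_partial i dy Uz (Dy z Uz)).
by split=> k; have [] := sxy k.
Qed.

End LineDerivative.

(** * Transport along segments of a chart *)

Section TransportDeterminant.
Context {R : realType} {n : nat} {X : manifold R (n + n)} {g : X -> 'M[R]_(n + n)}.
Hypothesis hX : calabi_yau g.
Context {L : manifold R n} {j : L -> X}.
Hypothesis sj : smooth_map j.
Variables (a : chart L) (b : chart X).
Local Notation J := (Jstd R n).

Let riem : riemannian g := cy_riemannian hX.

Definition chart_overlap : set 'rV[R]_n := coord L a @` (dom L a `&` j @^-1` dom X b).

Definition map_in (y : 'rV[R]_n) : 'rV[R]_(n + n) := coord X b (j (param L a y)).

Definition pulled_connection (y v : 'rV[R]_n) : 'M[R]_(n + n) :=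
  connection_mx (bilinear_in g b) (map_in y) (v *m 'J map_in y).

Lemma open_chart_overlap : open chart_overlap.
Proof. exact (smooth_map_open sj (a := a) (b := b)). Qed.

Lemma chart_overlapP y : chart_overlap y ->
  [/\ chart_image a y, dom L a (param L a y) & dom X b (j (param L a y))].
Proof.
move=> [x [ax bx] <-]; split; first exact: coord_image.
  by rewrite coordK.
by rewrite coordK.
Qed.

Lemma smooth_map_in : smooth_mx_on chart_overlap map_in.
Proof. by have [_ sm] := sj; exact (sm a b). Qed.

Lemma map_in_image y : chart_overlap y -> chart_image b (map_in y).
Proof. by move=> /chart_overlapP[_ _ bx]; exact: coord_image. Qed.

Lemma smooth_pulled_connection v : smooth_mx_on chart_overlap (pulled_connection^~ v).
Proof.
move=> i k d; have oW := open_chart_overlap; have [_ _ sg] := riem.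
apply: (@Ck_eq _ _ _ _ (fun y => \sum_l christoffel (bilinear_in g b) (map_in y) k l i
   * (v *m 'J map_in y) 0 l) _ oW).
  by move=> y _; rewrite mxE.
apply: Ck_sum => // l; apply: Ck_mul => //.
  apply: (Ck_comp (f := fun y => christoffel (bilinear_in g b) y k l i) oW
    (open_chart_image b) map_in_image smooth_map_in).
  exact (smooth_christoffel (open_chart_image b) k l i (sg b) (metric_unit riem (a := b)) d).
have := smooth_mx_mul oW (smooth_mx_cst chart_overlap v) (smooth_jacobian oW smooth_map_in).
exact.
Qed.

Lemma pulled_connection_sum y v : pulled_connection y v
  = \sum_i v 0 i *: pulled_connection y (delta_mx 0 i).
Proof.
apply/matrixP => k l; rewrite summxE mxE.
rewrite (eq_bigr (fun i => \sum_p christoffel (bilinear_in g b) (map_in y) l p k * (v 0 i * ('J map_in y) i p))).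
  rewrite exchange_big; apply: eq_bigr => p _; rewrite -mulr_sumr; congr (_ * _).
  by rewrite mxE.
move=> i _; rewrite !mxE mulr_sumr; apply: eq_bigr => p _.
by rewrite -rowE mxE mulrCA.
Qed.

Lemma pulled_connectionZ y k v : pulled_connection y (k *: v) = k *: pulled_connection y v.
Proof. by rewrite /pulled_connection -scalemxAl connection_mxZ. Qed.

Lemma pulled_connection_Jlinear y v : chart_overlap y -> Jlinear (pulled_connection y v).
Proof.
by move=> /map_in_image by_; exact (esym (kahler_connection hX (v *m 'J map_in y) by_)).
Qed.

Section Segment.
Variables (y v : 'rV[R]_n) (B : R).
Hypothesis Wt : forall t : R, 0 <= t <= 1 -> chart_overlap (y + t *: v).
Hypothesis conn_le : forall t : R, 0 <= t <= 1 ->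
  forall i k, `|pulled_connection (y + t *: v) v i k| <= B.
Hypothesis Bn : (n + n)%:R * B <= 2^-1.

Let c (t : R) : X := j (param L a (y + t *: v)).

Lemma segment_C1 t : 0 <= t <= 1 -> C1_curve_at c t.
Proof.
move=> t01; have [ay _ _] := chart_overlapP (Wt t01).
exact (C1_curve_map sj (C1_curve_param ay (C1_at_line y v t))).
Qed.

Lemma segment_connection t : 0 <= t <= 1 ->
  curve_connection g b c t = pulled_connection (y + t *: v) v.
Proof.
move=> t01; rewrite /curve_connection /pulled_connection; congr connection_mx.
have dF := smooth_mx_differentiable smooth_map_in (Wt t01).
rewrite derive1E -(deriveEjacobian v dF).
by have [_ E] := is_derive_line dF; exact E.
Qed.

(** A single parallel frame along the whole segment is read off at time [s], so that the transports
    to the intermediate points form a differentiable family. [U] is this frame in the fixed chart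
    [b]. *)
Lemma segment_frame : exists P : R -> 'M[R]_(n + n),
  (forall s : R, 0 < s <= 1 ->
     [/\ transport_mx (g := g) (j \o (param L a \o (fun t : R => y + t *: (s *: v)))) (P s),
         Jlinear (P s) & P s *m g (c s) *m (P s)^T = g (c 0)]) /\
  (forall s : R, 0 < s < 1 ->
     let U t := P t *m chart_change (chart_at X (c t)) b (c t) in
     is_derive s 1 U (U s *m (- pulled_connection (y + s *: v) v))).
Proof.
have cP t : 0 <= t <= 1 -> [/\ C1_curve_at c t, dom X b (c t) &
     forall i k, `|curve_connection g b c t i k| <= B].
  move=> t01; have [_ _ bt] := chart_overlapP (Wt t01); split=> //.
    exact: segment_C1.
  by move=> i k; rewrite segment_connection//; exact: conn_le.
pose V i := sval (cid (small_parallel riem (delta_mx 0 i) cP Bn)).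
have VP i : [/\ V i 0 = delta_mx 0 i, forall t, 0 <= t <= 1 -> continuous_field `[0, 1] c (V i) t
    & forall t, 0 < t < 1 -> parallel_at g c (V i) t].
  exact (svalP (cid (small_parallel riem (delta_mx 0 i) cP Bn))).
have rc : regular_path c.
  have a01 t : 0 <= t <= 1 -> chart_image a (y + t *: v).
    by move=> /Wt/chart_overlapP[].
  exact (pwC1_regular (pwC1_map sj (pwC1_segment a01))).
exists (fun t => \matrix_i V i t); split=> s s01.
  have [s0 s1] := andP s01.
  have Ws t : 0 <= t <= 1 -> chart_image a (y + t *: (s *: v)).
    move=> /andP[t0 t1]; have st : 0 <= t * s <= 1.
      by rewrite mulr_ge0 ?(ltW s0)// mulr_ile1// ltW.
    by have := Wt st; rewrite -scalerA => /chart_overlapP[].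
  have [Q [TQ JQ IQ]] := transport_mx_exists hX (pwC1_map sj (pwC1_segment Ws)).
  (* [Q] is already known to be complex linear and isometric; its rows are identified with the
     parallel frame at time [s], rescaled to unit time. *)
  have QE : \matrix_i V i s = Q.
    apply/row_matrixP => i; rewrite rowK rowE; apply/TQ.
    have [V0 cV pV] := VP i.
    exists (V i \o affine 0 s); split; last 2 first.
    - by rewrite /= /affine mulr0 addr0.
    - by rewrite /= /affine mulr1 add0r.
    have -> : j \o (param L a \o (fun t : R => y + t *: (s *: v))) = c \o affine 0 s.
      by apply/funext => t; rewrite /= /c /affine add0r scalerA [s * t]mulrC.
    apply: parallel_affine => //; first by rewrite gt_eqF.
    - by rewrite lexx ler01.
    - by rewrite add0r ltW.
    - by apply/parallelP; split=> //; exists [::] => t t01 _; exact: pV.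
  rewrite QE; split=> //.
  by move: IQ; rewrite /c scale0r addr0.
move=> U; have s01' : 0 <= s <= 1 by have [s0 s1] := andP s01; rewrite !ltW.
have [_ bs _] := cP s s01'.
have UE t i : row i (U t) = vector_in b (c t) (V i t).
  by rewrite /U row_mul rowK.
apply/is_derive_mxP => i k; have [_ _ /(_ s s01 b bs)/is_derive_mxP/(_ 0 k) d] := VP i.
have -> : (fun t => U t i k) = (fun t => vector_in b (c t) (V i t) 0 k).
  by apply/funext => t; have /rowP/(_ k) <- := UE t i; rewrite [RHS]mxE.
apply: (is_derive_eq d); have := segment_connection s01'; rewrite /curve_connection => ->.
by rewrite -UE -row_mul mulmxN !mxE.
Qed.

End Segment.

End TransportDeterminant.

(** * The transport determinant in a fixed chart and its derivative *)

Section MaslovPhase.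
Context {R : realType} {n : nat} {X : manifold R (n + n)} {g : X -> 'M[R]_(n + n)}.
Hypothesis hX : calabi_yau g.
Context {L : manifold R n} {j : L -> X}.
Hypothesis hj : lagrangian_embedding g j.
Variables (a : chart L) (b : chart X) (p : L) (f : L -> R[i]).
Hypothesis fP : forall q, transport_det (g := g) (j := j) p q (f q).

Let sj : smooth_map j. Proof. by have [[sj _ _ _] _] := hj. Qed.
Local Notation W := (chart_overlap (j := j) a b).
Local Notation conn := (pulled_connection (g := g) (j := j) a b).

Definition frame_change (y : 'rV[R]_n) : 'M[R]_(n + n) :=
  let x := j (param L a y) in chart_change (chart_at X x) b x.

(** The second factor expresses the final vectors in the fixed chart [b]; [f] alone refers to the
    preferred chart, which may jump from point to point. *)
Definition transport_det_in (y : 'rV[R]_n) : R[i] := f (param L a y) * detC (frame_change y).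

Lemma frame_change_Jlinear y : W y -> Jlinear (frame_change y).
Proof.
move=> /chart_overlapP[_ _ bx].
exact (cy_complex hX (dom_chart_at (j (param L a y))) bx).
Qed.

Lemma frame_change_unit y : W y -> frame_change y \in unitmx.
Proof.
move=> /chart_overlapP[_ _ bx].
exact (chart_change_unit (dom_chart_at (j (param L a y))) bx).
Qed.

Lemma transport_det_in_neq0 y : W y -> transport_det_in y != 0.
Proof.
move=> Wy; apply: mulf_neq0; first exact (transport_det_neq0 hX (fP _)).
exact (detC_neq0 (frame_change_unit Wy) (frame_change_Jlinear Wy)).
Qed.

(** By multiplicativity under concatenation, the value at a point of the segment is [f] at its
    origin times the determinant of the transport along the segment, to which [is_derive_detC]
    applies. *)
Lemma transport_det_in_segment (y v : 'rV[R]_n) (B : R) :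
  (forall t : R, 0 <= t <= 1 -> W (y + t *: v)) ->
  (forall t : R, 0 <= t <= 1 -> forall i k, `|conn (y + t *: v) v i k| <= B) ->
  (n + n)%:R * B <= 2^-1 ->
  forall s : R, 0 < s < 1 -> is_derive_C (fun t => transport_det_in (y + t *: v)) s
    (transport_det_in (y + s *: v) * dlogC (- conn (y + s *: v) v)).
Proof.
move=> Wt cB Bn s s01; have [P [PT PU]] := segment_frame hX sj Wt cB Bn.
have s01' : 0 <= s <= 1 by have [s0 s1] := andP s01; rewrite !ltW.
pose U t := P t *m frame_change (y + t *: v).
have fE t : 0 < t < 1 -> transport_det_in (y + t *: v) = f (param L a y) * detC (U t).
  move=> t01; have t01' : 0 < t <= 1 by have [t0 t1] := andP t01; rewrite t0 ltW.
  have t01'' : 0 <= t <= 1 by have [t0 t1] := andP t01; rewrite !ltW.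
  have [TP JP IP] := PT t t01'.
  rewrite /transport_det_in /U (detC_mul _ (frame_change_Jlinear (Wt t t01''))).
  rewrite mulrA; congr (_ * _); apply: (transport_det_unique hX hj (fP _)).
  apply: (transport_det_mul hX hj (fP (param L a y))).
  exists (param L a \o (fun r : R => y + r *: (t *: v))), (P t); split=> //.
    apply: pwC1_segment => r /andP[r0 r1]; rewrite scalerA.
    have /andP[t0 t1] := t01''.
    have rt : 0 <= r * t <= 1 by rewrite mulr_ge0// mulr_ile1.
    by have [] := chart_overlapP (Wt _ rt).
  by move: IP; rewrite scale0r addr0.
have dU : is_derive_C (fun t => f (param L a y) * detC (U t)) s
    (f (param L a y) * (detC (U s) * dlogC (- conn (y + s *: v) v))).
  apply: is_derive_C_cstM; apply: is_derive_detC; last exact (PU s s01).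
  have := pulled_connection_Jlinear hX v (Wt s s01').
  by rewrite /Jlinear mulmxN mulNmx => ->.
rewrite fE// -mulrA; have [dr di] := dU.
have nE : \forall t \near s, f (param L a y) * detC (U t) = transport_det_in (y + t *: v).
  by apply: filterS (near_itvoo s01) => t t01; rewrite fE.
split.
  by apply: near_eq_is_derive dr; apply: filterS nE => t /= ->.
by apply: near_eq_is_derive di; apply: filterS nE => t /= ->.
Qed.

(** The derivative along a segment is available only at interior times, so [y] is placed in the
    middle of the segment from [y - d *: v] to [y + d *: v] and the result is reparametrized. *)
Lemma transport_det_in_line (y v : 'rV[R]_n) : W y ->
  is_derive_C (fun t : R => transport_det_in (y + t *: v)) 0
    (transport_det_in y * dlogC (- conn y v)).
Proof.
move=> Wy; have oW := open_chart_overlap sj (a := a) (b := b).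
have sc := smooth_pulled_connection hX sj a b v.
pose C : R := \sum_i \sum_k `|conn y v i k| + 1.
have C0 : 0 < C by rewrite ltr_wpDl// sumr_ge0// => i _; rewrite sumr_ge0.
have nC : \forall z \near y, forall i k, `|conn z v i k| <= C.
  apply: (filter_forall (nbhs_filter y)) => i; apply: (filter_forall (nbhs_filter y)) => k.
  have cc : {for y, continuous (fun z => conn z v i k)} by apply: (sc i k 0%N); rewrite inE.
  have := (@cvgrPdist_le _ _ _ (nbhs y) (nbhs_filter y) (fun z => conn z v i k) _).1 cc 1 ltr01.
  apply: filterS => z zy; rewrite -[conn z v i k](subrK (conn y v i k)) addrC.
  apply: le_trans (ler_normD _ _) _; rewrite distrC; apply: lerD zy.
  rewrite (bigD1 i)//= (bigD1 k)//= -addrA lerDl addr_ge0// sumr_ge0// => l _.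
  by rewrite sumr_ge0.
have [e /= e0 eW] := (nbhs_ballP _ _).1 (filterI (open_nbhs_sub oW Wy) nC).
pose N : R := (n + n)%:R; have N0 : 0 <= N by [].
(* The first bound keeps the segment in the ball where the connection is controlled; the second
   makes the connection in the direction [(2 * d) *: v] satisfy the smallness condition. *)
pose d := Num.min (e / (`|v| + 1)) (4 * (N * C + 1))^-1.
have d0 : 0 < d.
  have NC : 0 < N * C + 1 by apply: ltr_wpDl => //; apply: mulr_ge0 => //; exact: ltW.
  by rewrite lt_min divr_gt0 ?ltr_wpDl//= invr_gt0 mulr_gt0.
have dv : d * `|v| < e.
  apply: (@le_lt_trans _ _ (e / (`|v| + 1) * `|v|)).
    by rewrite ler_wpM2r// ge_min lexx.
  by rewrite mulrAC ltr_pdivrMr ?ltr_wpDl// ltr_pM2l// ltrDl.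
have dB : N * (2 * d * C) <= 2^-1.
  have dle : d <= (4 * (N * C + 1))^-1 by rewrite ge_min lexx orbT.
  have NC : 0 <= N * C by rewrite mulr_ge0// ltW.
  have dp : d * (4 * (N * C + 1)) <= 1.
    by rewrite -ler_pdivlMr ?div1r// mulr_gt0// ltr_wpDl.
  have dNC : 0 <= d * (N * C) by apply: mulr_ge0 => //; exact: ltW.
  lra.
pose y' := y - d *: v; pose v' := (2 * d) *: v.
have yE (t : R) : y' + t *: v' = y + ((2 * t - 1) * d) *: v.
  by rewrite /y' /v' scalerA -addrA -scaleNr -scalerDl; congr (_ + _ *: _); ring.
have inB (t : R) : 0 <= t <= 1 -> ball y e (y' + t *: v').
  move=> /andP[t0 t1]; rewrite yE -ball_normE /= opprD addNKr normrN normrZ.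
  apply: le_lt_trans dv; rewrite ler_wpM2r// normrM (gtr0_norm d0) ler_piMl ?(ltW d0)//.
  by rewrite ler_norml; apply/andP; split; lra.
have h01 : 0 < (2^-1 : R) < 1 by rewrite invr_gt0 ltr0n invf_lt1 ?ltr1n.
have Wt t : 0 <= t <= 1 -> W (y' + t *: v') by move=> t01; have [] := eW _ (inB t t01).
have cB t : 0 <= t <= 1 -> forall i k, `|conn (y' + t *: v') v' i k| <= 2 * d * C.
  move=> t01 i k; rewrite pulled_connectionZ mxE normrM.
  have [_ /(_ i k) cC] := eW _ (inB t t01).
  by rewrite gtr0_norm ?mulr_gt0// ler_pM2l// mulr_gt0.
have hd := transport_det_in_segment Wt cB dB h01.
have h0 : y' + (2^-1 : R) *: v' = y.
  by rewrite yE mulfV// subrr mul0r scale0r addr0.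
have hd' : is_derive_C (fun t => transport_det_in (y' + t *: v')) (2^-1 + (2 * d)^-1 * 0)
    (transport_det_in y * dlogC (- conn y v')).
  by rewrite mulr0 addr0; move: hd; rewrite h0.
(* The substitution [t = 1/2 + s / (2 * d)] turns the segment back into the line [y + s *: v]. *)
have hd2 := is_derive_C_affine hd'.
rewrite pulled_connectionZ -scalerN dlogCZ real_complex_cancel in hd2.
  apply: (is_derive_C_eq _ hd2) => s; rewrite yE; congr (transport_det_in (y + _ *: v)).
  by field; rewrite gt_eqF.
by rewrite gt_eqF// mulr_gt0.
Qed.

End MaslovPhase.

Lemma phase_bounds {R : realType} (z : R[i]) : `|z| = 1 ->
  `|complex.Re z| <= 1 /\ `|complex.Im z| <= 1.
Proof.
move=> z1; have := add_Re2_Im2 z; rewrite z1 expr1n => /(congr1 (@complex.Re R)) /= E.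
have s1 (x : R) : x ^+ 2 <= 1 -> `|x| <= 1 by move=> x1; rewrite -(@ler_pXn2r _ 2) ?nnegrE// expr1n -normrX ger0_norm ?sqr_ge0.
split; apply: s1.
  by rewrite -E lerDl sqr_ge0.
by rewrite -E lerDr sqr_ge0.
Qed.

(** In components, this is [th' = (conj tau - tau) * th] for the quotient of [conj f] by [f]. *)
Lemma is_derive_phase {R : realType} (f : R -> R[i]) (t : R) (tau : R[i]) : f t != 0 ->
  is_derive_C f t (f t * tau) ->
  let th s := ((f s)^*)%C / f s in
  is_derive t 1 (@complex.Re R \o th) (2 * complex.Im tau * complex.Im (th t)) /\
  is_derive t 1 (@complex.Im R \o th) (- (2 * complex.Im tau * complex.Re (th t))).
Proof.
move=> f0 [dr di] th.
pose a s := complex.Re (f s); pose b s := complex.Im (f s).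
have fE s : f s = Complex (a s) (b s) by rewrite /a /b; case: (f s).
have thE s : th s = Complex (a s * (a s * (a s * a s + b s * b s)^-1)
    - b s * (b s * (a s * a s + b s * b s)^-1))
  (- (2 * (a s * (b s * (a s * a s + b s * b s)^-1)))).
  rewrite /th fE; apply/eqP; rewrite eq_complex /= -!expr2; apply/andP; split; apply/eqP; ring.
have N0 : a t * a t + b t * b t != 0.
  apply: contra f0 => /eqP N0; rewrite fE eq_complex /=.
  have a0 : a t * a t = 0 by have := sqr_ge0 (a t); have := sqr_ge0 (b t); rewrite !expr2; lra.
  have b0 : b t * b t = 0 by move: N0; rewrite a0 add0r.
  by move/eqP: a0; move/eqP: b0; rewrite !mulf_eq0 !orbb => -> ->.
have da : is_derive t 1 a (a t * complex.Re tau - b t * complex.Im tau).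
  by apply: (is_derive_eq dr); rewrite fE; case: tau {dr di}.
have db : is_derive t 1 b (a t * complex.Im tau + b t * complex.Re tau).
  by apply: (is_derive_eq di); rewrite fE; case: tau {dr di da} => x y /=.
have dN := is_deriveD (is_derive_mul da da) (is_derive_mul db db).
have dV := is_deriveV (f := fun s => a s * a s + b s * b s) N0 dN.
split.
  have -> : @complex.Re R \o th = fun s => a s * (a s * (a s * a s + b s * b s)^-1)
      - b s * (b s * (a s * a s + b s * b s)^-1) by apply/funext => s /=; rewrite thE.
  have := is_deriveB (is_derive_mul da (is_derive_mul da dV)) (is_derive_mul db (is_derive_mul db dV)).
  move=> h; apply: (is_derive_eq h); rewrite thE /= /GRing.scale /=.
  by field.
have -> : @complex.Im R \o th = fun s => - (2 * (a s * (b s * (a s * a s + b s * b s)^-1))).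
  by apply/funext => s /=; rewrite thE.
have := is_deriveN (is_deriveZ 2 (is_derive_mul da (is_derive_mul db dV))).
move=> h; apply: (is_derive_eq h); rewrite thE /= /GRing.scale /=.
by field.
Qed.

(** The real factor [s] disappears from the phase, and since [c'] is the inverse of [c], the chart
    change moves from the frame at the end point to the transport determinant. *)
Lemma phase_factor {R : realType} (dq dp ph e c c' : R[i]) (s : R) :
  s != 0 -> dp != 0 -> ph != 0 -> e != 0 -> c * c' = 1 ->
  dq = real_complex R s * e * c' ->
  dq / (dp * ph) / ((dq / (dp * ph))^*)%C
  = (dp^*)%C / dp * (e / (e^*)%C) * (((ph * c)^*)%C / (ph * c)).
Proof.
move=> s0 dp0 ph0 e0 cc E.
have c0 : c != 0 by apply: contra_eq_neq cc => ->; rewrite mul0r eq_sym oner_eq0.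
have sc0 : real_complex R s != 0 by rewrite (inj_eq (@complexI R)).
have wE : dq / (dp * ph) = real_complex R s * (e / (dp * (ph * c))).
  have c'E : c' = c^-1 by apply: (mulfI c0); rewrite cc divff.
  by rewrite E c'E; field; rewrite dp0 ph0 c0.
have conjM (u v : R[i]) : ((u * v)^*)%C = (u^*)%C * (v^*)%C by exact (rmorphM (@Num.conj R[i]) u v).
have conjV (u : R[i]) : ((u^-1)^*)%C = ((u^*)%C)^-1 by exact (fmorphV (@Num.conj R[i]) u).
have conj0 (u : R[i]) : u != 0 -> (u^*)%C != 0.
  by move=> u0; rewrite -(fmorph_eq0 (@Num.conj R[i])) in u0.
have sconj : ((real_complex R s)^*)%C = real_complex R s by apply/eqP; rewrite eq_complex /= oppr0 !eqxx.
rewrite wE !conjM conjV !conjM sconj.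
move: (conj0 _ dp0) (conj0 _ ph0) (conj0 _ e0) (conj0 _ c0).
move: (dp^*)%C (ph^*)%C (e^*)%C (c^*)%C => dp' ph' e' d' dp'0 ph'0 e'0 d'0.
rewrite -mulf_div divff// mul1r.
by field; rewrite dp0 ph0 c0 e'0 dp'0 ph'0 d'0.
Qed.

Lemma Ck_local {R : realType} k m (U : set 'rV[R]_m) (f : 'rV[R]_m -> R) :
  (forall x, U x -> exists2 V : set 'rV[R]_m, V x & open V /\ Ck k V f) -> Ck k U f.
Proof.
elim: k f => [|k IH] f loc /=.
  by move=> x; rewrite inE => /loc[V Vx [_]]; apply; rewrite inE.
split=> [x /loc[V Vx [_ [df _]]]|i]; first exact: df.
by apply: IH => x /loc[V Vx [oV [_ pf]]]; exists V => //; split=> //; exact: pf.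
Qed.

(** * Smoothness in charts of the Lagrangian *)

Section MaslovSmooth.
Context {R : realType} {n : nat} {X : manifold R (n + n)} {g : X -> 'M[R]_(n + n)}.
Hypothesis hX : calabi_yau g.
Context {L : manifold R n} {j : L -> X}.
Hypothesis hj : lagrangian_embedding g j.

Let sj : smooth_map j. Proof. by have [[sj _ _ _] _] := hj. Qed.

Section Charts.
Variables (a : chart L) (b : chart X).
Local Notation W := (chart_overlap (j := j) a b).
Local Notation conn := (pulled_connection (g := g) (j := j) a b).
Local Notation F := (map_in (j := j) a b).

Lemma differential_chart y : W y -> let q := param L a y in
  differential j q = chart_change (chart_at L q) a q *m 'J F y
    *m chart_change b (chart_at X (j q)) (j q).
Proof.
move=> Wy q; have [ay aq bq] := chart_overlapP Wy; have cj := sj.1.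
pose a' := chart_at L q; pose b' := chart_at X (j q).
have a'q : dom L a' q := dom_chart_at q; have b'q : dom X b' (j q) := dom_chart_at (j q).
have yE : (coord L a \o param L a') (coord L a' q) = y.
  by rewrite /= coordK // paramK.
have dF : differentiable F ((coord L a \o param L a') (coord L a' q)).
  by rewrite yE; exact (smooth_mx_differentiable (smooth_map_in sj a b) Wy).
have d1 := transition_differentiable a'q aq; have d2 := transition_differentiable bq b'q.
have FE : F ((coord L a \o param L a') (coord L a' q)) = coord X b (j q) by rewrite yE.
have d21 : differentiable ((coord X b' \o param X b) \o F) ((coord L a \o param L a') (coord L a' q)).
  by apply: differentiable_comp; [exact: dF|rewrite FE; exact: d2].
have dc : differentiable (((coord X b' \o param X b) \o F) \o (coord L a \o param L a')) (coord L a' q).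
  exact: differentiable_comp.
have E : 'J (((coord X b' \o param X b) \o F) \o (coord L a \o param L a')) (coord L a' q)
    = chart_change a' a q *m 'J F y *m chart_change b b' (j q).
  rewrite (jacobian_comp d1 d21) (jacobian_comp dF); last by rewrite FE.
  by rewrite FE yE mulmxA.
rewrite -E; apply/esym/near_eq_jacobian => //.
have pa : {for coord L a' q, continuous (param L a')}.
  by apply: param_continuous_at; exact: coord_image.
have n1 : \forall x \near q, dom L a x /\ dom X b (j x).
  by apply: filterI; [exact (open_nbhs_sub (dom_open a) aq)|exact (cj q _ (open_nbhs_sub (dom_open b) bq))].
have qE : param L a' (coord L a' q) = q by rewrite coordK.
have n2 : \forall x \near param L a' (coord L a' q), dom L a x /\ dom X b (j x) by rewrite qE.
apply: (@filterS _ (nbhs (coord L a' q)) (nbhs_filter _) _ _ _ (pa _ n2)) => z [az bz].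
by rewrite /= /map_in coordK//= coordK.
Qed.

Variables (p : L) (f : L -> R[i]).
Hypothesis fP : forall q, transport_det (g := g) (j := j) p q (f q).
Local Notation Phi := (transport_det_in (j := j) a b f).

Lemma smooth_phase : smooth_C_on W (fun y => ((Phi y)^*)%C / Phi y).
Proof.
have oW := open_chart_overlap sj (a := a) (b := b).
pose th y := ((Phi y)^*)%C / Phi y.
(* With [tau] the derivative of the logarithm of [Phi] in direction [i], [mu i] is [- 2 Im tau], the
   sign that brings the equation of the phase to the form required by [smooth_rotation]. *)
pose mu i y := - (2 * complex.Im (dlogC (- conn y (delta_mx 0 i)))).
have muE y v : 2 * complex.Im (dlogC (- conn y v)) = - \sum_i v 0 i * mu i y.
  have -> : - conn y v = \sum_i v 0 i *: (- conn y (delta_mx 0 i)).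
    by rewrite pulled_connection_sum -sumrN; apply: eq_bigr => i _; rewrite scalerN.
  rewrite dlogC_Im_sum mulr_sumr -sumrN; apply: eq_bigr => i _.
  by rewrite /mu mulrN opprK mulrCA.
have smu i : smooth_on W (mu i).
  move=> k; apply: (Ck_eq (f := fun y => - (2 * \sum_(e : 'I_(n + n) * 'I_(n + n))
      (- conn y (delta_mx 0 i) e.1 e.2) * complex.Im (dlogC (delta_mx e.1 e.2))))) => //.
    move=> y _; rewrite /mu [in RHS]dlogC_sum; congr (- (2 * _)).
    by apply: eq_bigr => e _; rewrite [in RHS]mxE.
  apply: Ck_opp => //; apply: Ck_mul => //; first exact: Ck_cst.
  apply: Ck_sum => // e; apply: Ck_mul => //; last exact: Ck_cst.
  by apply: Ck_opp => //; exact (smooth_pulled_connection hX sj a b (delta_mx 0 i) e.1 e.2 k).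
have th1 y : W y -> `|th y| = 1.
  move=> Wy; have P0 := transport_det_in_neq0 hX fP Wy.
  rewrite /th -(phase_norm (w := ((Phi y)^*)%C)); first by rewrite conjcK.
  by rewrite -(fmorph_eq0 (@Num.conj R[i])) in P0.
have dth y v : W y ->
    is_derive (0 : R) 1 (fun t => complex.Re (th (y + t *: v))) (\sum_i v 0 i * (- mu i y * complex.Im (th y))) /\
    is_derive (0 : R) 1 (fun t => complex.Im (th (y + t *: v))) (\sum_i v 0 i * (mu i y * complex.Re (th y))).
  move=> Wy; have P0 := transport_det_in_neq0 hX fP Wy.
  have E0 : y + (0 : R) *: v = y by rewrite scale0r addr0.
  have P0' : Phi (y + (0 : R) *: v) != 0 by rewrite E0.
  have dP : is_derive_C (fun t : R => Phi (y + t *: v)) 0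
      (Phi (y + (0 : R) *: v) * dlogC (- conn y v)).
    by rewrite E0; exact (transport_det_in_line hX hj fP v Wy).
  have [dr di] := is_derive_phase (f := fun t : R => Phi (y + t *: v)) P0' dP.
  split.
    apply: (is_derive_eq dr); rewrite E0 muE mulNr mulr_suml -sumrN; apply: eq_bigr => i _.
    by ring.
  apply: (is_derive_eq di); rewrite E0 muE mulNr opprK mulr_suml; apply: eq_bigr => i _.
  by rewrite mulrA.
have [s1 s2] := smooth_rotation oW smu
  (fun y Wy => (phase_bounds (th1 y Wy)).1) (fun y Wy => (phase_bounds (th1 y Wy)).2)
  (fun y v Wy => (dth y v Wy).1) (fun y v Wy => (dth y v Wy).2).
by split; [exact s1|exact s2].
Qed.

(** Three factors: a constant from the base point, the phase of the Jacobian of the embedding in the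
    charts [a] and [b], which is smooth by inspection, and the transport phase treated in
    [smooth_phase]. *)
Lemma maslov_chart (M : L -> circle R) y : maslov_map g j p M -> W y ->
  val (M (param L a y)) = ((\det (complexify (differential j p)))^*)%C / \det (complexify (differential j p))
    * (\det (complexify ('J F y)) / ((\det (complexify ('J F y)))^*)%C)
    * (((Phi y)^*)%C / Phi y).
Proof.
move=> hM Wy; rewrite (maslov_mapE hX hj hM (fP _)) /transport_det_in.
have d0 x : \det (complexify (differential j x)) != 0.
  exact (det_complexify_neq0 (metric_posdef hX _) (cy_hermitian hX _) (differential_frame hj x)).
have [ay aq bq] := chart_overlapP Wy.
pose q := param L a y; have b'q : dom X (chart_at X (j q)) (j q) := dom_chart_at (j q).
have JC : Jlinear (chart_change b (chart_at X (j q)) (j q)) := cy_complex hX bq b'q.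
have E : \det (complexify (differential j q)) = real_complex R (\det (chart_change (chart_at L q) a q))
    * \det (complexify ('J F y)) * detC (chart_change b (chart_at X (j q)) (j q)).
  have -> := differential_chart Wy.
  rewrite (complexifyM _ JC) complexifyMl !det_mulmx det_map_mx detCE.
  by [].
have s0 : \det (chart_change (chart_at L q) a q) != 0.
  rewrite -unitfE -unitmxE; exact (chart_change_unit (dom_chart_at q) aq).
have cc : detC (frame_change (j := j) a b y) * detC (chart_change b (chart_at X (j q)) (j q)) = 1.
  by rewrite -(detC_mul _ JC) /frame_change chart_changeK// detC1.
have e0 : \det (complexify ('J F y)) != 0.
  by apply: contra_neq (d0 q) => e0; rewrite E e0 mulr0 mul0r.
exact (phase_factor s0 (d0 p) (transport_det_neq0 hX (fP q)) e0 cc E).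
Qed.

Lemma maslov_chart_smooth (M : L -> circle R) : maslov_map g j p M ->
  smooth_C_on W (fun y => val (M (param L a y))).
Proof.
move=> hM; have oW := open_chart_overlap sj (a := a) (b := b).
have sJ := smooth_jacobian oW (smooth_map_in sj a b).
have e0 y : W y -> \det (complexify ('J F y)) != 0.
  move=> Wy; have [ay aq bq] := chart_overlapP Wy.
  have := det_complexify_neq0 (metric_posdef hX _) (cy_hermitian hX _) (differential_frame hj (param L a y)).
  rewrite (differential_chart Wy) (complexifyM _ (cy_complex hX bq (dom_chart_at _))) complexifyMl.
  by rewrite !det_mulmx; apply: contra_neq => ->; rewrite mulr0 mul0r.
have se : smooth_C_on W (fun y => \det (complexify ('J F y))).
  by apply: smooth_C_det => // i k; apply: smooth_C_complexify.
apply: (smooth_C_eq oW (fun y Wy => esym (maslov_chart hM Wy))).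
apply: smooth_C_mul => //; last exact smooth_phase.
apply: smooth_C_mul => //; first exact: smooth_C_cst.
apply: smooth_C_mul => //; apply: smooth_C_inv => //; last exact: smooth_C_conj.
by move=> y /e0; rewrite -(fmorph_eq0 (@Num.conj R[i])).
Qed.

End Charts.

(** The target chart depends on the point, so smoothness on the image of [a] is obtained locally, on
    the overlap with a chart around each image point. *)
Lemma maslov_smooth (hL : connected [set: L]) p (M : L -> circle R) :
  maslov_map g j p M -> smooth_circle_map M.
Proof.
move=> hM a; pose f q := sval (cid (transport_det_exists hX hL hj p q)).
have fP q : transport_det (g := g) (j := j) p q (f q) := svalP (cid (transport_det_exists hX hL hj p q)).
have loc y : chart_image a y -> exists2 V : set 'rV[R]_n, V y &
    open V /\ smooth_C_on V (fun y => val (M (param L a y))).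
  move=> ay; pose b := chart_at X (j (param L a y)).
  exists (chart_overlap (j := j) a b); last first.
    by split; [exact (open_chart_overlap sj (a := a) (b := b))|exact (maslov_chart_smooth a b fP hM)].
  exists (param L a y); last exact: paramK.
  by split; [exact: param_dom|exact: dom_chart_at].
by split=> k; apply: Ck_local => y /loc[V Vy [oV [sr si]]]; exists V.
Qed.

End MaslovSmooth.

(** * The pulled back form and class *)

(** Up to the factor [1 / (2 pi)], the form is the imaginary part of [conj z * w], which a rotation
    multiplies by the squared modulus of [c]. *)
Lemma alpha_rotation {R : realType} (c z w : R[i]) : `|c| = 1 -> alpha (c * z) (c * w) = alpha z w.
Proof.
move=> c1; have := add_Re2_Im2 c; rewrite c1 expr1n => /(congr1 (@complex.Re R)) /= E.
rewrite /alpha; congr (_ * _); case: c E {c1} => a b /= E; case: z w => x y [u v] /=.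
rewrite (_ : _ - _ = (a ^+ 2 + b ^+ 2) * (x * v - y * u)); first by rewrite E mul1r.
by ring.
Qed.

Lemma derive_C_rotation {R : realType} m (c : R[i]) (f : 'rV[R]_m -> R[i]) y v :
  differentiable (@complex.Re R \o f) y -> differentiable (@complex.Im R \o f) y ->
  derive_C v (fun x => c * f x) y = c * derive_C v f y.
Proof.
move=> dr di; case: c => a b.
have dr' := differentiable_is_derive v dr; have di' := differentiable_is_derive v di.
apply/eqP; rewrite eq_complex /=; apply/andP; split; apply/eqP.
  have -> : @complex.Re R \o (fun x => Complex a b * f x)
    = fun x => a * (@complex.Re R \o f) x + (- b) * (@complex.Im R \o f) x.
    by apply/funext => s /=; case: (f s) => p q /=; rewrite mulNr.
  have [_ E] := is_deriveD (is_deriveZ a dr') (is_deriveZ (- b) di').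
  by apply: etrans E _; rewrite /GRing.scale /= mulNr.
have -> : @complex.Im R \o (fun x => Complex a b * f x)
  = fun x => a * (@complex.Im R \o f) x + b * (@complex.Re R \o f) x.
  by apply/funext => s /=; case: (f s) => p q /=.
by have [_ E] := is_deriveD (is_deriveZ a di') (is_deriveZ b dr'); apply: etrans E _.
Qed.

Lemma pullback_alpha_rotation {R : realType} m (L : manifold R m) (M M' : L -> circle R) (c : R[i]) :
  `|c| = 1 -> smooth_circle_map M -> (forall q, val (M' q) = c * val (M q)) ->
  forall q u, pullback_alpha M q u = pullback_alpha M' q u.
Proof.
move=> c1 sM MM q u; rewrite /pullback_alpha MM.
have -> : (fun y => val (M' (param L (chart_at L q) y)))
  = (fun y => c * val (M (param L (chart_at L q) y))) by apply/funext => y; exact: MM.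
have [/(_ 1%N)[dr _] /(_ 1%N)[di _]] := sM (chart_at L q).
have aq := coord_image (dom_chart_at q).
by rewrite (derive_C_rotation _ _ (dr _ aq) (di _ aq)) alpha_rotation.
Qed.

Lemma normc_le {R : realType} (z : R[i]) :
  `|z| <= real_complex R (`|complex.Re z| + `|complex.Im z|).
Proof.
rewrite normc_def lecR -[leRHS]ger0_norm ?addr_ge0// -sqrtr_sqr ler_wsqrtr//.
rewrite sqrrD !real_normK ?num_real//.
by rewrite addrAC lerDl mulrn_wge0// mulr_ge0.
Qed.

(** * Topology of the circle and rotations *)

Section CircleTopology.
Context {R : realType}.
Local Notation C := (R[i]^o).

Lemma cvg_circle (T : Type) (F : set_system T) (f : T -> circle R) (w : circle R) : Filter F ->
  (fun x => val (f x) : C) @ F --> (val w : C) -> f @ F --> w.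
Proof.
move=> FF cf U [V /= [[W oW <-]]] /= Ww WU; apply: (filterS WU); apply: cf.
exact: open_nbhs_nbhs.
Qed.

Lemma circle_val_cvg (T : Type) (F : set_system T) (f : T -> circle R) (w : circle R) : Filter F ->
  f @ F --> w -> (fun x => val (f x) : C) @ F --> (val w : C).
Proof.
move=> FF cf; have cv : {for w, continuous (set_val : circle R -> C)}.
  exact: initial_continuous.
exact: (cvg_comp _ _ cf cv).
Qed.

Lemma cvg_complex (T : Type) (F : set_system T) (u : T -> R[i]) (z : R[i]) : Filter F ->
  (fun x => complex.Re (u x)) @ F --> complex.Re z ->
  (fun x => complex.Im (u x)) @ F --> complex.Im z ->
  (fun x => u x : C) @ F --> (z : C).
Proof.
move=> FF cr ci; apply/cvgrPdist_lt => /= e e0.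
(* In the order of [R[i]] a positive number is real, so the estimate reduces to real numbers. *)
have /andP[/eqP ei er] : (complex.Im e == 0) && (0 < complex.Re e) by move: e0; rewrite ltcE.
have eE : e = real_complex R (complex.Re e) by apply/eqP; rewrite eq_complex /= ei !eqxx.
have e2 : 0 < complex.Re e / 2 by rewrite divr_gt0.
have /(_ _ e2) nr := (cvgrPdist_lt (FF := FF) (fun x => complex.Re (u x)) (complex.Re z)).1 cr.
have /(_ _ e2) ni := (cvgrPdist_lt (FF := FF) (fun x => complex.Im (u x)) (complex.Im z)).1 ci.
apply: filterS2 nr ni => x xr xi; rewrite eE; apply: le_lt_trans (normc_le _) _.
rewrite ltcR [complex.Re e]splitr; apply: ltrD.
  by move: xr; case: (z) (u x) => a b [a' b'].
by move: xi; case: (z) (u x) => a b [a' b'].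
Qed.

Lemma circle_map_continuous m (L : manifold R m) (M : L -> circle R) :
  smooth_circle_map M -> continuous M.
Proof.
move=> sM q; apply: cvg_circle; pose a := chart_at L q.
have aq : dom L a q := dom_chart_at q.
have [/(_ 0%N) sr /(_ 0%N) si] := sM a.
have cc := coord_continuous_at aq.
have nE : \forall x \near q, M (param L a (coord L a x)) = M x.
  by apply: filterS (open_nbhs_sub (dom_open a) aq) => x ax; rewrite coordK.
have qE : M (param L a (coord L a q)) = M q by rewrite coordK.
have aqi : coord L a q \in chart_image a by rewrite inE; exact: coord_image.
apply: cvg_complex.
- have cr : {for q, continuous ((@complex.Re R \o (fun y => val (M (param L a y)))) \o coord L a)}.
    by apply: continuous_comp cc _; exact: sr.
  rewrite -qE; apply: cvg_trans cr; apply: near_eq_cvg.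
  by apply: filterS nE => x /= ->.
- have ci : {for q, continuous ((@complex.Im R \o (fun y => val (M (param L a y)))) \o coord L a)}.
    by apply: continuous_comp cc _; exact: si.
  rewrite -qE; apply: cvg_trans ci; apply: near_eq_cvg.
  by apply: filterS nE => x /= ->.
Qed.

End CircleTopology.

Section Rotation.
Context {R : realType}.
Local Notation C := (R[i]^o).

Definition expi (t : R) : R[i] := Complex (cos t) (sin t).

Lemma norm_expi t : `|expi t| = 1.
Proof. by rewrite normc_def /= cos2Dsin2 sqrtr1. Qed.

Lemma expi_surjective (c : R[i]) : `|c| = 1 -> exists t, c = expi t.
Proof.
move=> c1; have := add_Re2_Im2 c; rewrite c1 expr1n => /(congr1 (@complex.Re R)) /= E.
have [r1 _] := phase_bounds c1; move: r1; rewrite ler_norml => r1.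
have sE : sin (acos (complex.Re c)) = `|complex.Im c|.
  by rewrite sin_acos// -sqrtr_sqr -E addrAC subrr add0r.
have [i0|i0] := leP 0 (complex.Im c).
  exists (acos (complex.Re c)); rewrite /expi acosK// sE ger0_norm//.
  by case: (c).
exists (- acos (complex.Re c)); rewrite /expi cosN sinN acosK// sE ltr0_norm// opprK.
by case: (c).
Qed.

Lemma rotate_subproof t (w : circle R) : (expi t * val w) \in circle R.
Proof. by apply: mem_set; rewrite /circle /= normrM norm_expi mul1r; exact: (set_valP w). Qed.

Definition rotate t (w : circle R) : circle R := SigSub (rotate_subproof t w).

Lemma rotate0 w : rotate 0 w = w.
Proof. by apply: val_inj; rewrite /= /expi cos0 sin0 (_ : Complex 1 0 = 1) ?mul1r. Qed.

Lemma rotate_cvg (T : Type) (F : set_system T) (r : T -> R) (s : T -> circle R) t w : Filter F ->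
  r @ F --> t -> s @ F --> w -> (fun x => rotate (r x) (s x)) @ F --> rotate t w.
Proof.
move=> FF cr cs; apply: cvg_circle => /=.
have ce : (fun x => expi (r x) : C) @ F --> (expi t : C).
  apply: cvg_complex.
    exact (cvg_comp _ _ cr (@continuous_cos R t)).
  exact (cvg_comp _ _ cr (@continuous_sin R t)).
exact (@cvgM (R[i]) _ F FF _ _ _ _ ce (circle_val_cvg FF cs)).
Qed.

End Rotation.

(** * The prism homotopy for singular cochains *)

Section Prism.
Context {R : realType}.

Let o1 : 'I_3 := lift ord0 ord0.
Let o2 : 'I_3 := lift ord0 (lift ord0 ord0).

(** The last two barycentric coordinates on the three sides of a triangle; the maps of the prism
    depend on these two only. *)
Lemma edge_face (i : 'I_3) (t : R) : (face i (edge t) 0 o1, face i (edge t) 0 o2) =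
  if i == ord0 then (1 - t, t) else if i == o1 then (0, t) else (t, 0).
Proof.
have o1E : o1 = lift o2 (lift ord0 ord0) by apply: val_inj.
have o1E' : o1 = lift ord0 ord0 by [].
have o2E : o2 = lift ord0 (lift ord0 ord0) by [].
have o2E' : o2 = lift o1 (lift ord0 ord0) by apply: val_inj.
case: (unliftP ord0 i) => [i' ->|->]; last by rewrite eqxx /face !mxE {1}o1E' {1}o2E !liftK /= !mxE /=.
case: (unliftP ord0 i') => [i'' ->|->]; last first.
  by rewrite /= /face !mxE unlift_none /= {1}o2E' liftK /= !mxE /=.
rewrite (ord1 i'') /= /face !mxE {1}o1E liftK unlift_none /= !mxE /=.
by [].
Qed.

Lemma edge_face0 : face (ord0 : 'I_2) (const_mx 1) = edge (1 : R).
Proof.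
apply/rowP => i; rewrite /face /edge !mxE; case: (unliftP ord0 i) => [k ->|->].
  by rewrite /= mxE.
by rewrite /= subrr.
Qed.

Lemma edge_face1 : face (lift ord0 ord0 : 'I_2) (const_mx 1) = edge (0 : R).
Proof.
apply/rowP => i; rewrite /face /edge !mxE; case: (unliftP (lift ord0 ord0) i) => [k ->|->].
  by rewrite /= mxE (ord1 k) /= subr0.
by [].
Qed.

Lemma simplex1P (x : 'rV[R]_2) : simplex R 1 x ->
  exists2 t : R, 0 <= t <= 1 & x = edge t.
Proof.
move=> [x0 x1]; exists (x 0 (lift ord0 ord0)).
  have := x0 ord0; have := x0 (lift ord0 ord0); move: x1.
  by rewrite big_ord_recl big_ord1 => x1 a b; apply/andP; split; lra.
apply/rowP => i; rewrite mxE; case: (unliftP ord0 i) => [k ->|->] /=.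
  by rewrite (ord1 k).
by move: x1; rewrite big_ord_recl big_ord1 => <-; rewrite addrK.
Qed.

Lemma edge_simplex (t : R) : 0 <= t <= 1 -> simplex R 1 (edge t).
Proof.
move=> /andP[t0 t1]; split=> [i|].
  by rewrite mxE; case: ifP => _ //; rewrite subr_ge0.
by rewrite big_ord_recl big_ord1 !mxE /= subrK.
Qed.

Lemma simplex2_coord (x : 'rV[R]_3) : simplex R 2 x ->
  [/\ 0 <= x 0 o1, 0 <= x 0 o2 & x 0 o1 + x 0 o2 <= 1].
Proof.
move=> [x0 x1]; split; [exact: x0|exact: x0|].
move: x1; rewrite 2!big_ord_recl big_ord1 => <-.
rewrite addrA -addrA lerDr; exact: x0.
Qed.

Lemma edge_continuous : continuous (@edge R).
Proof.
move=> t; apply/(cvg_mxP (FF := nbhs_filter t)) => i k; rewrite mxE; under eq_fun do rewrite mxE.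
case: ifP => _; last exact: cvg_id.
by apply: cvgB; [exact: cvg_cst|exact: cvg_id].
Qed.

(** The common shape of the two triangles of the prism: [u] is the height, that is the fraction of
    the rotation by [phi], and [r] is the position along [s]. *)
Lemma prism_singular (phi : R) (s : 'rV[R]_2 -> circle R) (u r : 'rV[R]_3 -> R) :
  singular s -> continuous u -> continuous r ->
  (forall x, simplex R 2 x -> 0 <= r x <= 1) ->
  singular (fun x => rotate (u x * phi) (s (edge (r x)))).
Proof.
move=> /subspace_continuousP cs cu cr r01; apply/subspace_continuousP => x sx.
have FF : Filter (within (simplex R 2) (nbhs x)) by apply: within_filter; exact: nbhs_filter.
apply: (rotate_cvg (F := within (simplex R 2) (nbhs x))).
  apply: (cvg_within_filter (F := nbhs x)).
  by apply: cvgM; [exact: cu|exact: cvg_cst].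
move=> A /(cs _ (edge_simplex (r01 x sx))) nA.
have cer : {for x, continuous (@edge R \o r)}.
  by apply: continuous_comp; [exact: cr|exact: edge_continuous].
have nA' : nbhs (edge (r x)) (fun z => simplex R 1 z -> A (s z)) := nA.
apply: (@filterS _ (nbhs x) (nbhs_filter x) _ _ _ (cer _ nA')) => z zA sz; apply: zA.
exact: edge_simplex (r01 z sz).
Qed.

(* The prism [0,1] x Delta^1 is cut along its diagonal into two triangles; [z]
   vanishes on the boundary of each. *)
Lemma cocycle_rotate (z : ('rV[R]_2 -> circle R) -> int) (phi : R) (s : 'rV[R]_2 -> circle R) :
  cocycle z -> singular s ->
  let vertical w (x : 'rV[R]_2) := rotate (x 0 (lift ord0 ord0) * phi) w in
  z s - z (fun x => rotate phi (s x)) = z (vertical (s (edge 0))) - z (vertical (s (edge 1))).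
Proof.
move=> [zE zc] cs vertical.
have cc (i : 'I_3) : continuous (fun x : 'rV[R]_3 => x 0 i) by move=> x; exact: matrix_normedtype.coord_continuous.
have cD : continuous (fun x : 'rV[R]_3 => x 0 o1 + x 0 o2).
  by move=> x; exact (cvgD (FF := nbhs_filter x) (cc o1 x) (cc o2 x)).
have r1 x : simplex R 2 x -> 0 <= x 0 o1 + x 0 o2 <= 1.
  by move=> /simplex2_coord[a b ->]; rewrite addr_ge0.
have r2 x : simplex R 2 x -> 0 <= x 0 o2 <= 1.
  by move=> /simplex2_coord[a b ab]; apply/andP; split=> //; lra.
have T1 := zc _ (prism_singular (phi := phi) cs (cc o2) cD r1).
have T2 := zc _ (prism_singular (phi := phi) cs cD (cc o2) r2).
move: T1 T2; rewrite /coboundary !big_ord_recl !big_ord0 !addr0.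
set T1 := fun x : 'rV[R]_3 => rotate (x 0 o2 * phi) (s (edge (x 0 o1 + x 0 o2))).
set T2 := fun x : 'rV[R]_3 => rotate ((x 0 o1 + x 0 o2) * phi) (s (edge (x 0 o2))).
have F1 i t : T1 (face i (edge t)) = let: (a, b) := (if i == ord0 then (1 - t, t) else if i == o1 then (0, t) else (t, 0))
   in rotate (b * phi) (s (edge (a + b))) by rewrite /T1 -(edge_face i t).
have F2 i t : T2 (face i (edge t)) = let: (a, b) := (if i == ord0 then (1 - t, t) else if i == o1 then (0, t) else (t, 0))
   in rotate ((a + b) * phi) (s (edge b)) by rewrite /T2 -(edge_face i t).
have T10 : z (T1 \o face ord0) = z (vertical (s (edge 1))).
  apply: zE => x /simplex1P[t _ ->]; rewrite /= F1 /= subrK /vertical.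
  by rewrite mxE.
(* The diagonal common to the two triangles; its contributions cancel in the difference of the two
   cocycle relations. *)
have T11 : z (T1 \o face o1) = z (T2 \o face o1).
  by apply: zE => x /simplex1P[t _ ->]; rewrite /= F1 F2 /= add0r.
have T12 : z (T1 \o face o2) = z s.
  by apply: zE => x /simplex1P[t _ ->]; rewrite /= F1 /= mul0r rotate0 addr0.
have T20 : z (T2 \o face ord0) = z (fun x => rotate phi (s x)).
  by apply: zE => x /simplex1P[t _ ->]; rewrite /= F2 /= subrK mul1r.
have T22 : z (T2 \o face o2) = z (vertical (s (edge 0))).
  by apply: zE => x /simplex1P[t _ ->]; rewrite /= F2 /= addr0 /vertical mxE.
have e1 : (-1 : int) ^+ o1 = - 1 by [].
have e2 : (-1 : int) ^+ o2 = 1 by [].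
rewrite -/o1 -/o2 T10 T11 T12 T20 T22 expr0 e1 e2 !mul1r !mulN1r.
move: (z _) (z s) (z _) (z _) (z _) => *; lia.
Qed.

Lemma same_class_rotation (T : topologicalType) (M M' : T -> circle R) (c : R[i]) :
  `|c| = 1 -> continuous M -> (forall q, val (M' q) = c * val (M q)) -> same_pullback_class M M'.
Proof.
move=> /expi_surjective[phi cE] cM MM z [zc _].
have M'E q : M' q = rotate phi (M q) by apply: val_inj; rewrite /= MM cE.
pose vertical w (x : 'rV[R]_2) := rotate (x 0 (lift ord0 ord0) * phi) w.
(* [const_mx 1] is the only point of the standard 0-simplex. The cochain evaluates [z] on the path
   swept by that vertex under the rotation; the sign is opposite because face 0 of an edge is its
   end point. *)
exists (fun tau : 'rV[R]_1 -> T => - z (vertical (M (tau (const_mx 1))))).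
  move=> sigma tau st; rewrite st//; split=> [i|]; first by rewrite mxE.
  by rewrite big_ord1 mxE.
move=> sigma cs; rewrite /coboundary big_ord_recl big_ord1 /= edge_face0 edge_face1.
have cMs : singular (M \o sigma).
  move: cs => /subspace_continuousP cs'; apply/subspace_continuousP => x sx.
  exact (cvg_comp _ _ (cs' x sx) (cM (sigma x))).
have := cocycle_rotate phi zc cMs; rewrite -/vertical /= => E.
have -> : M' \o sigma = (fun x => rotate phi (M (sigma x))) by apply/funext => x; exact: M'E.
by rewrite E expr0 expr1 mul1r mulN1r opprK addrC.
Qed.

End Prism.

Theorem mainTheorem2 (R : realType) (n : nat)
    (X : manifold R (n + n)) (g : X -> 'M[R]_(n + n)) (hX : calabi_yau g)
    (L : manifold R n) (hL : connected [set: L])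
    (j : L -> X) (hj : lagrangian_embedding g j) :
  (forall p : L,
    [/\ forall (q : L) (gamma : R -> L), pwC1_path gamma p q ->
          lagrangian_subspace g (j q) (transported g j p gamma),
        forall (q : L) (gamma gamma' : R -> L) (A A' : 'M[R]_(n + n)),
          comparison g j p q gamma A -> comparison g j p q gamma' A' ->
          circle R (detC A ^+ 2) /\ detC A ^+ 2 = detC A' ^+ 2,
        exists! M : L -> circle R, maslov_map g j p M &
        forall M : L -> circle R, maslov_map g j p M -> smooth_circle_map M]) /\
  (forall (p p' : L) (M M' : L -> circle R),
    maslov_map g j p M -> maslov_map g j p' M' ->
    (forall (q : L) (u : 'rV[R]_n),
       pullback_alpha M q u = pullback_alpha M' q u) /\
    same_pullback_class M M').
Proof.
split=> [p|p p' M M' hM hM'].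
  split.
  - by move=> q gamma pg; exact (transported_lagrangian hX hj pg).
  - by move=> q gamma gamma' A A' cA cA'; exact (comparison_circle hX hL hj cA cA').
  - exact (maslov_map_unique hX hL hj p).
  - by move=> M hM; exact (maslov_smooth hX hj hL hM).
have sM := maslov_smooth hX hj hL hM.
have [c c1 MM] := maslov_map_basepoint hX hL hj hM hM'.
split; first exact (pullback_alpha_rotation c1 sM MM).
exact (same_class_rotation c1 (circle_map_continuous sM) MM).
Qed.
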